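(* Let $0<\alpha\le 1$, $1\le p\le 6$ an integer, $q\in\{1,2\}$, $\lambda\in\mathbb{C}$ with $\mathrm{Re}(\lambda)<0$, and let $\rho,\kappa$ be constants. Let $\omega(p,\alpha,1,z)=\sum_{n\ge 0}\omega^{(\alpha)}_n z^n$ be either the fractional backward difference generating function or the generalized Newton--Gregory generating function of order $p$ (both given in the context). Let $m,m_u,m_f$ be the numbers of correction terms, with exponents $0<\sigma_1<\sigma_2<\cdots$ and $0<\delta_1<\delta_2<\cdots$, $\delta_r\in\{\sigma_k\}\cup\{\sigma_k-\alpha\}$. Define $$\mathbb{S}=\mathbb{C}\setminus\left\{\xi\ \Big|\ \xi^{\alpha}=\frac{\omega(p,\alpha,1,z)}{(\lambda+\rho)-(\rho+\kappa)(1-z)^q}\ \text{ for some } |z|\le 1\right\}.$$ If the step size $\tau>0$ satisfies $\tau\in\mathbb{S}$, and $\sigma_m<\alpha+p$, $\sigma_{m_u}<q$, $\delta_{m_f}<q$, then the semi-implicit method with correction terms $$D_{\tau}^{(\alpha,n,m,\sigma)}U=\lambda U_n+F_n-E^{n,m_f,\delta}_q(F)-\kappa E^{n,m_u,\sigma}_q(U),\qquad F_n=\rho U_n,$$ for the model problem ${}_{C}D^{\alpha}_{0,t}u(t)=(\lambda+\rho)u(t)$ is stable.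
   Context: Caputo derivative: ${}_{C}D^{\alpha}_{0,t}u(t)=\frac{1}{\Gamma(1-\alpha)}\int_0^t (t-s)^{-\alpha}u'(s)\,ds$ for $0<\alpha<1$ (and $u'(t)$ for $\alpha=1$). $U_n$ approximates $u(t_n)$, $t_n=n\tau$. Generating functions. Fractional backward difference formula of order $p$: $\omega(p,\alpha,1,z)=\left(\sum_{k=1}^p\frac1k(1-z)^k\right)^{\alpha}$. Generalized Newton--Gregory formula of order $p$: $\omega(p,\alpha,1,z)=(1-z)^{\alpha}\sum_{k=1}^p g^{(\alpha)}_{k-1}(1-z)^{k-1}$, with $g^{(\alpha)}_0=1$, $g^{(\alpha)}_1=\frac{\alpha}{2}$, $g^{(\alpha)}_2=\frac{\alpha^2}{8}+\frac{5\alpha}{24}$, $g^{(\alpha)}_3=\frac{\alpha^3}{48}+\frac{5\alpha^2}{48}+\frac{\alpha}{8}$, $g^{(\alpha)}_4=\frac{\alpha^4}{384}+\frac{5\alpha^3}{192}+\frac{97\alpha^2}{1152}+\frac{251\alpha}{2880}$, $g^{(\alpha)}_5=\frac{\alpha^5}{3840}+\frac{5\alpha^4}{1152}+\frac{61\alpha^3}{2304}+\frac{401\alpha^2}{5760}+\frac{19\alpha}{288}$. The powers are the analytic branches on $|z|<1$ that are positive at $z=0$, extended continuously to $|z|\le 1$; $\omega^{(\alpha)}_n$ are the Taylor coefficients at $z=0$. Discrete fractional operator with corrections: $$D_{\tau}^{(\alpha,n,m,\sigma)}U=\frac{1}{\tau^{\alpha}}\sum_{j=0}^{n}\omega^{(\alpha)}_{n-j}(U_j-U_0)+\frac{1}{\tau^{\alpha}}\sum_{j=1}^{m}w^{(\alpha)}_{n,j}(U_j-U_0),$$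 where for each $n$ the starting weights $w^{(\alpha)}_{n,1},\dots,w^{(\alpha)}_{n,m}$ are determined by the linear system $$\sum_{j=0}^{n}\omega^{(\alpha)}_{n-j}j^{\sigma_r}+\sum_{j=1}^{m}w^{(\alpha)}_{n,j}j^{\sigma_r}=\frac{\Gamma(\sigma_r+1)}{\Gamma(\sigma_r+1-\alpha)}n^{\sigma_r-\alpha},\qquad r=1,\dots,m.$$ Perturbations: $E^n_1(U)=U_n-U_{n-1}$, $E^n_2(U)=U_n-2U_{n-1}+U_{n-2}$. With corrections, $$E^{n,m_u,\sigma}_q(U)=E^n_q(U)-\sum_{j=1}^{m_u}w^{(u)}_{n,j}(U_j-U_0),\qquad E^{n,m_f,\delta}_q(F)=E^n_q(F)-\sum_{j=1}^{m_f}w^{(f)}_{n,j}(F_j-F_0),$$ where $w^{(u)}_{n,j}$ are chosen such that $E^{n,m_u,\sigma}_q(u)=0$ for $u=t^{\sigma_r}$ (sampled at the grid points), $r=1,\dots,m_u$, and $w^{(f)}_{n,j}$ such that $E^{n,m_f,\delta}_q(f)=0$ for $f=t^{\delta_r}$, $r=1,\dots,m_f$. If a number of correction terms is $0$, the corresponding sum is empty and the corresponding condition on exponents is void. The condition $\tau\in\mathbb{S}$ is understood as: $\omega(p,\alpha,1,z)-\tau^{\alpha}\left[(\lambda+\rho)-(\rho+\kappa)(1-z)^q\right]\ne 0$ for all complex $z$ with $|z|\le 1$ (this fixes the meaning where the denominator vanishes). Stable means: for arbitrary given starting values $U_0,\dots,U_{n_*-1}$, with $n_*=\max\{m+1,m_u+1,m_f+1,q\}$,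 the numerical solution generated by the method for $n\ge n_*$ satisfies $U_n\to 0$ as $n\to\infty$. *)

(* Defs.v *)
From Stdlib Require Import Reals Arith.
From Coquelicot Require Import Coquelicot.

Open Scope R_scope.

(* Real power on [0, +oo) with 0^s = 0, used for the monomials t^s, s > 0, at
   t = 0; Stdlib has Rpower 0 s = 1. *)
Definition rpow (x s : R) : R := if Rle_dec x 0 then 0 else Rpower x s.

Definition Gamma (x : R) : R :=
  RInt_gen (fun t => Rpower t (x - 1) * exp (- t))
           (at_right 0) (Rbar_locally p_infty).

Definition Cexp (z : C) : C := (exp (Re z) * cos (Im z), exp (Re z) * sin (Im z)).

(* csum a m n = a m + ... + a n, equal to 0 when n < m. *)
Definition csum (a : nat -> C) (m n : nat) : C :=
  @sum_n_m C_AbelianMonoid a m n.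

(** * Generating functions *)

(* f is the branch of b^alpha that is analytic on the open unit disk and positive
   at 0, extended continuously to the closed disk.  Here L is an analytic
   logarithm of b; values of f outside the closed disk are irrelevant. *)
Definition is_power_branch (b : C -> C) (alpha : R) (f : C -> C) : Prop :=
  (exists L : C -> C,
     forall z : C, Cmod z < 1 ->
       @ex_derive C_AbsRing C_NormedModule L z /\
       Cexp (L z) = b z /\
       f z = Cexp (RtoC alpha * L z)%C) /\
  (0 < Re (f (RtoC 0)) /\ Im (f (RtoC 0)) = 0) /\
  (forall z : C, Cmod z <= 1 ->
     filterlim f (within (fun y : C => Cmod y <= 1) (locally z)) (locally (f z))).

Definition fbdf_base (p : nat) (z : C) : C :=
  csum (fun k => RtoC (/ INR k) * (1 - z) ^ k)%C 1 p.

Definition is_fbdf (p : nat) (alpha : R) (omega : C -> C) : Prop :=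
  is_power_branch (fbdf_base p) alpha omega.

Definition ng_coef (k : nat) (a : R) : R :=
  match k with
  | 0%nat => 1
  | 1%nat => a / 2
  | 2%nat => a ^ 2 / 8 + 5 * a / 24
  | 3%nat => a ^ 3 / 48 + 5 * a ^ 2 / 48 + a / 8
  | 4%nat => a ^ 4 / 384 + 5 * a ^ 3 / 192 + 97 * a ^ 2 / 1152 + 251 * a / 2880
  | 5%nat => a ^ 5 / 3840 + 5 * a ^ 4 / 1152 + 61 * a ^ 3 / 2304
         + 401 * a ^ 2 / 5760 + 19 * a / 288
  | _ => 0 (* not used: the order p is at most 6 *)
  end.

Definition is_newton_gregory (p : nat) (alpha : R) (omega : C -> C) : Prop :=
  exists f : C -> C,
    is_power_branch (fun z => 1 - z)%C alpha f /\
    forall z : C, Cmod z <= 1 ->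
      omega z =
      (f z * csum (fun k => RtoC (ng_coef (k - 1) alpha) * (1 - z) ^ (k - 1)) 1 p)%C.

Definition is_taylor_coef (omega : C -> C) (om : nat -> C) : Prop :=
  forall z : C, Cmod z < 1 ->
    @is_pseries C_AbsRing C_NormedModule om z (omega z).

(** * The step-size condition *)

(* tau lies in S, i.e. tau^alpha is not of the form omega z / denominator with
   |z| <= 1; the cross-multiplied form settles the case of a zero denominator. *)
Definition step_admissible (omega : C -> C) (alpha : R) (q : nat)
    (lambda rho kappa : C) (tau : R) : Prop :=
  forall z : C, Cmod z <= 1 ->
    (omega z - RtoC (Rpower tau alpha)
                 * ((lambda + rho) - (rho + kappa) * (1 - z) ^ q))%C <> RtoC 0.

(** * The method *)

(* om : Taylor coefficients; w : starting weights at the index n. *)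
Definition frac_op (tau alpha : R) (om : nat -> C) (m : nat) (w : nat -> C)
    (U : nat -> C) (n : nat) : C :=
  (/ RtoC (Rpower tau alpha) * csum (fun j => om (n - j)%nat * (U j - U 0%nat)) 0 n
   + / RtoC (Rpower tau alpha) * csum (fun j => w j * (U j - U 0%nat)) 1 m)%C.

Definition starting_weights (alpha : R) (om : nat -> C) (m : nat)
    (sigma : nat -> R) (n : nat) (w : nat -> C) : Prop :=
  forall r : nat, (1 <= r <= m)%nat ->
    (csum (fun j => om (n - j)%nat * RtoC (rpow (INR j) (sigma r))) 0 n
     + csum (fun j => w j * RtoC (rpow (INR j) (sigma r))) 1 m)%C
    = RtoC (Gamma (sigma r + 1) / Gamma (sigma r + 1 - alpha)
            * rpow (INR n) (sigma r - alpha)).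

Definition E1 (U : nat -> C) (n : nat) : C := (U n - U (n - 1)%nat)%C.
Definition E2 (U : nat -> C) (n : nat) : C :=
  (U n - RtoC 2 * U (n - 1)%nat + U (n - 2)%nat)%C.

(* Used only for q = 1 and q = 2, and only for n >= q. *)
Definition E (q : nat) : (nat -> C) -> nat -> C :=
  match q with 1%nat => E1 | _ => E2 end.

Definition E_corr (q m : nat) (w : nat -> C) (U : nat -> C) (n : nat) : C :=
  (E q U n - csum (fun j => w j * (U j - U 0%nat)) 1 m)%C.

Definition perturbation_weights (tau : R) (q m : nat) (sigma : nat -> R)
    (n : nat) (w : nat -> C) : Prop :=
  forall r : nat, (1 <= r <= m)%nat ->
    E_corr q m w (fun k => RtoC (rpow (INR k * tau) (sigma r))) n = RtoC 0.

Definition n_star (m mu mf q : nat) : nat :=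
  Nat.max (Nat.max (m + 1) (mu + 1)) (Nat.max (mf + 1) q).

Definition method_at (tau alpha : R) (q : nat) (lambda rho kappa : C)
    (om : nat -> C) (m mu mf : nat) (w wu wf : nat -> C)
    (U : nat -> C) (n : nat) : Prop :=
  let F := fun k => (rho * U k)%C in
  frac_op tau alpha om m w U n =
  (lambda * U n + F n - E_corr q mf wf F n - kappa * E_corr q mu wu U n)%C.

(* Starting values V 0, ..., V (n0 - 1), then the scheme eqn U n for n >= n0. *)
Definition is_numerical_solution (n0 : nat) (eqn : (nat -> C) -> nat -> Prop)
    (V U : nat -> C) : Prop :=
  (forall n : nat, (n < n0)%nat -> U n = V n) /\
  (forall n : nat, (n0 <= n)%nat -> eqn U n).

(* The scheme generates exactly one numerical solution from any starting values,
   and this solution tends to 0. *)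
Definition stable (n0 : nat) (eqn : (nat -> C) -> nat -> Prop) : Prop :=
  forall V : nat -> C,
    exists U : nat -> C,
      is_numerical_solution n0 eqn V U /\
      (forall U' : nat -> C,
         is_numerical_solution n0 eqn V U' -> forall n : nat, U' n = U n) /\
      filterlim U eventually (locally (RtoC 0)).

(* Main.v *)
Require Import Defs.
From Stdlib Require Import Reals Arith.
From Coquelicot Require Import Coquelicot.
From Stdlib Require Import Ranalysis5 List NArith Lra Lia Psatz.
From Stdlib Require Import FunctionalExtensionality Classical ClassicalEpsilon.

Open Scope R_scope.

(* Put X = 1 - z and T = tau^alpha, and let d(z) = omega(z) - T ((lambda + rho) - (rho + kappa) X^q).
   For n >= n_* the scheme is a convolution equation d * U = R, where R_n is U_0 times the
   n-th partial sum of the omega_j, plus a combination of starting weights at index n with fixed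
   coefficients.  Hence U = (1/d) * R for the formal inverse 1/d, and U -> 0 as soon as
   1/d has absolutely summable coefficients and R -> 0.

   The first point is Wiener's lemma, since d has summable coefficients and no zero in
   the closed disk.  It is proved by continuation in the radius: if 1/d(sz) is summable,
   Cauchy's estimate applied to its powers bounds their norms on a slightly smaller radius by
   const * M^k, M = max 1/|d|, and the Neumann series reaches a slightly larger radius.

   The second point needs the weights to vanish at infinity.  The generating functions
   satisfy omega = X^alpha (P + X^p H) with P the polynomial of the g_k and H summable.
   Expanding n^s = Gamma(s+1) sum_k c_k(s) [z^n] X^(k-s-1) + o(1), where the c_k(s) are the Taylor
   coefficients in X of (-ln(1-X)/X)^(-s-1), the convolution of omega with n^sigma differs from
   its target n^(sigma-alpha) by o(1) because the series (-ln(1-X)/X)^a multiply like powers of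
   one series; a generalized Vandermonde system then gives the weights. *)

(** * Formal power series and absolutely summable sequences *)

(** In general omega has a branch point at z = 1, on the unit circle itself, so the coefficients of
    1/d need not decay geometrically. Summability is what survives, and it is enough to carry null
    sequences to null sequences. The c_k(s) come from sum n^s z^n ~ Gamma(s+1) (-ln z)^(-s-1) with z
    = 1 - X: as -ln(1-X) = X (-ln(1-X)/X), they and the g_k are coefficients of powers of the same
    series. Since sigma < alpha + p <= 7, eight of them suffice. The expansion is obtained without
    complex analysis: its cut-off P(n) obeys the first-order recurrence of n^s up to O(n^(s-8)), so
    P(n)/n^s converges with rate n^(-7), and the limit is found from Gauss's limit formula for
    Gamma. For fractional backward differences omega = (X g)^alpha with g a truncation of
    -ln(1-X)/X, and H is summable because g has no zero in the closed disk: inside, an analytic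
    logarithm excludes zeros; on the circle an explicit Bezout identity for each p does. *)

Ltac unfold_ball := unfold ball; simpl; unfold AbsRing_ball, abs, minus, plus, opp; simpl.
Ltac unfold_ball_in H :=
  unfold ball in H; simpl in H; unfold AbsRing_ball, abs, minus, plus, opp in H; simpl in H.
Ltac fps_ext n := apply functional_extensionality; intros n.

Fixpoint rsum (u : nat -> R) (n : nat) : R :=
  match n with O => 0 | S k => rsum u k + u k end.

Fixpoint fsum (u : nat -> C) (n : nat) : C :=
  match n with O => RtoC 0 | S k => (fsum u k + u k)%C end.

Definition fps := nat -> C.
Definition fK (c : C) : fps := fun n => match n with O => c | _ => RtoC 0 end.
Definition fadd (a b : fps) : fps := fun n => (a n + b n)%C.
Definition fopp (a : fps) : fps := fun n => (- a n)%C.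
Definition fsub (a b : fps) : fps := fun n => (a n - b n)%C.
Definition fmul (a b : fps) : fps :=
  fun n => fsum (fun j => a (n - j)%nat * b j)%C (S n).
Definition fshift (a : fps) : fps := fun n => a (S n).

Declare Scope fps_scope.
Delimit Scope fps_scope with fps.
Bind Scope fps_scope with fps.
Infix "+" := fadd : fps_scope.
Infix "-" := fsub : fps_scope.
Infix "*" := fmul : fps_scope.
Notation "- a" := (fopp a) : fps_scope.
Notation "0" := (fK (RtoC 0)) : fps_scope.
Notation "1" := (fK (RtoC 1)) : fps_scope.

Lemma fsum_ext (u v : nat -> C) (n : nat) :
  (forall k, (k < n)%nat -> u k = v k) -> fsum u n = fsum v n.
Proof.
  induction n as [|n IH]; intros H; simpl; [reflexivity|].
  rewrite IH, H by (intros; try apply H; lia). reflexivity.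
Qed.

Lemma fsum_S_l (u : nat -> C) (n : nat) :
  fsum u (S n) = (u O + fsum (fun k => u (S k)) n)%C.
Proof.
  induction n as [|n IH]; [simpl; ring|].
  change (fsum u (S (S n))) with (fsum u (S n) + u (S n))%C.
  rewrite IH. simpl. ring.
Qed.

Lemma fsum_add (u v : nat -> C) (n : nat) :
  fsum (fun k => u k + v k)%C n = (fsum u n + fsum v n)%C.
Proof. induction n as [|n IH]; simpl; [ring|rewrite IH; ring]. Qed.

Lemma fsum_scal (c : C) (u : nat -> C) (n : nat) :
  fsum (fun k => c * u k)%C n = (c * fsum u n)%C.
Proof. induction n as [|n IH]; simpl; [ring|rewrite IH; ring]. Qed.

Lemma fsum_0 (n : nat) : fsum (fun _ => RtoC 0) n = RtoC 0.
Proof. induction n as [|n IH]; simpl; [ring|rewrite IH; ring]. Qed.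

Lemma fsum_app (u : nat -> C) (n m : nat) :
  fsum u (n + m) = (fsum u n + fsum (fun k => u (n + k)%nat) m)%C.
Proof.
  induction m as [|m IH].
  - rewrite Nat.add_0_r. simpl. ring.
  - rewrite Nat.add_succ_r. simpl. rewrite IH. ring.
Qed.

Lemma fsum_single (u : nat -> C) (N n : nat) : (n < N)%nat ->
  (forall j, (j < N)%nat -> j <> n -> u j = RtoC 0) -> fsum u N = u n.
Proof.
  intros Hn H. replace N with (n + S (N - S n))%nat by lia.
  rewrite fsum_app, fsum_S_l, Nat.add_0_r.
  rewrite (fsum_ext u (fun _ => RtoC 0)), (fsum_ext _ (fun _ => RtoC 0) (N - S n)), !fsum_0;
    [ring| |]; intros; apply H; lia.
Qed.

Lemma fsum_exchange (u : nat -> nat -> C) (n m : nat) :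
  fsum (fun i => fsum (u i) m) n = fsum (fun j => fsum (fun i => u i j) n) m.
Proof.
  induction n as [|n IH]; simpl.
  - now rewrite fsum_0.
  - rewrite IH, <- fsum_add. reflexivity.
Qed.

Lemma csum_0_fsum (u : nat -> C) (n : nat) : csum u 0 n = fsum u (S n).
Proof.
  unfold csum. induction n as [|n IH].
  - rewrite sum_n_n. simpl. ring.
  - rewrite sum_n_Sm by lia. rewrite IH. reflexivity.
Qed.

Lemma csum_1_fsum (u : nat -> C) (n : nat) :
  csum u 1 n = fsum (fun k => u (S k)) n.
Proof.
  unfold csum. induction n as [|n IH].
  - rewrite sum_n_m_zero by lia. reflexivity.
  - rewrite sum_n_Sm by lia. rewrite IH. reflexivity.
Qed.

Lemma fmul_S_r (a b : fps) (n : nat) :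
  fmul a b (S n) = (a (S n) * b O + fmul a (fshift b) n)%C.
Proof.
  unfold fmul. rewrite fsum_S_l. f_equal.
Qed.

(** Peeling off the constant coefficient of the left factor, as [fmul_S_r] does for the right one,
    lets the ring laws be proved by induction on the index instead of by re-indexing double sums. *)
Lemma fmul_S_l (a b : fps) (n : nat) :
  fmul a b (S n) = (a O * b (S n) + fmul (fshift a) b n)%C.
Proof.
  revert b. induction n as [|n IH]; intros b.
  - unfold fmul, fshift; simpl. ring.
  - rewrite fmul_S_r, IH, (fmul_S_r (fshift a)). unfold fshift. ring.
Qed.

Lemma fmul_O (a b : fps) : fmul a b O = (a O * b O)%C.
Proof. unfold fmul; simpl; ring. Qed.

Lemma fmul_comm (a b : fps) : (a * b)%fps = (b * a)%fps.
Proof.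
  fps_ext n. revert a b.
  induction n as [|n IH]; intros a b.
  - rewrite !fmul_O. ring.
  - rewrite fmul_S_l, fmul_S_r, IH. ring.
Qed.

Lemma fmul_add_l (a b c : fps) : ((a + b) * c)%fps = (a * c + b * c)%fps.
Proof.
  fps_ext n. unfold fmul, fadd.
  rewrite <- fsum_add. apply fsum_ext; intros; ring.
Qed.

Lemma fmul_scal_l (k : C) (a b : fps) (n : nat) :
  fmul (fun i => k * a i)%C b n = (k * fmul a b n)%C.
Proof.
  unfold fmul. rewrite <- fsum_scal. apply fsum_ext; intros; ring.
Qed.

Lemma fmul_assoc (a b c : fps) : (a * (b * c))%fps = ((a * b) * c)%fps.
Proof.
  fps_ext n. revert a b c.
  induction n as [|n IH]; intros a b c.
  - rewrite !fmul_O. ring.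
  - rewrite !fmul_S_l. rewrite IH, fmul_O.
    replace (fshift (a * b)%fps)
      with (fadd (fun i => a O * fshift b i)%C (fmul (fshift a) b)).
    2:{ fps_ext k. unfold fshift at 3.
        rewrite fmul_S_l. reflexivity. }
    rewrite fmul_add_l. unfold fadd at 1. rewrite fmul_scal_l. ring.
Qed.

Lemma fmul_K_l (c : C) (a : fps) (n : nat) : fmul (fK c) a n = (c * a n)%C.
Proof.
  destruct n as [|n].
  - now rewrite fmul_O.
  - rewrite fmul_S_l. simpl. unfold fmul.
    rewrite (fsum_ext _ (fun _ => RtoC 0)).
    2:{ intros. unfold fshift; simpl. ring. }
    rewrite fsum_0. ring.
Qed.

Lemma fps_ring_theory :
  ring_theory (fK (RtoC 0)) (fK (RtoC 1)) fadd fmul fsub fopp eq.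
Proof.
  split; intros; try apply fmul_comm; try apply fmul_assoc; try apply fmul_add_l;
    apply functional_extensionality; intros n;
    [| | |rewrite fmul_K_l; ring| |]; unfold fadd, fopp, fsub; destruct n; simpl; ring.
Qed.

Fixpoint fpow (a : fps) (n : nat) : fps :=
  match n with O => fK (RtoC 1) | S k => fmul a (fpow a k) end.
Infix "^" := fpow : fps_scope.

Lemma fps_power_theory :
  power_theory (fK (RtoC 1)) fmul eq BinNat.N.to_nat fpow.
Proof.
  constructor. intros a n. destruct n as [|n]; [reflexivity|]. simpl.
  induction n as [|n IH] using Pos.peano_ind.
  - simpl. rewrite fmul_comm.
    fps_ext k. now rewrite fmul_K_l, Cmult_1_l.
  - rewrite Pos2Nat.inj_succ. simpl. rewrite IH.
    rewrite pow_pos_succ; [reflexivity|typeclasses eauto| |exact fmul_assoc].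
    intros ? ? -> ? ? ->; reflexivity.
Qed.

Ltac fpow_cst t :=
  match isnatcst t with true => constr:(BinNat.N.of_nat t) | _ => constr:(InitialRing.NotConstant) end.

Add Ring fps_ring : fps_ring_theory (power_tac fps_power_theory [fpow_cst]).

Lemma fK_add (a b : C) : fK (a + b)%C = (fK a + fK b)%fps.
Proof.
  apply functional_extensionality; intros [|n]; unfold fadd; simpl; ring.
Qed.
Lemma fK_mul (a b : C) : fK (a * b)%C = (fK a * fK b)%fps.
Proof.
  apply functional_extensionality; intros n; rewrite fmul_K_l.
  destruct n; simpl; ring.
Qed.
Lemma fK_opp (a : C) : fK (- a)%C = (- fK a)%fps.
Proof.
  apply functional_extensionality; intros [|n]; unfold fopp; simpl; ring.
Qed.
(* z d/dz *)
Definition ftheta (a : fps) : fps := fun n => (RtoC (INR n) * a n)%C.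

Lemma ftheta_mul (a b : fps) :
  ftheta (a * b)%fps = (ftheta a * b + a * ftheta b)%fps.
Proof.
  fps_ext n. unfold fadd, ftheta at 1, fmul.
  rewrite <- fsum_scal, <- fsum_add. apply fsum_ext; intros k Hk. unfold ftheta.
  replace (INR n) with (INR (n - k) + INR k)
    by (rewrite <- plus_INR; f_equal; lia).
  rewrite RtoC_plus. ring.
Qed.
Lemma ftheta_add (a b : fps) : ftheta (a + b)%fps = (ftheta a + ftheta b)%fps.
Proof.
  fps_ext n. unfold ftheta, fadd. ring.
Qed.
Lemma ftheta_sub (a b : fps) : ftheta (a - b)%fps = (ftheta a - ftheta b)%fps.
Proof.
  fps_ext n. unfold ftheta, fsub. ring.
Qed.
Lemma ftheta_K (c : C) : ftheta (fK c) = 0%fps.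
Proof.
  apply functional_extensionality; intros [|n]; unfold ftheta; simpl fK; simpl; ring.
Qed.

Definition fz : fps := fun n => match n with 1%nat => RtoC 1 | _ => RtoC 0 end.
Definition fX : fps := (1 - fz)%fps.

Lemma ftheta_z : ftheta fz = fz.
Proof.
  apply functional_extensionality; intros [|[|n]]; unfold ftheta; simpl fz; simpl; ring.
Qed.
Lemma ftheta_X : ftheta fX = (- fz)%fps.
Proof. unfold fX. rewrite ftheta_sub, ftheta_K, ftheta_z. ring. Qed.

Lemma fz_mul_S (a : fps) (n : nat) : fmul fz a (S n) = a n.
Proof.
  rewrite fmul_S_l. replace (fshift fz) with (fK (RtoC 1)).
  - rewrite fmul_K_l. simpl. ring.
  - apply functional_extensionality; intros [|k]; reflexivity.
Qed.
Lemma fX_mul_O (a : fps) : fmul fX a O = a O.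
Proof. rewrite fmul_O. unfold fX, fsub; simpl. ring. Qed.
Lemma fX_mul_S (a : fps) (n : nat) : fmul fX a (S n) = (a (S n) - a n)%C.
Proof.
  unfold fX. replace ((1 - fz) * a)%fps with (a - fz * a)%fps by ring.
  unfold fsub. rewrite fz_mul_S. ring.
Qed.


(** Entry n no longer changes after n + 1 iterations of [F]. This builds formal inverses, the power
    series g^alpha and the numerical solution. *)
Lemma course_of_values {T : Type} (d : T) (F : nat -> (nat -> T) -> T) :
  (forall n u v, (forall k, (k < n)%nat -> u k = v k) -> F n u = F n v) ->
  exists u : nat -> T, forall n, u n = F n u.
Proof.
  intros HF.
  set (it := fix it m := match m with O => fun _ : nat => d | S k => fun n => F n (it k) end).
  assert (Hst : forall n m, (n < m)%nat -> it m n = it (S n) n).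
  { induction n as [n IH] using lt_wf_ind. intros [|m] Hm; [lia|].
    simpl. apply HF. intros k Hk. rewrite (IH k Hk m) by lia.
    symmetry. apply IH; lia. }
  exists (fun n => it (S n) n). intros n. simpl. apply HF.
  intros k Hk. apply Hst; lia.
Qed.

Lemma fps_inverse (a : fps) : a O <> RtoC 0 -> exists e : fps, (a * e)%fps = 1%fps.
Proof.
  intros Ha.
  destruct (course_of_values (RtoC 0) (fun n u =>
    match n with O => / a O
    | S m => - (/ a O * fmul (fshift a) u m) end)%C) as [e He].
  { intros [|n] u v H; [reflexivity|]. do 2 f_equal. unfold fmul.
    apply fsum_ext. intros k Hk. rewrite H by lia. reflexivity. }
  exists e. apply functional_extensionality. intros [|n].
  - rewrite fmul_O, He. simpl. field. exact Ha.
  - rewrite fmul_S_l, (He (S n)). simpl. field. exact Ha.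
Qed.

Lemma fps_mul_cancel (a b c : fps) :
  a O <> RtoC 0 -> (a * b)%fps = (a * c)%fps -> b = c.
Proof.
  intros Ha H. destruct (fps_inverse a Ha) as [e He].
  replace b with (e * (a * b))%fps by (ring [He]). rewrite H. ring [He].
Qed.

(** * Norm bounds *)

(** A bound on the l^1 norm expressed by finite partial sums, so that products and Neumann sums are
    estimated without limits. *)
Definition sums_le (a : nat -> C) (B : R) : Prop :=
  forall n, rsum (fun k => Cmod (a k)) n <= B.
Definition l1 (a : nat -> C) : Prop := exists B, sums_le a B.
Definition null_seq (a : nat -> C) : Prop :=
  forall eps, 0 < eps -> exists N, forall n, (N <= n)%nat -> Cmod (a n) <= eps.

Lemma rsum_ext (u v : nat -> R) (n : nat) :
  (forall k, (k < n)%nat -> u k = v k) -> rsum u n = rsum v n.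
Proof.
  induction n as [|n IH]; intros H; simpl; [reflexivity|].
  rewrite IH, H by (intros; try apply H; lia). reflexivity.
Qed.
Lemma rsum_le (u v : nat -> R) (n : nat) :
  (forall k, (k < n)%nat -> u k <= v k) -> rsum u n <= rsum v n.
Proof.
  induction n as [|n IH]; intros H; simpl; [lra|].
  apply Rplus_le_compat; [apply IH; intros|]; apply H; lia.
Qed.
Lemma rsum_add (u v : nat -> R) (n : nat) :
  rsum (fun k => u k + v k) n = rsum u n + rsum v n.
Proof. induction n as [|n IH]; simpl; [ring|rewrite IH; ring]. Qed.
Lemma rsum_sub (u v : nat -> R) (n : nat) :
  rsum (fun k => u k - v k) n = rsum u n - rsum v n.
Proof. induction n as [|n IH]; simpl; [ring|rewrite IH; ring]. Qed.
Lemma rsum_scal (c : R) (u : nat -> R) (n : nat) :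
  rsum (fun k => c * u k) n = c * rsum u n.
Proof. induction n as [|n IH]; simpl; [ring|rewrite IH; ring]. Qed.
Lemma rsum_app (u : nat -> R) (n m : nat) :
  rsum u (n + m) = rsum u n + rsum (fun k => u (n + k)%nat) m.
Proof.
  induction m as [|m IH].
  - rewrite Nat.add_0_r. simpl. ring.
  - rewrite Nat.add_succ_r. simpl. rewrite IH. ring.
Qed.
Lemma rsum_S_l (u : nat -> R) (n : nat) :
  rsum u (S n) = u O + rsum (fun k => u (S k)) n.
Proof. change (S n) with (1 + n)%nat. rewrite rsum_app. simpl. ring. Qed.
Lemma rsum_nonneg (u : nat -> R) (n : nat) :
  (forall k, 0 <= u k) -> 0 <= rsum u n.
Proof.
  intros H. induction n as [|n IH]; simpl; [lra|]. specialize (H n). lra.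
Qed.
Lemma rsum_mono (u : nat -> R) (n m : nat) :
  (forall k, 0 <= u k) -> (n <= m)%nat -> rsum u n <= rsum u m.
Proof.
  intros H Hnm. replace m with (n + (m - n))%nat by lia. rewrite rsum_app.
  pose proof (rsum_nonneg (fun k => u (n + k)%nat) (m - n) (fun k => H _)). lra.
Qed.
Lemma rsum_const (c : R) (n : nat) : rsum (fun _ => c) n = INR n * c.
Proof. induction n as [|n IH]; [simpl; ring|]. rewrite S_INR. simpl. rewrite IH. ring. Qed.
Lemma rsum_geom (r : R) (n : nat) : 0 <= r < 1 -> rsum (fun k => r ^ k) n <= / (1 - r).
Proof.
  intros Hr. assert (E : rsum (fun k => r ^ k) n = (1 - r ^ n) / (1 - r)).
  { induction n as [|n IH]; simpl; [|rewrite IH]; field; lra. }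
  rewrite E. unfold Rdiv. pose proof (pow_le r n (proj1 Hr)).
  assert (0 < / (1 - r)) by (apply Rinv_0_lt_compat; lra). nra.
Qed.

Lemma Cmod_fsum_le (u : nat -> C) (n : nat) :
  Cmod (fsum u n) <= rsum (fun k => Cmod (u k)) n.
Proof.
  induction n as [|n IH]; simpl.
  - rewrite Cmod_0. lra.
  - pose proof (Cmod_triangle (fsum u n) (u n)). lra.
Qed.

Lemma sums_le_nonneg (a : nat -> C) (B : R) : sums_le a B -> 0 <= B.
Proof. intros H. exact (H O). Qed.
Lemma sums_le_coef (a : nat -> C) (B : R) (n : nat) : sums_le a B -> Cmod (a n) <= B.
Proof.
  intros H. specialize (H (S n)). simpl in H.
  pose proof (rsum_nonneg (fun k => Cmod (a k)) n (fun k => Cmod_ge_0 _)). lra.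
Qed.
Lemma sums_le_weaken (a : nat -> C) (B B' : R) : sums_le a B -> B <= B' -> sums_le a B'.
Proof. intros H HB n. specialize (H n). lra. Qed.

Lemma sums_le_add (a b : fps) (A B : R) :
  sums_le a A -> sums_le b B -> sums_le (a + b)%fps (A + B).
Proof.
  intros Ha Hb n. specialize (Ha n). specialize (Hb n).
  apply Rle_trans with (rsum (fun k => Cmod (a k) + Cmod (b k)) n).
  - apply rsum_le. intros. apply Cmod_triangle.
  - rewrite rsum_add. lra.
Qed.

Lemma sums_le_mul (a b : fps) (A B : R) :
  sums_le a A -> sums_le b B -> sums_le (a * b)%fps (A * B).
Proof.
  intros Ha Hb n. revert a A Ha.
  (* The first factor is kept as a finite partial sum: the induction removes its constant
     coefficient and continues with [fshift a]. *)
  assert (H : forall n a, rsum (fun k => Cmod (fmul a b k)) n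
              <= rsum (fun k => Cmod (a k)) n * B).
  { clear n. induction n as [|n IH]; intros a; [simpl; lra|].
    rewrite rsum_S_l, fmul_O.
    apply Rle_trans with (Cmod (a O * b O) +
      rsum (fun k => Cmod (a O) * Cmod (b (S k)) + Cmod (fmul (fshift a) b k)) n).
    - apply Rplus_le_compat_l, rsum_le. intros k _. rewrite fmul_S_l.
      rewrite <- Cmod_mult. apply Cmod_triangle.
    - rewrite rsum_add, rsum_scal, Cmod_mult, (rsum_S_l (fun k => Cmod (a k))).
      specialize (IH (fshift a)). specialize (Hb (S n)).
      rewrite rsum_S_l in Hb. pose proof (Cmod_ge_0 (a O)).
      change (rsum (fun k => Cmod (fshift a k)) n) with
        (rsum (fun k => Cmod (a (S k))) n) in IH. nra. }
  intros a A Ha. eapply Rle_trans; [apply H|].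
  apply Rmult_le_compat_r; [|apply Ha]. apply (sums_le_nonneg _ _ Hb).
Qed.

Lemma sums_le_pow (a : fps) (A : R) (k : nat) :
  sums_le a A -> sums_le (a ^ k)%fps (A ^ k).
Proof.
  intros H. induction k as [|k IH]; simpl.
  - intros [|n]; simpl; [lra|]. 
    change (rsum (fun k => Cmod (fK (RtoC 1) k)) (S n) <= 1).
    rewrite rsum_S_l. simpl. rewrite Cmod_1.
    rewrite (rsum_ext _ (fun _ => 0)) by (intros; apply Cmod_0).
    rewrite rsum_const. lra.
  - now apply sums_le_mul.
Qed.

Lemma sums_le_K (c : C) : sums_le (fK c) (Cmod c).
Proof.
  intros [|n]; [simpl; apply Cmod_ge_0|]. rewrite rsum_S_l. simpl.
  rewrite (rsum_ext _ (fun _ => 0)) by (intros; apply Cmod_0).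
  rewrite rsum_const. lra.
Qed.

Lemma l1_add (a b : fps) : l1 a -> l1 b -> l1 (a + b)%fps.
Proof. intros [A HA] [B HB]. exists (A + B). now apply sums_le_add. Qed.
Lemma l1_mul (a b : fps) : l1 a -> l1 b -> l1 (a * b)%fps.
Proof. intros [A HA] [B HB]. exists (A * B). now apply sums_le_mul. Qed.
Lemma l1_K (c : C) : l1 (fK c).
Proof. exists (Cmod c). apply sums_le_K. Qed.
Lemma l1_opp (a : fps) : l1 a -> l1 (- a)%fps.
Proof.
  intros [A HA]. exists A. intros n. rewrite (rsum_ext _ (fun k => Cmod (a k))).
  - apply HA. - intros. apply Cmod_opp.
Qed.
Lemma l1_sub (a b : fps) : l1 a -> l1 b -> l1 (a - b)%fps.
Proof.
  intros Ha Hb. replace (a - b)%fps with (a + - b)%fps by ring.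
  apply l1_add, l1_opp; assumption.
Qed.
Lemma l1_pow (a : fps) (k : nat) : l1 a -> l1 (a ^ k)%fps.
Proof. intros [A HA]. exists (A ^ k). now apply sums_le_pow. Qed.
Lemma l1_finite (a : fps) (N : nat) :
  (forall n, (N <= n)%nat -> a n = RtoC 0) -> l1 a.
Proof.
  intros H. exists (rsum (fun k => Cmod (a k)) N). intros n.
  destruct (le_lt_dec n N).
  - apply rsum_mono; auto. intros; apply Cmod_ge_0.
  - replace n with (N + (n - N))%nat by lia. rewrite rsum_app.
    rewrite (rsum_ext (fun k => Cmod (a (N + k)%nat)) (fun _ => 0)).
    + rewrite rsum_const. lra.
    + intros. rewrite H by lia. apply Cmod_0.
Qed.
Lemma l1_z : l1 fz.
Proof. apply (l1_finite _ 2). intros [|[|n]] Hn; try lia. reflexivity. Qed.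
Lemma l1_X : l1 fX.
Proof. apply l1_sub; [apply l1_K|apply l1_z]. Qed.

(** Some partial sum comes within eps of the supremum, so whatever follows it adds up to at most
    eps. *)
Lemma l1_tail (a : nat -> C) (eps : R) : l1 a -> 0 < eps ->
  exists N, forall m, rsum (fun k => Cmod (a (N + k)%nat)) m <= eps.
Proof.
  intros [B HB] He.
  destruct (completeness (fun x => exists n, x = rsum (fun k => Cmod (a k)) n)) as [s [Hs1 Hs2]].
  - exists B. intros x [n ->]. apply HB.
  - exists 0, O. reflexivity.
  - assert (HN : exists N, s - eps < rsum (fun k => Cmod (a k)) N).
    { apply NNPP. intros Hn.
      assert (s <= s - eps); [|lra]. apply Hs2. intros x [n ->].
      apply Rnot_lt_le. intros Hlt. apply Hn. now exists n. }
    destruct HN as [N HN]. exists N. intros m.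
    assert (Hm : rsum (fun k => Cmod (a k)) (N + m) <= s) by (apply Hs1; now eexists).
    rewrite rsum_app in Hm. lra.
Qed.

Lemma null_add (a b : fps) : null_seq a -> null_seq b -> null_seq (a + b)%fps.
Proof.
  intros Ha Hb eps He. destruct (Ha (eps / 2)) as [N HN]; [lra|].
  destruct (Hb (eps / 2)) as [M HM]; [lra|]. exists (N + M)%nat. intros n Hn.
  specialize (HN n ltac:(lia)). specialize (HM n ltac:(lia)).
  pose proof (Cmod_triangle (a n) (b n)). unfold fadd. lra.
Qed.
Lemma null_scal (c : C) (a : nat -> C) : null_seq a -> null_seq (fun n => c * a n)%C.
Proof.
  intros Ha eps He. pose proof (Cmod_ge_0 c) as Hc.
  destruct (Ha (eps / (Cmod c + 1))) as [N HN].
  { apply Rdiv_lt_0_compat; lra. }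
  exists N. intros n Hn. rewrite Cmod_mult. specialize (HN n Hn).
  apply Rle_trans with (Cmod c * (eps / (Cmod c + 1))).
  - apply Rmult_le_compat_l; auto.
  - apply Rle_trans with ((Cmod c + 1) * (eps / (Cmod c + 1))).
    + apply Rmult_le_compat_r; [|lra]. apply Rlt_le, Rdiv_lt_0_compat; lra.
    + right. field. lra.
Qed.
Lemma null_ext (a b : nat -> C) (N : nat) :
  (forall n, (N <= n)%nat -> a n = b n) -> null_seq a -> null_seq b.
Proof.
  intros H Ha eps He. destruct (Ha eps He) as [M HM]. exists (N + M)%nat.
  intros n Hn. rewrite <- H by lia. apply HM; lia.
Qed.
Lemma null_bounded (a : nat -> C) : null_seq a -> exists B, forall n, Cmod (a n) <= B.
Proof.
  intros Ha. destruct (Ha 1 ltac:(lra)) as [N HN].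
  exists (rsum (fun k => Cmod (a k)) N + 1). intros n.
  pose proof (rsum_nonneg (fun k => Cmod (a k)) N (fun k => Cmod_ge_0 _)).
  destruct (le_lt_dec N n) as [Hn|Hn].
  - specialize (HN n Hn). lra.
  - pose proof (rsum_mono (fun k => Cmod (a k)) (S n) N (fun k => Cmod_ge_0 _) Hn) as Hm.
    simpl in Hm. pose proof (rsum_nonneg (fun k => Cmod (a k)) n (fun k => Cmod_ge_0 _)). lra.
Qed.

(** Split the convolution at N: the first N coefficients of [a] meet late, hence small, terms of
    [b]; the others form a small tail against the bound of [b]. *)
Lemma null_l1_mul (a b : fps) : l1 a -> null_seq b -> null_seq (a * b)%fps.
Proof.
  intros Ha Hb eps He. destruct (null_bounded b Hb) as [B HB].
  assert (HB0 : 0 <= B) by (apply Rle_trans with (1 := Cmod_ge_0 (b O)), HB).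
  pose proof Ha as [A HA]. pose proof (sums_le_nonneg _ _ HA) as HA0.
  destruct (l1_tail a (eps / 2 / (B + 1)) Ha) as [N HN].
  { repeat apply Rdiv_lt_0_compat; lra. }
  destruct (Hb (eps / 2 / (A + 1))) as [M HM].
  { repeat apply Rdiv_lt_0_compat; lra. }
  exists (N + M)%nat. intros n Hn. rewrite fmul_comm. unfold fmul.
  replace (S n) with (N + (S n - N))%nat by lia. rewrite fsum_app.
  eapply Rle_trans; [apply Cmod_triangle|].
  replace eps with (A * (eps / 2 / (A + 1)) + eps / 2 / (A + 1)
                    + (B * (eps / 2 / (B + 1)) + eps / 2 / (B + 1))) by (field; lra).
  assert (0 < eps / 2 / (A + 1)) by (repeat apply Rdiv_lt_0_compat; lra).
  assert (0 < eps / 2 / (B + 1)) by (repeat apply Rdiv_lt_0_compat; lra).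
  apply Rplus_le_compat.
  - eapply Rle_trans; [apply Cmod_fsum_le|].
    eapply Rle_trans.
    { apply (rsum_le _ (fun k => (eps / 2 / (A + 1)) * Cmod (a k))). intros k Hk.
      rewrite Cmod_mult. apply Rmult_le_compat_r; [apply Cmod_ge_0|]. apply HM; lia. }
    rewrite rsum_scal. specialize (HA N). nra.
  - eapply Rle_trans; [apply Cmod_fsum_le|].
    eapply Rle_trans.
    { apply (rsum_le _ (fun k => B * Cmod (a (N + k)%nat))). intros k Hk.
      rewrite Cmod_mult. apply Rmult_le_compat_r; [apply Cmod_ge_0|]. apply HB. }
    rewrite rsum_scal. specialize (HN (S n - N)%nat). nra.
Qed.

(** * Sums and evaluation *)

(** A total function computed by components; it is the sum whenever both real series converge. *)
Definition tsum (u : nat -> C) : C :=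
  (Series (fun n => Re (u n)), Series (fun n => Im (u n))).

Lemma rsum_sum_n (u : nat -> R) (n : nat) : sum_n u n = rsum u (S n).
Proof.
  induction n as [|n IH].
  - rewrite sum_O. simpl. ring.
  - rewrite sum_Sn, IH. reflexivity.
Qed.

Lemma ex_series_of_bounded (u : nat -> R) (B : R) :
  (forall n, 0 <= u n) -> (forall n, rsum u n <= B) -> ex_series u.
Proof.
  intros H0 HB. destruct (ex_finite_lim_seq_incr (sum_n u) B) as [l Hl].
  - intros n. rewrite !rsum_sum_n. apply rsum_mono; auto.
  - intros n. rewrite rsum_sum_n. apply HB.
  - exists l. exact Hl.
Qed.

Lemma im_le_Cmod (c : C) : Rabs (Im c) <= Cmod c.
Proof.
  eapply Rle_trans; [|apply Rmax_Cmod]. apply Rmax_r.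
Qed.

Lemma Cmod_le_re_im (c : C) : Cmod c <= Rabs (Re c) + Rabs (Im c).
Proof.
  replace c with (RtoC (Re c) + Ci * RtoC (Im c))%C at 1.
  - eapply Rle_trans; [apply Cmod_triangle|]. rewrite Cmod_mult, Cmod_Ci, !Cmod_R. lra.
  - destruct c as [x y]. unfold Re, Im, Ci, RtoC, Cplus, Cmult; simpl. f_equal; ring.
Qed.

Lemma l1_re_abs (u : nat -> C) : l1 u -> ex_series (fun n => Rabs (Re (u n))).
Proof.
  intros [B HB]. apply (ex_series_of_bounded _ B); [intros; apply Rabs_pos|].
  intros n. eapply Rle_trans; [|apply HB]. apply rsum_le. intros. apply re_le_Cmod.
Qed.
Lemma l1_im_abs (u : nat -> C) : l1 u -> ex_series (fun n => Rabs (Im (u n))).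
Proof.
  intros [B HB]. apply (ex_series_of_bounded _ B); [intros; apply Rabs_pos|].
  intros n. eapply Rle_trans; [|apply HB]. apply rsum_le. intros. apply im_le_Cmod.
Qed.
Lemma l1_re (u : nat -> C) : l1 u -> is_series (fun n => Re (u n)) (Re (tsum u)).
Proof. intros H. apply Series_correct, ex_series_Rabs, l1_re_abs, H. Qed.
Lemma l1_im (u : nat -> C) : l1 u -> is_series (fun n => Im (u n)) (Im (tsum u)).
Proof. intros H. apply Series_correct, ex_series_Rabs, l1_im_abs, H. Qed.

Lemma tsum_unique (u : nat -> C) (l : C) :
  is_series (fun n => Re (u n)) (Re l) -> is_series (fun n => Im (u n)) (Im l) ->
  tsum u = l.
Proof.
  intros H1 H2. unfold tsum. rewrite (is_series_unique _ _ H1), (is_series_unique _ _ H2).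
  now destruct l.
Qed.

Lemma fsum_re (u : nat -> C) (n : nat) : Re (fsum u n) = rsum (fun k => Re (u k)) n.
Proof. induction n as [|n IH]; simpl; [reflexivity|]. now rewrite <- IH. Qed.
Lemma fsum_im (u : nat -> C) (n : nat) : Im (fsum u n) = rsum (fun k => Im (u k)) n.
Proof. induction n as [|n IH]; simpl; [reflexivity|]. now rewrite <- IH. Qed.

Lemma fsum_tsum (u : nat -> C) (eps : R) : l1 u -> 0 < eps ->
  exists N, forall n, (N <= n)%nat -> Cmod (tsum u - fsum u n) <= eps.
Proof.
  intros Hu He.
  pose proof (l1_re u Hu) as H1. pose proof (l1_im u Hu) as H2.
  apply is_series_Reals in H1. apply is_series_Reals in H2.
  destruct (H1 (eps / 2)) as [N HN]; [lra|]. destruct (H2 (eps / 2)) as [M HM]; [lra|].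
  exists (S (N + M)). intros [|n] Hn; [lia|].
  specialize (HN n ltac:(lia)). specialize (HM n ltac:(lia)).
  rewrite <- sum_n_Reals, rsum_sum_n, <- fsum_re in HN.
  rewrite <- sum_n_Reals, rsum_sum_n, <- fsum_im in HM. unfold R_dist in *.
  eapply Rle_trans; [apply Cmod_le_re_im|].
  rewrite (Rabs_minus_sym (Re (fsum u (S n)))) in HN.
  rewrite (Rabs_minus_sym (Im (fsum u (S n)))) in HM.
  change (Re (tsum u - fsum u (S n))%C) with (Re (tsum u) - Re (fsum u (S n))).
  change (Im (tsum u - fsum u (S n))%C) with (Im (tsum u) - Im (fsum u (S n))).
  lra.
Qed.

Lemma tsum_bound (u : nat -> C) (B : R) : sums_le u B -> Cmod (tsum u) <= B.
Proof.
  intros HB. apply Rnot_lt_le. intros Hlt.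
  destruct (fsum_tsum u ((Cmod (tsum u) - B) / 2)) as [N HN]; [now exists B|lra|].
  specialize (HN N (le_n _)). pose proof (Cmod_fsum_le u N) as H1. specialize (HB N).
  pose proof (Cmod_triangle (tsum u - fsum u N) (fsum u N)) as H2.
  replace (tsum u - fsum u N + fsum u N)%C with (tsum u) in H2 by ring. lra.
Qed.

Lemma tsum_add (u v : fps) : l1 u -> l1 v -> tsum (u + v)%fps = (tsum u + tsum v)%C.
Proof.
  intros Hu Hv. apply tsum_unique; unfold fadd; simpl.
  - apply (is_series_plus (fun n => Re (u n)) (fun n => Re (v n))); now apply l1_re.
  - apply (is_series_plus (fun n => Im (u n)) (fun n => Im (v n))); now apply l1_im.
Qed.

(** Reduced to the four real Cauchy products of the real and imaginary parts. *)
Lemma tsum_mul (u v : fps) : l1 u -> l1 v -> tsum (u * v)%fps = (tsum u * tsum v)%C.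
Proof.
  intros Hu Hv.
  assert (Hf : forall n, fmul u v n = fmul v u n) by (intros; now rewrite fmul_comm).
  apply tsum_unique.
  - apply (is_series_ext (fun n =>
      minus (sum_f_R0 (fun k => Re (u k) * Re (v (n - k)%nat)) n)
            (sum_f_R0 (fun k => Im (u k) * Im (v (n - k)%nat)) n))).
    + intros n. rewrite Hf. unfold fmul. rewrite fsum_re, <- !sum_n_Reals, !rsum_sum_n.
      etransitivity; [symmetry; apply rsum_sub|].
      apply rsum_ext. intros k _. unfold Re, Im; simpl. ring.
    + change (Re (tsum u * tsum v)%C) with
        (minus (Re (tsum u) * Re (tsum v)) (Im (tsum u) * Im (tsum v))).
      apply (is_series_minus (fun n => sum_f_R0 (fun k => Re (u k) * Re (v (n - k)%nat)) n)
         (fun n => sum_f_R0 (fun k => Im (u k) * Im (v (n - k)%nat)) n)).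
      * apply (is_series_mult (fun n => Re (u n)) (fun n => Re (v n)));
          auto using l1_re, l1_re_abs.
      * apply (is_series_mult (fun n => Im (u n)) (fun n => Im (v n)));
          auto using l1_im, l1_im_abs.
  - apply (is_series_ext (fun n =>
      plus (sum_f_R0 (fun k => Re (u k) * Im (v (n - k)%nat)) n)
            (sum_f_R0 (fun k => Im (u k) * Re (v (n - k)%nat)) n))).
    + intros n. rewrite Hf. unfold fmul. rewrite fsum_im, <- !sum_n_Reals, !rsum_sum_n.
      etransitivity; [symmetry; apply rsum_add|].
      apply rsum_ext. intros k _. unfold Re, Im; simpl. ring.
    + change (Im (tsum u * tsum v)%C) with
        (plus (Re (tsum u) * Im (tsum v)) (Im (tsum u) * Re (tsum v))).
      apply (is_series_plus (fun n => sum_f_R0 (fun k => Re (u k) * Im (v (n - k)%nat)) n)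
         (fun n => sum_f_R0 (fun k => Im (u k) * Re (v (n - k)%nat)) n)).
      * apply (is_series_mult (fun n => Re (u n)) (fun n => Im (v n)));
          auto using l1_re, l1_re_abs, l1_im, l1_im_abs.
      * apply (is_series_mult (fun n => Im (u n)) (fun n => Re (v n)));
          auto using l1_re, l1_re_abs, l1_im, l1_im_abs.
Qed.

Lemma Ceq_of_dist (a b : C) : (forall eps, 0 < eps -> Cmod (a - b) <= eps) -> a = b.
Proof.
  intros H. apply NNPP. intros Hne.
  assert (Hp : 0 < Cmod (a - b)).
  { apply Cmod_gt_0. intros E. apply Hne. replace a with (a - b + b)%C by ring. rewrite E. ring. }
  specialize (H (Cmod (a - b) / 2)). lra.
Qed.

Lemma tsum_finite (u : nat -> C) (N : nat) :
  (forall n, (N <= n)%nat -> u n = RtoC 0) -> tsum u = fsum u N.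
Proof.
  intros H. apply Ceq_of_dist. intros eps He.
  destruct (fsum_tsum u eps (l1_finite u N H) He) as [M HM].
  specialize (HM (N + M)%nat ltac:(lia)). rewrite fsum_app in HM.
  rewrite (fsum_ext (fun k => u (N + k)%nat) (fun _ => RtoC 0)), fsum_0, Cplus_0_r in HM
    by (intros; apply H; lia). exact HM.
Qed.

Definition scale (z : C) (a : fps) : fps := fun n => (a n * z ^ n)%C.
Definition ev (a : fps) (z : C) : C := tsum (scale z a).

Lemma Cpow_mod_le_1 (z : C) (n : nat) : Cmod z <= 1 -> Cmod (z ^ n) <= 1.
Proof.
  intros H. rewrite Cmod_pow. rewrite <- (pow1 n). apply pow_incr. split; [apply Cmod_ge_0|exact H].
Qed.

Lemma scale_coef_le (z : C) (a : fps) (n : nat) :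
  Cmod z <= 1 -> Cmod (scale z a n) <= Cmod (a n).
Proof.
  intros Hz. unfold scale. rewrite Cmod_mult. pose proof (Cpow_mod_le_1 z n Hz).
  pose proof (Cmod_ge_0 (a n)). nra.
Qed.

Lemma scale_sums_le (z : C) (a : fps) (B : R) : Cmod z <= 1 -> sums_le a B -> sums_le (scale z a) B.
Proof.
  intros Hz H n. eapply Rle_trans; [|apply (H n)]. apply rsum_le. intros k _. now apply scale_coef_le.
Qed.
Lemma scale_l1 (z : C) (a : fps) : Cmod z <= 1 -> l1 a -> l1 (scale z a).
Proof. intros Hz [B HB]. exists B. now apply scale_sums_le. Qed.

Lemma scale_add (z : C) (a b : fps) : scale z (a + b)%fps = (scale z a + scale z b)%fps.
Proof. fps_ext n. unfold scale, fadd. ring. Qed.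
Lemma scale_mul (z : C) (a b : fps) : scale z (a * b)%fps = (scale z a * scale z b)%fps.
Proof.
  fps_ext n. unfold scale at 1, fmul.
  rewrite Cmult_comm, <- fsum_scal. apply fsum_ext. intros k Hk. unfold scale.
  replace n with (n - k + k)%nat at 1 by lia. rewrite Cpow_add_r. ring.
Qed.
Lemma scale_K (z c : C) : scale z (fK c) = fK c.
Proof. apply functional_extensionality; intros [|n]; unfold scale; simpl; ring. Qed.
Lemma scale_pow (z : C) (a : fps) (k : nat) : scale z (a ^ k)%fps = (scale z a ^ k)%fps.
Proof.
  induction k as [|k IH]; simpl; [apply scale_K|]. now rewrite scale_mul, IH.
Qed.
Lemma scale_scale (z w : C) (a : fps) : scale z (scale w a) = scale (z * w)%C a.
Proof.
  fps_ext n. unfold scale. rewrite Cpow_mult_l. ring.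
Qed.
Lemma scale_1 (a : fps) : scale (RtoC 1) a = a.
Proof. fps_ext n. unfold scale. rewrite Cpow_1_l. ring. Qed.
Lemma scale_theta (z : C) (a : fps) : scale z (ftheta a) = ftheta (scale z a).
Proof. fps_ext n. unfold scale, ftheta. ring. Qed.

Lemma ev_scale (a : fps) (z w : C) : ev (scale w a) z = ev a (z * w)%C.
Proof. unfold ev. now rewrite scale_scale. Qed.

Section Evaluation.
Variable z : C.
Hypothesis Hz : Cmod z <= 1.
Lemma ev_add (a b : fps) : l1 a -> l1 b -> ev (a + b)%fps z = (ev a z + ev b z)%C.
Proof. intros. unfold ev. rewrite scale_add. apply tsum_add; now apply scale_l1. Qed.
Lemma ev_mul (a b : fps) : l1 a -> l1 b -> ev (a * b)%fps z = (ev a z * ev b z)%C.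
Proof. intros. unfold ev. rewrite scale_mul. apply tsum_mul; now apply scale_l1. Qed.
Lemma ev_bound (a : fps) (B : R) : sums_le a B -> Cmod (ev a z) <= B.
Proof. intros. apply tsum_bound. now apply scale_sums_le. Qed.
End Evaluation.

Lemma ev_finite (a : fps) (N : nat) (z : C) :
  (forall n, (N <= n)%nat -> a n = RtoC 0) -> ev a z = fsum (scale z a) N.
Proof. intros H. apply tsum_finite. intros n Hn. unfold scale. rewrite H by lia. ring. Qed.
Lemma ev_K (c z : C) : ev (fK c) z = c.
Proof.
  rewrite (ev_finite _ 1); [|intros [|n] Hn; [lia|reflexivity]]. unfold scale; simpl. ring.
Qed.
Lemma ev_0 (a : fps) : ev a (RtoC 0) = a O.
Proof.
  unfold ev. rewrite (tsum_finite _ 1).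
  - unfold scale; simpl. ring.
  - intros [|n] Hn; [lia|]. unfold scale. simpl. ring.
Qed.
Lemma ev_z (z : C) : ev fz z = z.
Proof.
  rewrite (ev_finite _ 2); [|intros [|[|n]] Hn; try lia; reflexivity]. unfold scale; simpl. ring.
Qed.
Lemma ev_sub (a b : fps) (z : C) : Cmod z <= 1 -> l1 a -> l1 b ->
  ev (a - b)%fps z = (ev a z - ev b z)%C.
Proof.
  intros Hz Ha Hb. replace (a - b)%fps with (a + fK (- RtoC 1)%C * b)%fps.
  - rewrite ev_add, ev_mul, ev_K; auto using l1_K, l1_mul. ring.
  - rewrite fK_opp. ring.
Qed.
Lemma ev_X (z : C) : Cmod z <= 1 -> ev fX z = (1 - z)%C.
Proof. intros Hz. unfold fX. rewrite ev_sub, ev_K, ev_z; auto using l1_K, l1_z. Qed.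
Lemma ev_pow (a : fps) (k : nat) (z : C) : Cmod z <= 1 -> l1 a -> ev (a ^ k)%fps z = (ev a z ^ k)%C.
Proof.
  intros Hz Ha. induction k as [|k IH]; simpl; [apply ev_K|].
  rewrite ev_mul, IH; auto using l1_pow.
Qed.

Lemma Cpow_dist (z w : C) (n : nat) : Cmod z <= 1 -> Cmod w <= 1 ->
  Cmod (z ^ n - w ^ n) <= INR n * Cmod (z - w).
Proof.
  intros Hz Hw. induction n as [|n IH].
  - simpl. replace (1 - 1)%C with (RtoC 0) by ring. rewrite Cmod_0. lra.
  - rewrite S_INR, !Cpow_S.
    replace (z * z ^ n - w * w ^ n)%C with (z * (z ^ n - w ^ n) + (z - w) * w ^ n)%C by ring.
    eapply Rle_trans; [apply Cmod_triangle|]. rewrite !Cmod_mult.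
    pose proof (Cpow_mod_le_1 w n Hw). pose proof (Cmod_ge_0 (z - w)).
    pose proof (Cmod_ge_0 (z ^ n - w ^ n)). pose proof (Cmod_ge_0 z).
    pose proof (Cmod_ge_0 (w ^ n)). nra.
Qed.

(** Continuity in the l^1 norm, uniform over the closed disk: one [eta] serves all radii in the
    continuation argument. Before the index where the tail of [a] becomes small, use |z^k - w^k| <=
    k |z - w|. *)
Lemma scale_equicont (a : fps) (eps : R) : l1 a -> 0 < eps ->
  exists eta, 0 < eta /\ forall z w, Cmod z <= 1 -> Cmod w <= 1 -> Cmod (z - w) <= eta ->
    sums_le (scale z a - scale w a)%fps eps.
Proof.
  intros Ha He. destruct (l1_tail a (eps / 4) Ha) as [N HN]; [lra|].
  pose proof Ha as [A HA]. pose proof (sums_le_nonneg _ _ HA) as HA0.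
  pose proof (pos_INR N) as HN0.
  exists (eps / 2 / ((INR N + 1) * (A + 1))).
  assert (Hd : 0 < (INR N + 1) * (A + 1)) by nra.
  split; [repeat apply Rdiv_lt_0_compat; lra|].
  intros z w Hz Hw Hzw n.
  apply Rle_trans with (rsum (fun k => Cmod ((scale z a - scale w a)%fps k)) (N + n)).
  { apply rsum_mono; [intros; apply Cmod_ge_0|lia]. }
  rewrite rsum_app.
  assert (Hk : forall k, Cmod ((scale z a - scale w a)%fps k) = Cmod (a k) * Cmod (z ^ k - w ^ k)).
  { intros k. rewrite <- Cmod_mult. f_equal. unfold fsub, scale. ring. }
  set (eta := eps / 2 / ((INR N + 1) * (A + 1))) in *.
  assert (Heta : 0 < eta) by (unfold eta; repeat apply Rdiv_lt_0_compat; lra).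
  assert (Heq : (INR N + 1) * (A + 1) * eta = eps / 2) by (unfold eta; field; split; lra).
  apply Rle_trans with (INR N * eta * A + 2 * (eps / 4)).
  2:{ assert (INR N * eta * A <= eps / 2); [|lra]. rewrite <- Heq.
      assert (INR N * A <= (INR N + 1) * (A + 1)) by nra. nra. }
  apply Rplus_le_compat.
  - apply Rle_trans with (rsum (fun k => INR N * eta * Cmod (a k)) N).
    + apply rsum_le. intros k Hkn. rewrite Hk, Rmult_comm.
      apply Rmult_le_compat_r; [apply Cmod_ge_0|].
      eapply Rle_trans; [apply Cpow_dist; auto|].
      apply Rmult_le_compat; auto using pos_INR, Cmod_ge_0. apply le_INR; lia.
    + rewrite rsum_scal. apply Rmult_le_compat_l; [nra|apply HA].
  - apply Rle_trans with (rsum (fun k => 2 * Cmod (a (N + k)%nat)) n).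
    + apply rsum_le. intros k Hkn. rewrite Hk, Rmult_comm.
      apply Rmult_le_compat_r; [apply Cmod_ge_0|].
      unfold Cminus. eapply Rle_trans; [apply Cmod_triangle|]. rewrite Cmod_opp.
      pose proof (Cpow_mod_le_1 z (N + k) Hz). pose proof (Cpow_mod_le_1 w (N + k) Hw). lra.
    + rewrite rsum_scal. specialize (HN n). lra.
Qed.

Lemma ev_equicont (a : fps) (eps : R) : l1 a -> 0 < eps ->
  exists eta, 0 < eta /\ forall z w, Cmod z <= 1 -> Cmod w <= 1 -> Cmod (z - w) <= eta ->
    Cmod (ev a z - ev a w) <= eps.
Proof.
  intros Ha He. destruct (scale_equicont a eps Ha He) as [eta [H0 H]].
  exists eta. split; [exact H0|]. intros z w Hz Hw Hzw.
  replace (ev a z - ev a w)%C with (tsum (scale z a - scale w a)%fps).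
  - apply tsum_bound. now apply H.
  - rewrite <- (scale_1 (scale z a - scale w a)%fps). change (ev (scale z a - scale w a)%fps (RtoC 1) = (ev a z - ev a w)%C).
    rewrite ev_sub; try (apply scale_l1; assumption); [|rewrite Cmod_1; lra].
    rewrite !ev_scale, !Cmult_1_l. reflexivity.
Qed.

(** * Wiener's lemma *)

Lemma tsum_tail_le (u : nat -> C) (N : nat) (eps : R) : l1 u ->
  (forall m, rsum (fun k => Cmod (u (N + k)%nat)) m <= eps) ->
  Cmod (tsum u - fsum u N) <= eps.
Proof.
  intros Hu Ht. apply Rnot_lt_le. intros Hlt.
  destruct (fsum_tsum u ((Cmod (tsum u - fsum u N) - eps) / 2) Hu) as [M HM]; [lra|].
  specialize (HM (N + M)%nat ltac:(lia)). rewrite fsum_app in HM. specialize (Ht M).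
  pose proof (Cmod_fsum_le (fun k => u (N + k)%nat) M) as H1. simpl in H1.
  pose proof (Cmod_triangle (tsum u - (fsum u N + fsum (fun k => u (N + k)%nat) M))
    (fsum (fun k => u (N + k)%nat) M)) as H2.
  replace (tsum u - (fsum u N + fsum (fun k => u (N + k)%nat) M) + fsum (fun k => u (N + k)%nat) M)%C
    with (tsum u - fsum u N)%C in H2 by ring. lra.
Qed.

(** * Roots of unity and Cauchy's coefficient estimate *)

Definition cis (t : R) : C := (cos t, sin t).

Lemma cis_add (s t : R) : cis (s + t) = (cis s * cis t)%C.
Proof.
  unfold cis, Cmult; simpl. rewrite cos_plus, sin_plus. apply injective_projections; simpl; ring.
Qed.
Lemma cis_0 : cis 0 = RtoC 1.
Proof. unfold cis. now rewrite cos_0, sin_0. Qed.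
Lemma cis_pow (t : R) (n : nat) : (cis t ^ n)%C = cis (INR n * t).
Proof.
  induction n as [|n IH].
  - simpl. rewrite Rmult_0_l, cis_0. reflexivity.
  - rewrite Cpow_S, IH, S_INR, <- cis_add. replace ((INR n + 1) * t) with (t + INR n * t) by ring. reflexivity.
Qed.
Lemma Cmod_cis (t : R) : Cmod (cis t) = 1.
Proof.
  unfold Cmod, cis; simpl. pose proof (sin2_cos2 t) as H. unfold Rsqr in H.
  replace (cos t * (cos t * 1) + sin t * (sin t * 1)) with 1 by lra. apply sqrt_1.
Qed.
Lemma cis_neq_1 (t : R) : 0 < t < 2 * PI -> cis t <> RtoC 1.
Proof.
  intros Ht E. injection E as E1 E2.
  replace t with (2 * (t / 2)) in E1 by field. rewrite cos_2a_sin in E1.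
  assert (0 < sin (t / 2)) by (apply sin_gt_0; lra). nra.
Qed.

Lemma geometric_sum_root (u : C) (N : nat) :
  u <> RtoC 1 -> (u ^ N)%C = RtoC 1 -> fsum (fun k => (u ^ k)%C) N = RtoC 0.
Proof.
  intros Hu HN.
  assert (E : ((u - 1) * fsum (fun k => (u ^ k)%C) N = u ^ N - 1)%C).
  { clear HN. induction N as [|N IH]; simpl; [ring|].
    rewrite Cmult_plus_distr_l, IH. ring. }
  rewrite HN in E. assert (Hu' : (u - 1 <> 0)%C).
  { intros H. apply Hu. replace u with (u - 1 + 1)%C by ring. rewrite H. ring. }
  replace (fsum (fun k => (u ^ k)%C) N) with (/ (u - 1) * ((u - 1) * fsum (fun k => (u ^ k)%C) N))%C
    by (field; exact Hu').
  rewrite E. ring.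
Qed.

Lemma cis_char (N j n : nat) : (j < N)%nat -> (n < N)%nat ->
  fsum (fun k => (cis ((INR j - INR n) * (2 * PI / INR N)) ^ k)%C) N
  = if Nat.eq_dec j n then RtoC (INR N) else RtoC 0.
Proof.
  intros Hj Hn. assert (HN : 0 < INR N) by (apply lt_0_INR; lia).
  pose proof PI_RGT_0 as HPI.
  destruct (Nat.eq_dec j n) as [->|Hne].
  - rewrite (fsum_ext _ (fun _ => RtoC 1)).
    + clear. induction N as [|N IH]; [reflexivity|]. rewrite S_INR. simpl. rewrite IH, <- RtoC_plus. reflexivity.
    + intros k _. replace ((INR n - INR n) * (2 * PI / INR N)) with 0 by ring.
      rewrite cis_0. apply Cpow_1_l.
  - apply geometric_sum_root.
    + intros E. assert (E' : cis (- ((INR j - INR n) * (2 * PI / INR N))) = RtoC 1).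
      { pose proof (cis_add ((INR j - INR n) * (2 * PI / INR N)) (- ((INR j - INR n) * (2 * PI / INR N)))) as Ha.
        rewrite Rplus_opp_r, cis_0, E, Cmult_1_l in Ha. now symmetry. }
      assert (Hd : INR N * (2 * PI / INR N) = 2 * PI) by (field; lra).
      assert (Hd0 : 0 < 2 * PI / INR N) by (apply Rdiv_lt_0_compat; lra).
      apply lt_INR in Hj. apply lt_INR in Hn. pose proof (pos_INR j). pose proof (pos_INR n).
      destruct (Rtotal_order (INR j) (INR n)) as [H1|[H1|H1]].
      * apply cis_neq_1 in E'; [exact E'|]. nra.
      * apply INR_eq in H1. lia.
      * apply cis_neq_1 in E; [exact E|]. nra.
    + rewrite cis_pow. replace (INR N * ((INR j - INR n) * (2 * PI / INR N)))
        with (INR j * (2 * PI) + INR n * (- (2 * PI))) by (field; lra).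
      rewrite cis_add, <- !cis_pow. replace (cis (- (2 * PI))) with (RtoC 1).
      * replace (cis (2 * PI)) with (RtoC 1); [rewrite !Cpow_1_l; ring|].
        unfold cis. now rewrite cos_2PI, sin_2PI.
      * unfold cis. rewrite cos_neg, sin_neg, cos_2PI, sin_2PI. unfold RtoC. f_equal. ring.
Qed.

(* Discrete Cauchy formula: average over the N-th roots of unity. *)
Lemma coef_le_sup (h : fps) (Q : R) : l1 h ->
  (forall z, Cmod z = 1 -> Cmod (ev h z) <= Q) -> forall n, Cmod (h n) <= Q.
Proof.
  intros Hh HQ n. apply le_epsilon. intros eps He.
  destruct (l1_tail h eps Hh He) as [N0 HN0].
  (* N exceeds n, so orthogonality isolates h_n among the first N coefficients, and it exceeds N0,
     so truncation at N costs at most eps. *)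
  set (N := S (N0 + n)). assert (HN : 0 < INR N) by (apply lt_0_INR; unfold N; lia).
  set (w := 2 * PI / INR N).
  assert (Htail : forall m, rsum (fun k => Cmod (h (N + k)%nat)) m <= eps).
  { intros m. specialize (HN0 (S n + m)%nat). rewrite rsum_app in HN0.
    pose proof (rsum_nonneg (fun k => Cmod (h (N0 + k)%nat)) (S n) (fun k => Cmod_ge_0 _)).
    rewrite (rsum_ext _ (fun k => Cmod (h (N0 + (S n + k))%nat))); [lra|].
    intros k _. replace (N + k)%nat with (N0 + (S n + k))%nat by (unfold N; lia). reflexivity. }
  set (v := fun k => fsum (scale (cis (INR k * w)) h) N).
  assert (Hv : forall k, Cmod (v k) <= Q + eps).
  { intros k. set (z := cis (INR k * w)).
    assert (Hz : Cmod z = 1) by apply Cmod_cis.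
    assert (Ht : Cmod (ev h z - v k) <= eps).
    { apply tsum_tail_le; [apply scale_l1; [apply Req_le, Cmod_cis|exact Hh]|]. intros m.
      eapply Rle_trans; [|apply (Htail m)]. apply rsum_le. intros j _. apply scale_coef_le, Req_le, Hz. }
    pose proof (Cmod_triangle (ev h z) (- (ev h z - v k))) as H1.
    replace (ev h z + - (ev h z - v k))%C with (v k) in H1 by ring.
    rewrite Cmod_opp in H1. specialize (HQ z Hz). lra. }
  assert (E : fsum (fun k => v k * cis (- (INR n * (INR k * w))))%C N = (RtoC (INR N) * h n)%C).
  { rewrite (fsum_ext _ (fun k => fsum (fun j => h j * cis ((INR j - INR n) * w) ^ k)%C N)).
    - rewrite fsum_exchange.
      rewrite (fsum_single _ N n) by (unfold N; lia || (intros j Hj Hjn; rewrite fsum_scal;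
        unfold w; rewrite cis_char by (unfold N in *; lia);
        destruct (Nat.eq_dec j n); [lia|ring])).
      rewrite fsum_scal. unfold w. rewrite cis_char by (unfold N; lia).
      destruct (Nat.eq_dec n n); [ring|lia].
    - intros k _. unfold v. rewrite Cmult_comm, <- fsum_scal. apply fsum_ext. intros j _.
      unfold scale. rewrite !cis_pow, Cmult_comm, <- Cmult_assoc, <- cis_add. do 2 f_equal. ring. }
  assert (H1 : Cmod (RtoC (INR N) * h n) <= INR N * (Q + eps)).
  { rewrite <- E. eapply Rle_trans; [apply Cmod_fsum_le|]. rewrite <- rsum_const.
    apply rsum_le. intros k _. rewrite Cmod_mult, Cmod_cis, Rmult_1_r. apply Hv. }
  rewrite Cmod_mult, Cmod_R, Rabs_pos_eq in H1 by lra.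
  apply (Rmult_le_reg_l (INR N)); auto.
Qed.

Lemma fpow_order (a : fps) (K n : nat) : a O = RtoC 0 -> (n < K)%nat -> fpow a K n = RtoC 0.
Proof.
  intros Ha. revert n. induction K as [|K IH]; intros n Hn; [lia|].
  simpl. destruct n as [|n]; [rewrite fmul_O, Ha; ring|].
  rewrite fmul_comm. unfold fmul. rewrite (fsum_ext _ (fun _ => RtoC 0)); [apply fsum_0|].
  intros j Hj. destruct j as [|j]; [rewrite Ha; ring|]. rewrite IH by lia. ring.
Qed.

(** Partial sums of 1/(d1 - del) = sum del^k e^(k+1), where e = 1/d1. *)
Fixpoint neumann (del e : fps) (K : nat) : fps :=
  match K with
  | O => fK (RtoC 0)
  | S k => (neumann del e k + del ^ k * e ^ S k)%fps
  end.

Lemma neumann_spec (d1 d2 e1 : fps) (K : nat) : (d1 * e1)%fps = 1%fps ->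
  (d2 * neumann (d1 - d2) e1 K)%fps = (1 - (d1 - d2) ^ K * e1 ^ K)%fps.
Proof.
  intros H. induction K as [|K IH]; simpl; [ring|].
  transitivity (d2 * neumann (d1 - d2) e1 K + d2 * ((d1 - d2) ^ K * (e1 * e1 ^ K)))%fps; [ring|].
  rewrite IH. ring [H].
Qed.

(** The term of index k has norm at most (2M)^(-k) C0 M^(k+1) = C0 M 2^(-k). It matters that the
    powers of [e] grow with base M: submultiplicativity would give the norm of [e] as base, and no
    bound on it uniform in the radius is available. *)
Lemma neumann_bound (del e : fps) (M C0 : R) (K : nat) : 0 < M -> 0 <= C0 ->
  sums_le del (/ (2 * M)) -> (forall k, sums_le (e ^ k)%fps (C0 * M ^ k)) ->
  sums_le (neumann del e K) (2 * C0 * M).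
Proof.
  intros HM HC Hd He.
  assert (H : sums_le (neumann del e K) (2 * C0 * M * (1 - (/ 2) ^ K))).
  { induction K as [|K IH]; simpl neumann.
    - intros n. eapply Rle_trans; [apply sums_le_K|]. rewrite Cmod_0. simpl. lra.
    - eapply sums_le_weaken.
      + apply sums_le_add; [exact IH|]. apply sums_le_mul; [apply sums_le_pow, Hd|apply (He (S K))].
      + assert (Ep : (/ (2 * M)) ^ K * M ^ K = (/ 2) ^ K)
          by (rewrite <- Rpow_mult_distr; f_equal; field; lra).
        simpl. right. transitivity (2 * C0 * M * (1 - (/ 2) ^ K) + C0 * M * ((/ (2 * M)) ^ K * M ^ K)); [ring|].
        rewrite Ep. field. }
  eapply sums_le_weaken; [exact H|].
  assert (0 < (/ 2) ^ K) by (apply pow_lt; lra). assert (0 <= C0 * M) by nra. nra.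
Qed.

(* The truncated Neumann series for 1/d2 is exact up to order K because d1 - d2
   has no constant term. *)
Lemma inverse_step (d1 d2 e1 e2 : fps) (M C0 : R) : 0 < M -> 0 <= C0 ->
  (d1 * e1)%fps = 1%fps -> (d2 * e2)%fps = 1%fps -> d1 O = d2 O ->
  sums_le (d1 - d2)%fps (/ (2 * M)) -> (forall k, sums_le (e1 ^ k)%fps (C0 * M ^ k)) ->
  l1 e2.
Proof.
  intros HM HC H1 H2 H0 Hd He. exists (2 * C0 * M). intros N.
  rewrite (rsum_ext _ (fun k => Cmod (neumann (d1 - d2) e1 N k))).
  - now apply neumann_bound.
  - intros k Hk. f_equal.
    assert (E : e2 = (neumann (d1 - d2) e1 N + (d1 - d2) ^ N * (e1 ^ N * e2))%fps).
    { pose proof (neumann_spec d1 d2 e1 N H1) as Hn.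
      transitivity (e2 * (d2 * neumann (d1 - d2) e1 N) + (d1 - d2) ^ N * (e1 ^ N * e2))%fps.
      - rewrite Hn. ring. - ring [H2]. }
    apply (f_equal (fun f : fps => f k)) in E. etransitivity; [exact E|]. clear E. cbv beta. unfold fadd at 1.
    replace (fmul ((d1 - d2) ^ N)%fps (e1 ^ N * e2)%fps k) with (RtoC 0); [ring|].
    symmetry. unfold fmul at 1. rewrite (fsum_ext _ (fun _ => RtoC 0)); [apply fsum_0|].
    intros j Hj. rewrite fpow_order; [ring| |lia]. unfold fsub. rewrite H0. ring.
Qed.

(** On the circle of radius s the values of e^k = d^(-k) are at most M^k, hence so are its
    coefficients rescaled by s. Passing to t multiplies the i-th one by (t/s)^i, and the geometric
    sum s/(s-t) does not depend on k. *)
Lemma inverse_powers_bound (d e : fps) (s t M : R) : 0 < M -> 0 <= t < s -> s <= 1 ->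
  l1 d -> (d * e)%fps = 1%fps -> l1 (scale (RtoC s) e) ->
  (forall z, Cmod z <= 1 -> / M <= Cmod (ev d z)) ->
  forall k, sums_le (scale (RtoC t) e ^ k)%fps (s / (s - t) * M ^ k).
Proof.
  intros HM Ht Hs Hd Hde Hes Hmin k.
  assert (Hsm : Cmod (RtoC s) <= 1) by (rewrite Cmod_R, Rabs_pos_eq; lra).
  assert (Hco : forall n, Cmod ((scale (RtoC s) e ^ k)%fps n) <= M ^ k).
  { apply coef_le_sup; [now apply l1_pow|]. intros z Hz.
    rewrite ev_pow by (auto; lra). rewrite Cmod_pow. apply pow_incr. split; [apply Cmod_ge_0|].
    assert (E : (ev d (z * RtoC s) * ev (scale (RtoC s) e) z = 1)%C).
    { rewrite <- ev_scale, <- ev_mul, <- scale_mul, Hde, scale_K, ev_K; auto; try lra.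
      now apply scale_l1. }
    assert (E' := f_equal Cmod E). rewrite Cmod_mult, Cmod_1 in E'.
    assert (Hz' : Cmod (z * RtoC s) <= 1) by (rewrite Cmod_mult; pose proof (Cmod_ge_0 (RtoC s)); nra).
    specialize (Hmin _ Hz'). pose proof (Cmod_ge_0 (ev (scale (RtoC s) e) z)).
    assert (Cmod (ev (scale (RtoC s) e) z) * / M <= 1) by nra.
    apply (Rmult_le_reg_r (/ M)); [now apply Rinv_0_lt_compat|]. rewrite Rinv_r by lra. lra. }
  intros n. apply Rle_trans with (rsum (fun i => M ^ k * (t / s) ^ i) n).
  - apply rsum_le. intros i _. specialize (Hco i). rewrite <- scale_pow in *.
    unfold scale in *. rewrite Cmod_mult in *. rewrite Cmod_pow, Cmod_R, Rabs_pos_eq in * by lra.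
    apply (Rmult_le_compat_r ((t / s) ^ i)) in Hco.
    + eapply Rle_trans; [|exact Hco]. right. rewrite Rmult_assoc, <- Rpow_mult_distr. do 2 f_equal. field. lra.
    + apply pow_le. apply Rmult_le_pos; [lra|]. apply Rlt_le, Rinv_0_lt_compat; lra.
  - rewrite rsum_scal, Rmult_comm. apply Rmult_le_compat_r; [apply pow_le; lra|].
    eapply Rle_trans; [apply rsum_geom|].
    + split; [apply Rmult_le_pos; [lra|apply Rlt_le, Rinv_0_lt_compat; lra]|].
      apply (Rmult_lt_reg_r s); [lra|]. unfold Rdiv. rewrite Rmult_assoc, Rinv_l; lra.
    + right. field. split; lra.
Qed.

Lemma wiener_quantitative (d e : fps) (M : R) : 0 < M -> l1 d -> (d * e)%fps = 1%fps ->
  (forall z, Cmod z <= 1 -> / M <= Cmod (ev d z)) -> l1 e.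
Proof.
  intros HM Hd Hde Hmin.
  destruct (scale_equicont d (/ (2 * M)) Hd) as [eta [Heta Heq]].
  { apply Rinv_0_lt_compat; lra. }
  assert (Hscale : forall t, (scale (RtoC t) d * scale (RtoC t) e)%fps = 1%fps).
  { intros t. now rewrite <- scale_mul, Hde, scale_K. }
  assert (Hd0 : forall t, scale (RtoC t) d O = d O) by (intros; unfold scale; simpl; ring).
  assert (Hstep : forall t t', 0 <= t <= 1 -> 0 <= t' <= 1 -> Rabs (t - t') <= eta ->
    forall C0, 0 <= C0 -> (forall k, sums_le (scale (RtoC t) e ^ k)%fps (C0 * M ^ k)) ->
    l1 (scale (RtoC t') e)).
  { intros t t' Ht Ht' Htt C0 HC0 Hk.
    apply (inverse_step (scale (RtoC t) d) (scale (RtoC t') d) (scale (RtoC t) e) _ M C0); auto.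
    - apply Heq; rewrite ?Cmod_R, ?Rabs_pos_eq; try lra. rewrite <- RtoC_minus, Cmod_R. exact Htt. }
  (* The continuation starts at radius 0, where the inverse is the constant 1/d(0) and its powers
     are bounded by M^k, so C0 = 1. *)
  assert (H0 : forall t', 0 <= t' <= 1 -> t' <= eta -> l1 (scale (RtoC t') e)).
  { intros t' Ht' Hte. apply (Hstep 0 t') with (C0 := 1); try lra.
    - rewrite Rminus_0_l, Rabs_Ropp, Rabs_pos_eq; lra.
    - assert (E : scale (RtoC 0) e = fK (e O)).
      { apply functional_extensionality; intros [|n]; unfold scale; simpl; ring. }
      intros k. rewrite E, Rmult_1_l. apply sums_le_pow. eapply sums_le_weaken; [apply sums_le_K|].
      assert (E1 := f_equal (fun f : fps => f O) Hde). cbv beta in E1.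
      rewrite fmul_O, <- (ev_0 d) in E1. cbn [fK] in E1.
      assert (E' := f_equal Cmod E1). rewrite Cmod_mult, Cmod_1 in E'.
      specialize (Hmin (RtoC 0)). rewrite Cmod_0 in Hmin. specialize (Hmin Rle_0_1).
      pose proof (Cmod_ge_0 (e O)). assert (Cmod (e O) * / M <= 1) by nra.
      apply (Rmult_le_reg_r (/ M)); [now apply Rinv_0_lt_compat|]. rewrite Rinv_r by lra. lra. }
  assert (Hn : forall n t', 0 <= t' <= 1 -> t' <= INR (S n) * (eta / 2) -> l1 (scale (RtoC t') e)).
  { induction n as [|n IH]; intros t' Ht' Hb.
    - apply H0; auto. simpl in Hb. lra.
    - destruct (Rle_dec t' eta) as [Hl|Hl]; [now apply H0|].
      apply Rnot_le_lt in Hl. rewrite S_INR in Hb.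
      assert (Hs : l1 (scale (RtoC (t' - eta / 2)) e)) by (apply IH; lra).
      (* Half of [eta] is spent on the bound for powers, going from radius t' - eta/2 down to t' -
         eta. The Neumann series then gains a full [eta], so each round advances by eta/2. *)
      apply (Hstep (t' - eta) t') with (C0 := (t' - eta / 2) / ((t' - eta / 2) - (t' - eta))); try lra.
      + rewrite Rabs_minus_sym, Rabs_pos_eq; lra.
      + apply Rlt_le, Rdiv_lt_0_compat; lra.
      + apply (inverse_powers_bound d e); auto; lra. }
  rewrite <- (scale_1 e).
  destruct (nfloor_ex (2 / eta)) as [n Hnn]; [apply Rlt_le, Rdiv_lt_0_compat; lra|].
  apply (Hn n); [lra|]. rewrite S_INR.
  assert (E : 2 / eta * (eta / 2) = 1) by (field; lra).
  assert (2 / eta * (eta / 2) <= (INR n + 1) * (eta / 2)) by (apply Rmult_le_compat_r; lra). lra.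
Qed.

Lemma Csub_add (a b : C) : (a - b + b)%C = a.
Proof. ring. Qed.
Lemma Cmod_le_of_abs (z : C) (d : R) : Rabs (Re z) <= d -> Rabs (Im z) <= d -> Cmod z <= 2 * d.
Proof. intros. pose proof (Cmod_le_re_im z). lra. Qed.

(** The gauge [del] is both the size of a neighbourhood and the lower bound on it, so the positive
    lower bound [mu] of the gauge given by compactness is already the global bound. *)
Lemma ev_bounded_below (d : fps) : l1 d ->
  (forall z, Cmod z <= 1 -> ev d z <> RtoC 0) ->
  exists mu, 0 < mu /\ forall z, Cmod z <= 1 -> mu <= Cmod (ev d z).
Proof.
  intros Hd Hne.
  assert (Hloc : forall u v : R, exists del : posreal,
    forall z, Cmod z <= 1 -> Rabs (Re z - u) < del -> Rabs (Im z - v) < del ->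
      pos del <= Cmod (ev d z)).
  { intros u v. destruct (Rle_dec (Cmod (u, v)) 1) as [Hin|Hout].
    - assert (Hp : 0 < Cmod (ev d (u, v))) by (apply Cmod_gt_0, Hne, Hin).
      destruct (ev_equicont d (Cmod (ev d (u, v)) / 2) Hd) as [eta [He Heq]]; [lra|].
      assert (Hm : 0 < Rmin (eta / 2) (Cmod (ev d (u, v)) / 2)) by (apply Rmin_pos; lra).
      exists (mkposreal _ Hm). simpl. intros z Hz H1 H2.
      pose proof (Rmin_l (eta / 2) (Cmod (ev d (u, v)) / 2)).
      pose proof (Rmin_r (eta / 2) (Cmod (ev d (u, v)) / 2)).
      specialize (Heq (u, v) z Hin Hz).
      assert (Hc : Cmod ((u, v) - z) <= eta).
      { replace eta with (2 * (eta / 2)) by field.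
        apply Cmod_le_of_abs; unfold Re, Im in *; simpl in *;
        [rewrite Rabs_minus_sym in H1|rewrite Rabs_minus_sym in H2]; unfold Rminus in *; lra. }
      specialize (Heq Hc).
      pose proof (Cmod_triangle (ev d (u, v) - ev d z) (ev d z)) as Ht.
      rewrite Csub_add in Ht. lra.
    (* The square [-1,1]^2 exceeds the disk; at a point outside the disk the gauge is so small that
       no point of the disk is that near. *)
    - assert (Hp : 0 < (Cmod (u, v) - 1) / 2) by lra.
      exists (mkposreal _ Hp). simpl. intros z Hz H1 H2. exfalso.
      assert (Hc : Cmod ((u, v) - z) < 2 * ((Cmod (u, v) - 1) / 2)).
      { eapply Rle_lt_trans; [apply Cmod_le_re_im|].
        unfold Re, Im in *; simpl in *. rewrite Rabs_minus_sym in H1, H2. unfold Rminus in *. lra. }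
      pose proof (Cmod_triangle ((u, v) - z) z) as Ht.
      rewrite Csub_add in Ht. lra. }
  assert (Hch : exists del : R -> R -> posreal, forall u v z, Cmod z <= 1 ->
     Rabs (Re z - u) < del u v -> Rabs (Im z - v) < del u v -> pos (del u v) <= Cmod (ev d z)).
  { exists (fun u v => proj1_sig (constructive_indefinite_description _ (Hloc u v))).
    intros u v. exact (proj2_sig (constructive_indefinite_description _ (Hloc u v))). }
  destruct Hch as [del Hdel].
  destruct (compactness_value_2d (-1) 1 (-1) 1 del) as [mu Hmu].
  exists mu. split; [apply cond_pos|]. intros z Hz.
  apply Rnot_lt_le. intros Hlt.
  pose proof (re_le_Cmod z) as Hr. pose proof (im_le_Cmod z) as Hi.
  apply (Hmu (Re z) (Im z)).
  - apply Rabs_le_between. lra.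
  - apply Rabs_le_between. lra.
  - intros [u [v [_ [_ [H1 [H2 H3]]]]]]. specialize (Hdel u v z Hz H1 H2). lra.
Qed.

Lemma wiener (d e : fps) : l1 d -> (d * e)%fps = 1%fps ->
  (forall z, Cmod z <= 1 -> ev d z <> RtoC 0) -> l1 e.
Proof.
  intros Hd Hde Hne. destruct (ev_bounded_below d Hd Hne) as [mu [Hmu Hb]].
  apply (wiener_quantitative d e (/ mu)); auto.
  - now apply Rinv_0_lt_compat.
  - intros z Hz. rewrite Rinv_inv. auto.
Qed.

(** * The Gamma function *)

Lemma exp_nondecreasing (x y : R) : x <= y -> exp x <= exp y.
Proof. intros [H|H]; [left; now apply exp_increasing|right; now rewrite H]. Qed.

Notation is_RInt_0inf f l := (is_RInt_gen f (at_right 0) (Rbar_locally p_infty) l).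

Lemma at_right_0_pos (P : R -> Prop) (d : R) : 0 < d ->
  (forall t, 0 < t < d -> P t) -> at_right 0 P.
Proof.
  intros Hd H. exists (mkposreal d Hd). intros t Ht Ht0. apply H. split; [exact Ht0|].
  unfold_ball_in Ht.
  apply Rabs_def2 in Ht. lra.
Qed.

Lemma filter_prod_0inf (P : R * R -> Prop) (a b : R) : 0 < a ->
  (forall s t, 0 < s < a -> b < t -> P (s, t)) ->
  filter_prod (at_right 0) (Rbar_locally p_infty) P.
Proof.
  intros Ha H. apply Filter_prod with (Q := fun s => 0 < s < a) (R := fun t => b < t).
  - now apply (at_right_0_pos _ a).
  - now exists b.
  - intros. apply H; assumption.
Qed.

Lemma is_RInt_0inf_derive (f df : R -> R) (la lb : R) :
  (forall t, 0 < t -> is_derive f t (df t)) ->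
  (forall t, 0 < t -> continuous df t) ->
  filterlim f (at_right 0) (locally la) ->
  filterlim f (Rbar_locally p_infty) (locally lb) ->
  is_RInt_0inf df (lb - la).
Proof.
  intros Hd Hc Ha Hb.
  apply (is_RInt_gen_ext (Derive f)).
  - apply (filter_prod_0inf _ 1 1); [lra|]. intros s t Hs Ht u Hu. simpl in Hu.
    rewrite Rmin_left, Rmax_right in Hu by lra. apply is_derive_unique, Hd. lra.
  - apply is_RInt_gen_Derive; auto.
    + apply (filter_prod_0inf _ 1 1); [lra|]. intros s t Hs Ht u Hu. simpl in Hu.
      rewrite Rmin_left, Rmax_right in Hu by lra. eexists. apply Hd. lra.
    + apply (filter_prod_0inf _ 1 1); [lra|]. intros s t Hs Ht u Hu. simpl in Hu.
      rewrite Rmin_left, Rmax_right in Hu by lra.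
      apply (continuous_ext_loc _ df); [|apply Hc; lra].
      assert (Hu0 : 0 < u) by lra. exists (mkposreal u Hu0). intros v Hv.
      unfold_ball_in Hv.
      apply Rabs_def2 in Hv. symmetry. apply is_derive_unique, Hd. lra.
Qed.

Lemma is_RInt_0inf_bounded (f : R -> R) (B : R) :
  (forall t, 0 < t -> continuous f t) -> (forall t, 0 < t -> 0 <= f t) ->
  (forall a b, 0 < a -> a < b -> RInt f a b <= B) ->
  exists l, is_RInt_0inf f l.
Proof.
  intros Hc H0 HB.
  assert (Hex : forall a b, 0 < a -> a <= b -> ex_RInt f a b).
  { intros a b Ha Hab. apply (ex_RInt_continuous (V := R_CompleteNormedModule)).
    intros z Hz. rewrite Rmin_left in Hz by lra. apply Hc. lra. }
  destruct (completeness (fun x => exists a b, 0 < a /\ a < b /\ x = RInt f a b)) as [s [Hs1 Hs2]].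
  - exists B. intros x (a & b & Ha & Hab & ->). now apply HB.
  - exists (RInt f 1 2), 1, 2. repeat split; lra.
  - exists s. intros P [eps HP].
    assert (Hab : exists a b, 0 < a /\ a < b /\ s - eps < RInt f a b).
    { apply NNPP. intros Hn. pose proof (cond_pos eps).
      assert (s <= s - eps); [|lra]. apply Hs2. intros x (a & b & Ha & Hab & ->).
      apply Rnot_lt_le. intros Hlt. apply Hn. exists a, b. auto. }
    destruct Hab as (a & b & Ha & Hab & Hl).
    unfold filtermapi. apply (filter_prod_0inf _ a b); auto. intros u v Hu Hv. simpl.
    exists (RInt f u v). split; [apply (RInt_correct (V := R_CompleteNormedModule)), Hex; lra|].
    apply HP. unfold_ball.
    assert (H1 : RInt f u v <= s) by (apply Hs1; exists u, v; repeat split; lra).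
    assert (H2 : RInt f a b <= RInt f u v).
    { rewrite <- (RInt_Chasles f u a v) by (apply Hex; lra).
      rewrite <- (RInt_Chasles f a b v) by (apply Hex; lra).
      assert (0 <= RInt f u a) by (apply RInt_ge_0; [lra|apply Hex; lra|intros; apply H0; lra]).
      assert (0 <= RInt f b v) by (apply RInt_ge_0; [lra|apply Hex; lra|intros; apply H0; lra]).
      change plus with Rplus. lra. }
    apply Rabs_def1; lra.
Qed.

Lemma is_RInt_0inf_le (f g : R -> R) (lf lg : R) :
  is_RInt_0inf f lf -> is_RInt_0inf g lg ->
  (forall t, 0 < t -> 0 <= f t <= g t) -> lf <= lg.
Proof.
  intros Hf Hg H. eapply Rle_trans; [apply Rle_abs|].
  apply (RInt_gen_norm (V := R_CompleteNormedModule) (Fa := at_right 0) (Fb := Rbar_locally p_infty) f g lf lg); auto.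
  - apply (filter_prod_0inf _ 1 1); [lra|]. intros; simpl; lra.
  - apply (filter_prod_0inf _ 1 1); [lra|]. intros s t Hs Ht u Hu. simpl in Hu.
    specialize (H u ltac:(lra)). change (Rabs (f u) <= g u). rewrite Rabs_pos_eq; lra.
Qed.

Definition gamma_integrand (x t : R) : R := Rpower t (x - 1) * exp (- t).

Lemma gamma_integrand_pos (x t : R) : 0 < gamma_integrand x t.
Proof. apply Rmult_lt_0_compat; apply exp_pos. Qed.

Lemma gamma_integrand_continuous (x t : R) : 0 < t -> continuous (gamma_integrand x) t.
Proof.
  intros Ht. apply (ex_derive_continuous (V := R_NormedModule)).
  unfold gamma_integrand, Rpower. auto_derive. lra.
Qed.

Lemma gamma_integrand_bound (x : R) : 0 < x ->
  exists K, 0 < K /\ forall t, 0 < t -> exp ((x + 1) * ln (1 + t) - t) <= K.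
Proof.
  (* The maximum, attained at t = x. *)
  intros Hx. exists (exp (1 - (x + 1) + (x + 1) * ln (x + 1))). split; [apply exp_pos|].
  intros t Ht. apply exp_nondecreasing.
  assert (H : ln ((1 + t) / (x + 1)) <= (1 + t) / (x + 1) - 1).
  { assert (Hp : 0 < (1 + t) / (x + 1)) by (apply Rdiv_lt_0_compat; lra).
    pose proof (exp_ineq1_le (ln ((1 + t) / (x + 1)))) as H1. rewrite exp_ln in H1 by exact Hp. lra. }
  unfold Rdiv in H at 1. rewrite ln_mult, ln_Rinv in H by (try apply Rinv_0_lt_compat; lra).
  assert (E : (x + 1) * ((1 + t) / (x + 1) - 1) = 1 + t - (x + 1)) by (field; lra).
  assert ((x + 1) * (ln (1 + t) - ln (x + 1)) <= (x + 1) * ((1 + t) / (x + 1) - 1))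
    by (apply Rmult_le_compat_l; lra). lra.
Qed.

Lemma Gamma_correct (x : R) : 0 < x -> is_RInt_0inf (gamma_integrand x) (Gamma x).
Proof.
  intros Hx. destruct (gamma_integrand_bound x Hx) as [K [HK HKb]].
  (* The integrand is dominated by the derivative of the bounded function
     (K/x) (t/(1+t))^x. *)
  set (F := fun t => K / x * exp (x * (ln t - ln (1 + t)))).
  set (dF := fun t => K * exp (x * (ln t - ln (1 + t))) * / (t * (1 + t))).
  assert (HF : forall t, 0 < t -> is_derive F t (dF t)).
  { intros t Ht. unfold F, dF. auto_derive; [lra|]. unfold Rminus. field. lra. }
  assert (HdFc : forall t, 0 < t -> continuous dF t).
  { intros t Ht. apply (ex_derive_continuous (V := R_NormedModule)). unfold dF. auto_derive.
    repeat split; try lra. apply Rmult_integral_contrapositive_currified; lra. }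
  assert (Hle : forall t, 0 < t -> gamma_integrand x t <= dF t).
  { intros t Ht. unfold gamma_integrand, dF, Rpower.
    replace (exp ((x - 1) * ln t) * exp (- t)) with
      (exp ((x + 1) * ln (1 + t) - t) * (exp (x * (ln t - ln (1 + t))) * exp (- ln t + - ln (1 + t))))
      by (rewrite <- !exp_plus; f_equal; ring).
    rewrite exp_plus, !exp_Ropp, !exp_ln, <- Rinv_mult by lra. rewrite (Rmult_assoc K).
    apply Rmult_le_compat_r; [|apply HKb; lra].
    apply Rlt_le, Rmult_lt_0_compat; [apply exp_pos|apply Rinv_0_lt_compat; nra]. }
  assert (Hex : exists l, is_RInt_0inf (gamma_integrand x) l).
  { apply (is_RInt_0inf_bounded _ (K / x)).
    - intros; now apply gamma_integrand_continuous.
    - intros; apply Rlt_le, gamma_integrand_pos.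
    - intros a b Ha Hab.
      assert (HI : is_RInt dF a b (F b - F a)).
      { apply (is_RInt_derive (V := R_CompleteNormedModule) F dF); intros t Ht; rewrite Rmin_left in Ht by lra;
        [apply HF|apply HdFc]; lra. }
      apply Rle_trans with (F b - F a).
      + rewrite <- (is_RInt_unique _ _ _ _ HI). apply RInt_le; [lra| |eexists; exact HI|intros; apply Hle; lra].
        apply (ex_RInt_continuous (V := R_CompleteNormedModule)). intros z Hz.
        rewrite Rmin_left in Hz by lra. apply gamma_integrand_continuous; lra.
      + assert (Hp : 0 < K / x) by (apply Rdiv_lt_0_compat; lra).
        assert (0 <= F a) by (unfold F; apply Rmult_le_pos; [lra|apply Rlt_le, exp_pos]).
        assert (F b <= K / x); [|lra]. unfold F. rewrite <- (Rmult_1_r (K / x)) at 2.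
        apply Rmult_le_compat_l; [lra|]. apply Rle_trans with (exp 0); [apply exp_nondecreasing|rewrite exp_0; lra].
        assert (ln b <= ln (1 + b)) by (apply Rlt_le, ln_increasing; lra). nra. }
  destruct Hex as [l Hl].
  replace (Gamma x) with l; [exact Hl|].
  symmetry. exact (is_RInt_gen_unique (V := R_CompleteNormedModule) _ l Hl).
Qed.

Lemma filterlim_at_right_0_Rpower (x : R) : 0 < x ->
  filterlim (fun t => exp (x * ln t - t)) (at_right 0) (locally 0).
Proof.
  intros Hx P [eps HP]. unfold filtermap.
  apply (at_right_0_pos _ (exp (ln eps / x))); [apply exp_pos|].
  intros t [Ht Hte]. apply HP. unfold_ball.
  rewrite Ropp_0, Rplus_0_r, Rabs_pos_eq by apply Rlt_le, exp_pos.
  rewrite <- (exp_ln eps) by apply cond_pos. apply exp_increasing.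
  assert (H : ln t < ln eps / x) by (rewrite <- (ln_exp (ln eps / x)); now apply ln_increasing).
  apply (Rmult_lt_compat_l x) in H; [|exact Hx].
  replace (x * (ln eps / x)) with (ln eps) in H by (field; lra). lra.
Qed.

Lemma filterlim_infinity_Rpower (x : R) : 0 < x ->
  filterlim (fun t => exp (x * ln t - t)) (Rbar_locally p_infty) (locally 0).
Proof.
  intros Hx P [eps HP]. unfold filtermap.
  destruct (gamma_integrand_bound x Hx) as [K [HK HKb]].
  exists (Rmax 0 (K / eps)). intros t Ht.
  pose proof (Rmax_l 0 (K / eps)). pose proof (Rmax_r 0 (K / eps)). pose proof (cond_pos eps).
  apply HP. unfold_ball.
  rewrite Ropp_0, Rplus_0_r, Rabs_pos_eq by apply Rlt_le, exp_pos.
  assert (Ht0 : 0 < t) by lra. specialize (HKb t Ht0).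
  assert (Hl : ln t <= ln (1 + t)) by (apply Rlt_le, ln_increasing; lra).
  assert (E : exp (x * ln t - t) * (1 + t) <= K).
  { rewrite <- (exp_ln (1 + t)) by lra. rewrite <- exp_plus. eapply Rle_trans; [|exact HKb].
    apply exp_nondecreasing. nra. }
  assert (HKe : K < eps * t).
  { assert (Hq : K / eps < t) by lra. apply (Rmult_lt_compat_l eps) in Hq; [|lra].
    replace (eps * (K / eps)) with K in Hq by (field; lra). exact Hq. }
  pose proof (exp_pos (x * ln t - t)). nra.
Qed.

(** Integrate the derivative of t^x e^(-t), a function that vanishes at both ends. *)
Lemma Gamma_S (x : R) : 0 < x -> Gamma (x + 1) = x * Gamma x.
Proof.
  intros Hx.
  assert (H : is_RInt_0inf (fun t => x * gamma_integrand x t - gamma_integrand (x + 1) t) (0 - 0)).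
  { apply (is_RInt_0inf_derive (fun t => exp (x * ln t - t))).
    - intros t Ht. unfold gamma_integrand, Rpower. auto_derive; [lra|].
      rewrite <- !exp_plus.
      replace ((x - 1) * ln t + - t) with (x * ln t - t + - ln t) by ring.
      replace ((x + 1 - 1) * ln t + - t) with (x * ln t - t) by ring.
      replace (x * ln t + - t) with (x * ln t - t) by ring.
      rewrite (exp_plus _ (- ln t)), exp_Ropp, exp_ln by lra. field. lra.
    - intros t Ht. apply (continuous_minus (V := R_NormedModule) (fun t => x * gamma_integrand x t)).
      + apply (continuous_scal_r (V := R_NormedModule) x (gamma_integrand x)). now apply gamma_integrand_continuous.
      + now apply gamma_integrand_continuous.
    - now apply filterlim_at_right_0_Rpower.
    - now apply filterlim_infinity_Rpower. }
  assert (H' : is_RInt_0inf (fun t => x * gamma_integrand x t - gamma_integrand (x + 1) t)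
                 (x * Gamma x - Gamma (x + 1))).
  { apply (is_RInt_gen_minus (V := R_NormedModule) (fun t => x * gamma_integrand x t)).
    - apply (is_RInt_gen_scal (V := R_NormedModule) (gamma_integrand x)). now apply Gamma_correct.
    - apply Gamma_correct. lra. }
  apply (is_RInt_gen_unique (V := R_CompleteNormedModule)) in H.
  apply (is_RInt_gen_unique (V := R_CompleteNormedModule)) in H'. rewrite H in H'. lra.
Qed.

Lemma Gamma_1 : Gamma 1 = 1.
Proof.
  assert (H : is_RInt_0inf (fun t => exp (- t)) (0 - (- 1))).
  { apply (is_RInt_0inf_derive (fun t => - exp (- t))).
    - intros t Ht. auto_derive; [easy|ring].
    - intros t Ht. apply (ex_derive_continuous (V := R_NormedModule)). auto_derive. easy.
    - apply (filterlim_filter_le_1 (G := at_right 0) (F := locally 0)).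
      + intros P HP. apply filter_le_within, HP.
      + replace (-1) with (- exp (- 0)) by (rewrite Ropp_0, exp_0; ring).
        apply (ex_derive_continuous (V := R_NormedModule) (fun t => - exp (- t)) 0). auto_derive. easy.
    - intros P [eps HP]. unfold filtermap. exists (Rmax 0 (/ eps)). intros t Ht.
      pose proof (Rmax_l 0 (/ eps)). pose proof (Rmax_r 0 (/ eps)). pose proof (cond_pos eps).
      apply HP. unfold_ball.
      rewrite Ropp_0, Rplus_0_r, Rabs_Ropp, Rabs_pos_eq by apply Rlt_le, exp_pos.
      rewrite exp_Ropp. rewrite <- (Rinv_inv eps). apply Rinv_lt_contravar.
      + apply Rmult_lt_0_compat; [now apply Rinv_0_lt_compat|apply exp_pos].
      + pose proof (exp_ineq1_le t). lra. }
  unfold Gamma. rewrite (is_RInt_gen_unique (V := R_CompleteNormedModule) _ (0 - -1)); [ring|].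
  apply (is_RInt_gen_ext (fun t => exp (- t))); [|exact H].
  apply (filter_prod_0inf _ 1 1); [lra|]. intros s t Hs Ht u Hu.
  change (exp (- u) = Rpower u (1 - 1) * exp (- u)). rewrite Rminus_diag. unfold Rpower. rewrite Rmult_0_l, exp_0. ring.
Qed.

Lemma Gamma_nonneg (x : R) : 0 < x -> 0 <= Gamma x.
Proof.
  intros Hx. apply (is_RInt_0inf_le (fun _ => 0) (gamma_integrand x)).
  - replace 0 with (0 - 0) at 2 by ring.
    apply (is_RInt_0inf_derive (fun _ => 0)).
    + intros. auto_derive; auto.
    + intros. apply continuous_const.
    + apply filterlim_const. + apply filterlim_const.
  - now apply Gamma_correct.
  - intros. split; [lra|apply Rlt_le, gamma_integrand_pos].
Qed.

(* y^s <= 1 + s (y - 1) with y = e^v: tangent lines of exp at s v. *)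
Lemma exp_convex_upper (s v : R) : 0 <= s <= 1 -> exp (s * v) <= 1 + s * (exp v - 1).
Proof.
  intros Hs.
  pose proof (exp_ineq1_le ((1 - s) * v)) as H1. pose proof (exp_ineq1_le (- (s * v))) as H2.
  assert (E1 : exp v = exp (s * v) * exp ((1 - s) * v)) by (rewrite <- exp_plus; f_equal; ring).
  assert (E2 : 1 = exp (s * v) * exp (- (s * v))) by (rewrite <- exp_plus, Rplus_opp_r, exp_0; ring).
  pose proof (exp_pos (s * v)) as H3.
  assert (exp v >= exp (s * v) * (1 + (1 - s) * v)) by nra.
  assert (1 >= exp (s * v) * (1 + - (s * v))) by nra. nra.
Qed.

Lemma exp_convex_lower (s v : R) : s <= 0 -> 1 + s * (exp v - 1) <= exp (s * v).
Proof.
  intros Hs. pose proof (exp_ineq1_le (s * v)). pose proof (exp_ineq1_le v). nra.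
Qed.

(** Integrate the tangent bound t^s <= y^s (1 + s (t/y - 1)) against t^(y-1) e^(-t). The point of
    tangency y is the mean of t for this weight, so the linear term integrates to zero. *)
Lemma Gamma_upper (y s : R) : 0 < y -> 0 <= s <= 1 -> Gamma (y + s) <= Rpower y s * Gamma y.
Proof.
  intros Hy Hs.
  replace (Rpower y s * Gamma y) with
    (Rpower y s * (1 - s) * Gamma y + Rpower y s * (s / y) * Gamma (y + 1))
    by (rewrite Gamma_S by exact Hy; field; lra).
  apply (is_RInt_0inf_le (gamma_integrand (y + s))
    (fun t => Rpower y s * (1 - s) * gamma_integrand y t + Rpower y s * (s / y) * gamma_integrand (y + 1) t)).
  - apply Gamma_correct; lra.
  - apply (is_RInt_gen_plus (V := R_NormedModule)).
    + apply (is_RInt_gen_scal (V := R_NormedModule) (gamma_integrand y)), Gamma_correct; lra.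
    + apply (is_RInt_gen_scal (V := R_NormedModule) (gamma_integrand (y + 1))), Gamma_correct; lra.
  - intros t Ht. split; [apply Rlt_le, gamma_integrand_pos|].
    pose proof (exp_convex_upper s (ln t - ln y) Hs) as H.
    unfold gamma_integrand, Rpower.
    replace ((y + s - 1) * ln t) with (s * (ln t - ln y) + s * ln y + (y - 1) * ln t) by ring.
    replace ((y + 1 - 1) * ln t) with (ln t + (y - 1) * ln t) by ring.
    rewrite !exp_plus. rewrite exp_ln by exact Ht.
    replace (exp (ln t - ln y)) with (t * / y) in H
      by (unfold Rminus; rewrite exp_plus, exp_Ropp, !exp_ln by assumption; reflexivity).
    set (P := exp (s * ln y) * exp ((y - 1) * ln t) * exp (- t)).
    assert (HP : 0 < P) by (unfold P; repeat apply Rmult_lt_0_compat; apply exp_pos).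
    apply Rle_trans with ((1 + s * (t * / y - 1)) * P).
    + apply Rle_trans with (exp (s * (ln t - ln y)) * P); [right; unfold P; ring|nra].
    + right. unfold P. field. lra.
Qed.

Lemma Gamma_lower (y s : R) : 0 < y -> 0 <= s <= 1 ->
  Rpower (y + 1) (s - 1) * y * Gamma y <= Gamma (y + s).
Proof.
  (* The tangent of t^(s-1) is taken at y + 1, the mean of t for the weight t^y e^(-t), so that the
     linear term again integrates to zero. *)
  intros Hy Hs. set (c := y + 1).
  assert (Hc : 0 < c) by (unfold c; lra).
  (* The affine minorant of t^(s-1) may be negative, so move its negative part
     to the other side. *)
  assert (Hle : Rpower c (s - 1) * (2 - s) * Gamma (y + 1) <=
    Gamma (y + s) + Rpower c (s - 1) * ((1 - s) / c) * Gamma (y + 1 + 1)).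
  { apply (is_RInt_0inf_le (fun t => Rpower c (s - 1) * (2 - s) * gamma_integrand (y + 1) t)
      (fun t => gamma_integrand (y + s) t + Rpower c (s - 1) * ((1 - s) / c) * gamma_integrand (y + 1 + 1) t)).
    - apply (is_RInt_gen_scal (V := R_NormedModule) (gamma_integrand (y + 1))), Gamma_correct; lra.
    - apply (is_RInt_gen_plus (V := R_NormedModule)).
      + apply Gamma_correct; lra.
      + apply (is_RInt_gen_scal (V := R_NormedModule) (gamma_integrand (y + 1 + 1))), Gamma_correct; lra.
    - intros t Ht. split.
      + apply Rmult_le_pos; [|apply Rlt_le, gamma_integrand_pos].
        apply Rmult_le_pos; [apply Rlt_le, exp_pos|lra].
      + pose proof (exp_convex_lower (s - 1) (ln t - ln c) ltac:(lra)) as H.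
        unfold gamma_integrand, Rpower.
        replace ((y + s - 1) * ln t) with ((s - 1) * (ln t - ln c) + (s - 1) * ln c + y * ln t) by ring.
        replace ((y + 1 - 1) * ln t) with (y * ln t) by ring.
        replace ((y + 1 + 1 - 1) * ln t) with (ln t + y * ln t) by ring.
        rewrite !exp_plus. rewrite exp_ln by exact Ht.
        replace (exp (ln t - ln c)) with (t * / c) in H
          by (unfold Rminus; rewrite exp_plus, exp_Ropp, !exp_ln by assumption; reflexivity).
        set (P := exp ((s - 1) * ln c) * exp (y * ln t) * exp (- t)).
        assert (HP : 0 < P) by (unfold P; repeat apply Rmult_lt_0_compat; apply exp_pos).
        apply Rle_trans with ((1 + (s - 1) * (t * / c - 1)) * P + (1 - s) * (t * / c) * P).
        * right. unfold P. ring.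
        * apply Rle_trans with (exp ((s - 1) * (ln t - ln c)) * P + (1 - s) * (t * / c) * P); [nra|].
          right. unfold P. field. lra. }
  rewrite (Gamma_S (y + 1)), (Gamma_S y) in Hle by lra. fold c in Hle.
  replace (Rpower c (s - 1) * ((1 - s) / c) * (c * (y * Gamma y))) with
    (Rpower c (s - 1) * (1 - s) * (y * Gamma y)) in Hle by (field; lra). lra.
Qed.

(** * Binomial coefficient sequences *)

(* Taylor coefficients of (1 - z)^(-b). *)
Fixpoint bin_seq (b : R) (n : nat) : R :=
  match n with O => 1 | S k => bin_seq b k * ((b + INR k) / INR (S k)) end.

Lemma bin_seq_S (b : R) (n : nat) : INR (S n) * bin_seq b (S n) = (b + INR n) * bin_seq b n.
Proof.
  change (bin_seq b (S n)) with (bin_seq b n * ((b + INR n) / INR (S n))).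
  field. apply not_0_INR. lia.
Qed.

Lemma bin_seq_up (b : R) (n : nat) : b * bin_seq (b + 1) n = (b + INR n) * bin_seq b n.
Proof.
  induction n as [|n IH]; [simpl; ring|].
  apply (Rmult_eq_reg_l (INR (S n))); [|apply not_0_INR; lia].
  transitivity (b * (INR (S n) * bin_seq (b + 1) (S n))); [ring|].
  rewrite bin_seq_S. transitivity ((b + 1 + INR n) * (b * bin_seq (b + 1) n)); [ring|].
  rewrite IH. transitivity ((b + INR (S n)) * (INR (S n) * bin_seq b (S n))); [|ring].
  rewrite bin_seq_S, S_INR. ring.
Qed.

Lemma Gamma_shift (x : R) (n : nat) : 0 < x ->
  Gamma (INR n + x) = INR (fact n) * bin_seq x n * Gamma x.
Proof.
  intros Hx. induction n as [|n IH].
  - simpl. rewrite Rplus_0_l. ring.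
  - rewrite S_INR. replace (INR n + 1 + x) with (INR n + x + 1) by ring.
    pose proof (pos_INR n). rewrite Gamma_S, IH by lra.
    rewrite fact_simpl, mult_INR. transitivity (INR (fact n) * (INR (S n) * bin_seq x (S n)) * Gamma x); [|ring].
    rewrite bin_seq_S. ring.
Qed.

Lemma bin_seq_1 (n : nat) : bin_seq 1 n = 1.
Proof.
  induction n as [|n IH]; [reflexivity|].
  change (bin_seq 1 n * ((1 + INR n) / INR (S n)) = 1).
  rewrite IH, S_INR. pose proof (pos_INR n). field. lra.
Qed.

Lemma is_lim_seq_inv_INR : is_lim_seq (fun n => / INR n) 0.
Proof.
  replace (Finite 0) with (Rbar_inv p_infty) by reflexivity.
  apply is_lim_seq_inv; [apply is_lim_seq_INR|discriminate].
Qed.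

(** Gauss's limit. For 0 < x <= 1 write bin_seq x n Gamma(x) = Gamma(n+x)/n! and squeeze it between
    the two convexity bounds. Larger x reduce to x - 1 by [bin_seq_up] and Gamma(x) = (x-1)
    Gamma(x-1). *)
Lemma bin_seq_lim (x : R) : 0 < x ->
  is_lim_seq (fun n => bin_seq x n * Gamma x / Rpower (INR n) (x - 1)) 1.
Proof.
  assert (Hbase : forall x, 0 < x <= 1 ->
    is_lim_seq (fun n => bin_seq x n * Gamma x / Rpower (INR n) (x - 1)) 1).
  { clear x. intros x Hx.
    apply (is_lim_seq_le_le_loc (fun n => Rpower (1 + / INR n) (x - 1)) _ (fun _ => 1)).
    - exists 1%nat. intros n Hn.
      assert (HnR : 0 < INR n) by (apply lt_0_INR; lia).
      destruct n as [|n]; [lia|].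
      assert (HG : Gamma (INR (S n)) = INR (fact n)).
      { rewrite S_INR, Gamma_shift, bin_seq_1, Gamma_1 by lra. ring. }
      pose proof (Gamma_upper (INR (S n)) x HnR ltac:(lra)) as Hu.
      pose proof (Gamma_lower (INR (S n)) x HnR ltac:(lra)) as Hl.
      rewrite HG, Gamma_shift in Hu, Hl by lra.
      rewrite fact_simpl, mult_INR in Hu, Hl.
      assert (Hf : 0 < INR (fact n)) by (apply INR_fact_lt_0).
      assert (Hp : 0 < Rpower (INR (S n)) (x - 1)) by apply exp_pos.
      assert (E : Rpower (INR (S n)) x = INR (S n) * Rpower (INR (S n)) (x - 1)).
      { rewrite <- (Rpower_1 (INR (S n))) at 2 by exact HnR. rewrite <- Rpower_plus. f_equal. ring. }
      rewrite E in Hu.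
      assert (E2 : Rpower (INR (S n) + 1) (x - 1) = Rpower (INR (S n)) (x - 1) * Rpower (1 + / INR (S n)) (x - 1)).
      { rewrite Rpower_mult_distr; [f_equal; field; lra|lra|].
        assert (0 < / INR (S n)) by now apply Rinv_0_lt_compat. lra. }
      rewrite E2 in Hl.
      set (B := bin_seq x (S n) * Gamma x) in *.
      set (N := INR (S n)) in *. set (P := Rpower N (x - 1)) in *.
      set (f := INR (fact n)) in *. set (Q := Rpower (1 + / N) (x - 1)) in *.
      assert (HfN : 0 < f * N) by nra.
      assert (Hu' : B <= P) by (apply (Rmult_le_reg_l (f * N)); [exact HfN|unfold B; lra]).
      assert (Hl' : P * Q <= B) by (apply (Rmult_le_reg_l (f * N)); [exact HfN|unfold B; lra]).
      split.
      + apply (Rmult_le_reg_r P); [exact Hp|]. unfold Rdiv. rewrite Rmult_assoc, Rinv_l by lra. lra.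
      + apply (Rmult_le_reg_r P); [exact Hp|]. unfold Rdiv. rewrite Rmult_assoc, Rinv_l by lra. lra.
    - assert (E1 : Rpower (1 + 0) (x - 1) = 1)
        by (unfold Rpower; rewrite Rplus_0_r, ln_1, Rmult_0_r, exp_0; reflexivity).
      assert (Hlim : is_lim_seq (fun n => Rpower (1 + / INR n) (x - 1)) (Rpower (1 + 0) (x - 1))).
      { apply (is_lim_seq_continuous (fun h => Rpower (1 + h) (x - 1))).
        - apply continuity_pt_filterlim. apply (ex_derive_continuous (V := R_NormedModule) (fun h => Rpower (1 + h) (x - 1)) 0).
          unfold Rpower. auto_derive. lra.
        - apply is_lim_seq_inv_INR. }
      rewrite E1 in Hlim. exact Hlim.
    - apply is_lim_seq_const. }
  assert (Hn : forall (n : nat) (x : R), 0 < x <= INR n + 1 ->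
    is_lim_seq (fun n => bin_seq x n * Gamma x / Rpower (INR n) (x - 1)) 1).
  { induction n as [|n IH]; intros y Hy; [apply Hbase; simpl in Hy; lra|].
    destruct (Rle_dec y 1) as [Hy1|Hy1]; [apply Hbase; lra|].
    rewrite S_INR in Hy. specialize (IH (y - 1) ltac:(lra)).
    apply (is_lim_seq_ext_loc (fun k => (bin_seq (y - 1) k * Gamma (y - 1) / Rpower (INR k) (y - 1 - 1)) *
              (1 + (y - 1) * / INR k))).
    - exists 1%nat. intros k Hk. assert (HkR : 0 < INR k) by (apply lt_0_INR; lia).
      pose proof (bin_seq_up (y - 1) k) as Hup. replace (y - 1 + 1) with y in Hup by ring.
      pose proof (Gamma_S (y - 1) ltac:(lra)) as HG. replace (y - 1 + 1) with y in HG by ring.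
      rewrite HG. replace (Rpower (INR k) (y - 1)) with (INR k * Rpower (INR k) (y - 1 - 1)).
      2:{ rewrite <- (Rpower_1 (INR k)) at 1 by exact HkR. rewrite <- Rpower_plus. f_equal. ring. }
      assert (0 < Rpower (INR k) (y - 1 - 1)) by apply exp_pos.
      transitivity ((y - 1) * bin_seq y k * Gamma (y - 1) / (INR k * Rpower (INR k) (y - 1 - 1))); [|field; lra].
      rewrite Hup. field. lra.
    - replace (Finite 1) with (Rbar_mult 1 (1 + (y - 1) * 0)) by (simpl; f_equal; ring).
      apply is_lim_seq_mult'; [exact IH|].
      apply (is_lim_seq_plus' (fun _ => 1) (fun n => (y - 1) * / INR n)); [apply is_lim_seq_const|].
      apply (is_lim_seq_scal_l _ (y - 1) 0). apply is_lim_seq_inv_INR. }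
  intros Hx. destruct (nfloor_ex x) as [n Hfl]; [lra|]. apply (Hn n). lra.
Qed.

(** Comparison of integrals gave only Gamma >= 0. If Gamma(x) were 0, the sequence in [bin_seq_lim]
    would be 0 instead of tending to 1. *)
Lemma Gamma_pos (x : R) : 0 < x -> 0 < Gamma x.
Proof.
  intros Hx. destruct (Gamma_nonneg x Hx) as [H|H]; [exact H|]. exfalso.
  pose proof (bin_seq_lim x Hx) as Hl. apply is_lim_seq_unique in Hl.
  rewrite (Lim_seq_ext _ (fun _ => 0)) in Hl.
  - rewrite Lim_seq_const in Hl. injection Hl. lra.
  - intros n. rewrite <- H. unfold Rdiv. ring.
Qed.

(** * Asymptotic expansion of powers *)

(* Taylor coefficients in x of (- ln (1 - x) / x)^a up to order 7, continuing
   ng_coef by the recurrence for powers of a series. *)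
Definition ng6 (a : R) : R :=
  ((a - 5) / 2 * ng_coef 5 a + (2 * a - 4) / 3 * ng_coef 4 a + (3 * a - 3) / 4 * ng_coef 3 a
   + (4 * a - 2) / 5 * ng_coef 2 a + (5 * a - 1) / 6 * ng_coef 1 a + 6 * a / 7) / 6.
Definition ng7 (a : R) : R :=
  ((a - 6) / 2 * ng6 a + (2 * a - 5) / 3 * ng_coef 5 a + (3 * a - 4) / 4 * ng_coef 4 a
   + (4 * a - 3) / 5 * ng_coef 3 a + (5 * a - 2) / 6 * ng_coef 2 a
   + (6 * a - 1) / 7 * ng_coef 1 a + 7 * a / 8) / 7.
Definition pow_coef (k : nat) (s : R) : R :=
  match k with 6%nat => ng6 (- (s + 1)) | 7%nat => ng7 (- (s + 1)) | _ => ng_coef k (- (s + 1)) end.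

(* The expansion of n^(s-j) / Gamma(s-j+1) in the sequences bin_seq (s+1-l), cut off at l = 7. *)
Definition pow_part (s : R) (j n : nat) : R :=
  rsum (fun k => pow_coef k (s - INR j) * bin_seq (s + 1 - INR (j + k)) n) (8 - j).

(** Coefficients of z d/dz X^(-b) = b (X^(-b-1) - X^(-b)) at b = s - l. *)
Lemma bin_seq_theta (s : R) (l n : nat) :
  INR n * bin_seq (s + 1 - INR (S l)) n =
  (s - INR l) * (bin_seq (s + 1 - INR l) n - bin_seq (s + 1 - INR (S l)) n).
Proof.
  pose proof (bin_seq_up (s + 1 - INR (S l)) n) as H. rewrite S_INR in *.
  replace (s + 1 - (INR l + 1) + 1) with (s + 1 - INR l) in H by ring. lra.
Qed.

Lemma bin_seq_diff (b : R) (n : nat) : bin_seq b (S n) - bin_seq b n = bin_seq (b - 1) (S n).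
Proof.
  pose proof (bin_seq_up (b - 1) n) as H. replace (b - 1 + 1) with b in H by ring.
  apply (Rmult_eq_reg_l (INR (S n))); [|apply not_0_INR; lia].
  rewrite Rmult_minus_distr_l, !bin_seq_S, S_INR. lra.
Qed.

(** Mirrors n n^(s-j-1)/Gamma(s-j) = (s-j) n^(s-j)/Gamma(s-j+1). The coefficients match by the
    recurrence for powers of a series; [kappa] collects what the cut-off leaves at the last
    sequence, that of X^(6-s). *)
Lemma pow_part_theta (s : R) (j : nat) : (j <= 6)%nat ->
  exists kappa, forall n, INR n * pow_part s (S j) n =
    (s - INR j) * pow_part s j n + kappa * bin_seq (s - 6) n.
Proof.
  intros Hj.
  exists (- pow_coef (6 - j) (s - INR (S j)) * (s - 6) - (s - INR j) * pow_coef (7 - j) (s - INR j)).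
  intros n.
  pose proof (bin_seq_theta s 0 n) as H0. pose proof (bin_seq_theta s 1 n) as H1.
  pose proof (bin_seq_theta s 2 n) as H2. pose proof (bin_seq_theta s 3 n) as H3.
  pose proof (bin_seq_theta s 4 n) as H4. pose proof (bin_seq_theta s 5 n) as H5.
  pose proof (bin_seq_theta s 6 n) as H6.
  assert (H7 : bin_seq (s - 6) n = bin_seq (s + 1 - INR 7) n) by (f_equal; simpl; ring).
  rewrite H7. clear H7. unfold pow_part.
  do 7 (destruct j as [|j];
   [cbn [rsum Nat.sub Nat.add pow_coef]; revert H0 H1 H2 H3 H4 H5 H6;
    generalize (bin_seq (s + 1 - INR 0) n) (bin_seq (s + 1 - INR 1) n) (bin_seq (s + 1 - INR 2) n)
     (bin_seq (s + 1 - INR 3) n) (bin_seq (s + 1 - INR 4) n) (bin_seq (s + 1 - INR 5) n)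
     (bin_seq (s + 1 - INR 6) n) (bin_seq (s + 1 - INR 7) n);
    intros a0 a1 a2 a3 a4 a5 a6 a7; generalize (INR n); intros N; cbn [INR]; intros;
    unfold ng7, ng6, ng_coef; field [H0 H1 H2 H3 H4 H5 H6]|]).
  lia.
Qed.

(* The coefficients (-1)^(j+1)/j! come from x = 1 - exp (ln (1 - x)). *)
Lemma pow_part_diff (s : R) (n : nat) :
  pow_part s 0 n =
  pow_part s 0 (S n) - pow_part s 1 (S n) + pow_part s 2 (S n) / 2 - pow_part s 3 (S n) / 6
  + pow_part s 4 (S n) / 24 - pow_part s 5 (S n) / 120 + pow_part s 6 (S n) / 720
  - pow_part s 7 (S n) / 5040 - pow_coef 7 s * bin_seq (s - 7) (S n).
Proof.
  assert (Hd : forall l, bin_seq (s + 1 - INR l) n =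
    bin_seq (s + 1 - INR l) (S n) - bin_seq (s + 1 - INR (S l)) (S n)).
  { intros l. pose proof (bin_seq_diff (s + 1 - INR l) n) as H. rewrite S_INR.
    replace (s + 1 - INR l - 1) with (s + 1 - (INR l + 1)) in H by ring. lra. }
  assert (H8 : bin_seq (s - 7) (S n) = bin_seq (s + 1 - INR 8) (S n)) by (f_equal; simpl; ring).
  rewrite H8. clear H8. unfold pow_part. cbn [rsum Nat.sub Nat.add pow_coef].
  rewrite !Hd.
  generalize (bin_seq (s + 1 - INR 0) (S n)) (bin_seq (s + 1 - INR 1) (S n)) (bin_seq (s + 1 - INR 2) (S n))
     (bin_seq (s + 1 - INR 3) (S n)) (bin_seq (s + 1 - INR 4) (S n)) (bin_seq (s + 1 - INR 5) (S n))
     (bin_seq (s + 1 - INR 6) (S n)) (bin_seq (s + 1 - INR 7) (S n)) (bin_seq (s + 1 - INR 8) (S n)).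
  intros a0 a1 a2 a3 a4 a5 a6 a7 a8. cbn [INR]. unfold ng7, ng6, ng_coef. field.
Qed.

(** * Growth rates in powers of n *)

Definition pow_bigO (e : R) (u : nat -> R) : Prop :=
  exists K N, 0 <= K /\ forall n, (N <= n)%nat -> Rabs (u n) <= K * Rpower (INR n) e.

Lemma bigO_add (e : R) (u v : nat -> R) :
  pow_bigO e u -> pow_bigO e v -> pow_bigO e (fun n => u n + v n).
Proof.
  intros (K & N & HK & H) (L & M & HL & H'). exists (K + L), (N + M)%nat. split; [lra|].
  intros n Hn. specialize (H n ltac:(lia)). specialize (H' n ltac:(lia)).
  pose proof (Rabs_triang (u n) (v n)). lra.
Qed.
Lemma bigO_ext (e : R) (u v : nat -> R) (N : nat) :
  (forall n, (N <= n)%nat -> u n = v n) -> pow_bigO e u -> pow_bigO e v.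
Proof.
  intros E (K & M & HK & H). exists K, (N + M)%nat. split; [exact HK|].
  intros n Hn. rewrite <- E by lia. apply H; lia.
Qed.
Lemma bigO_mul (e f : R) (u v : nat -> R) :
  pow_bigO e u -> pow_bigO f v -> pow_bigO (e + f) (fun n => u n * v n).
Proof.
  intros (K & N & HK & H) (L & M & HL & H'). exists (K * L), (N + M)%nat. split; [nra|].
  intros n Hn. specialize (H n ltac:(lia)). specialize (H' n ltac:(lia)).
  rewrite Rabs_mult, Rpower_plus.
  replace (K * L * (Rpower (INR n) e * Rpower (INR n) f)) with
    (K * Rpower (INR n) e * (L * Rpower (INR n) f)) by ring.
  apply Rmult_le_compat; auto using Rabs_pos.
Qed.
Lemma bigO_Rpower (e : R) : pow_bigO e (fun n => Rpower (INR n) e).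
Proof.
  exists 1, 0%nat. split; [lra|]. intros n _.
  rewrite Rabs_pos_eq by apply Rlt_le, exp_pos. lra.
Qed.
Lemma Rpower_0_r (x : R) : Rpower x 0 = 1.
Proof. unfold Rpower. rewrite Rmult_0_l. apply exp_0. Qed.
Lemma bigO_const (c : R) : pow_bigO 0 (fun _ => c).
Proof.
  exists (Rabs c), 0%nat. split; [apply Rabs_pos|]. intros n _. rewrite Rpower_0_r. lra.
Qed.
Lemma bigO_scal (c e : R) (u : nat -> R) : pow_bigO e u -> pow_bigO e (fun n => c * u n).
Proof.
  intros H. replace e with (0 + e) by ring. apply bigO_mul; [apply bigO_const|exact H].
Qed.
Lemma bigO_sub (e : R) (u v : nat -> R) :
  pow_bigO e u -> pow_bigO e v -> pow_bigO e (fun n => u n - v n).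
Proof.
  intros Hu Hv. apply (bigO_ext _ (fun n => u n + -1 * v n) _ 0); [intros; ring|].
  apply bigO_add; [exact Hu|now apply bigO_scal].
Qed.
Lemma bigO_weaken (e f : R) (u : nat -> R) : e <= f -> pow_bigO e u -> pow_bigO f u.
Proof.
  intros Hef (K & N & HK & H). exists K, (S N). split; [exact HK|]. intros n Hn.
  eapply Rle_trans; [apply H; lia|]. apply Rmult_le_compat_l; [exact HK|].
  apply Rle_Rpower; [|exact Hef]. change 1 with (INR 1). apply le_INR. lia.
Qed.
Lemma Rpower_INR_opp_nat (n k : nat) : (0 < n)%nat -> Rpower (INR n) (- INR k) = (/ INR n) ^ k.
Proof.
  intros Hn. rewrite Rpower_Ropp, Rpower_pow, pow_inv by now apply lt_0_INR. reflexivity.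
Qed.
Lemma bigO_inv : pow_bigO (- 1) (fun n => / INR n).
Proof.
  apply (bigO_ext _ (fun n => Rpower (INR n) (- 1)) _ 1); [|apply bigO_Rpower].
  intros n Hn. replace (- 1) with (- INR 1) by (simpl; ring). rewrite Rpower_INR_opp_nat by lia. ring.
Qed.

Lemma bigO_neg_lim (e : R) (u : nat -> R) : e < 0 -> pow_bigO e u -> is_lim_seq u 0.
Proof.
  intros He (K & N & HK & H).
  apply is_lim_seq_Reals. intros eps Heps.
  assert (Hp : 0 < K + 1) by lra.
  destruct (nfloor_ex (exp (ln (eps / (K + 1)) / e))) as [M HM]; [apply Rlt_le, exp_pos|].
  exists (S (N + M)). intros n Hn. unfold R_dist. rewrite Rminus_0_r.
  eapply Rle_lt_trans; [apply H; lia|].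
  assert (HnR : exp (ln (eps / (K + 1)) / e) < INR n).
  { eapply Rlt_le_trans; [apply HM|]. rewrite <- S_INR. apply le_INR. lia. }
  assert (Hn0 : 0 < INR n) by (eapply Rlt_trans; [apply exp_pos|exact HnR]).
  assert (Hlt : Rpower (INR n) e < eps / (K + 1)).
  { unfold Rpower. rewrite <- (exp_ln (eps / (K + 1))) by (apply Rdiv_lt_0_compat; lra).
    apply exp_increasing.
    assert (Hl : ln (eps / (K + 1)) / e < ln (INR n)).
    { rewrite <- (ln_exp (_ / e)). apply ln_increasing; [apply exp_pos|exact HnR]. }
    apply (Rmult_lt_gt_compat_neg_l e) in Hl; [|exact He].
    replace (e * (ln (eps / (K + 1)) / e)) with (ln (eps / (K + 1))) in Hl by (field; lra). lra. }
  assert (Hpos : 0 < Rpower (INR n) e) by apply exp_pos.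
  apply (Rmult_lt_compat_l (K + 1)) in Hlt; [|exact Hp].
  replace ((K + 1) * (eps / (K + 1))) with eps in Hlt by (field; lra). nra.
Qed.

Lemma bigO_of_lim (e l : R) (u : nat -> R) :
  is_lim_seq (fun n => u n / Rpower (INR n) e) l -> pow_bigO e u.
Proof.
  intros H. apply is_lim_seq_Reals in H. destruct (H 1) as [N HN]; [lra|].
  exists (Rabs l + 1), N. split; [pose proof (Rabs_pos l); lra|]. intros n Hn.
  specialize (HN n Hn). unfold R_dist in HN.
  assert (Hp : 0 < Rpower (INR n) e) by apply exp_pos.
  assert (Hd : Rabs (u n / Rpower (INR n) e) <= Rabs l + 1).
  { pose proof (Rabs_triang (u n / Rpower (INR n) e - l) l) as Ht.
    replace (u n / Rpower (INR n) e - l + l) with (u n / Rpower (INR n) e) in Ht by ring. lra. }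
  replace (u n) with (u n / Rpower (INR n) e * Rpower (INR n) e) by (field; lra).
  rewrite Rabs_mult, (Rabs_pos_eq (Rpower _ _)) by lra. apply Rmult_le_compat_r; lra.
Qed.

(* For b <= 0, |b_{n+1} / b_n| = 1 - d/(n+1) <= (1 + 1/(n+1))^(-d) with d = 1 - b. *)
Lemma bigO_bin_seq (b : R) : pow_bigO (b - 1) (bin_seq b).
Proof.
  destruct (Rlt_le_dec 0 b) as [Hb|Hb].
  { apply (bigO_of_lim _ (/ Gamma b * 1)).
    apply (is_lim_seq_ext (fun n => / Gamma b * (bin_seq b n * Gamma b / Rpower (INR n) (b - 1)))).
    - intros n. pose proof (Gamma_pos b Hb). assert (0 < Rpower (INR n) (b - 1)) by apply exp_pos.
      field. lra.
    - apply (is_lim_seq_scal_l _ (/ Gamma b) 1). now apply bin_seq_lim. }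
  destruct (nfloor_ex (Rabs (1 - b))) as [N HN]; [apply Rabs_pos|].
  assert (Hstep : forall n, (S N <= n)%nat ->
    Rabs (bin_seq b (S n)) * Rpower (INR (S (S n))) (1 - b) <=
    Rabs (bin_seq b n) * Rpower (INR (S n)) (1 - b)).
  { intros n Hn. change (bin_seq b (S n)) with (bin_seq b n * ((b + INR n) / INR (S n))).
    rewrite Rabs_mult, Rmult_assoc. apply Rmult_le_compat_l; [apply Rabs_pos|].
    assert (Hn1 : 0 < INR (S n)) by (apply lt_0_INR; lia).
    assert (Hpos : 0 <= b + INR n).
    { pose proof (Rle_abs (1 - b)). apply le_INR in Hn. rewrite S_INR in Hn. lra. }
    rewrite Rabs_pos_eq.
    2:{ apply Rmult_le_pos; [lra|]. apply Rlt_le, Rinv_0_lt_compat, Hn1. }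
    set (h := / INR (S n)). assert (Hh : 0 < h) by now apply Rinv_0_lt_compat.
    replace (Rpower (INR (S (S n))) (1 - b)) with (Rpower (1 + h) (1 - b) * Rpower (INR (S n)) (1 - b)).
    2:{ rewrite Rpower_mult_distr by lra. f_equal. unfold h. rewrite (S_INR (S n)). field. lra. }
    rewrite <- Rmult_assoc. rewrite <- (Rmult_1_l (Rpower (INR (S n)) (1 - b))) at 2.
    apply Rmult_le_compat_r; [apply Rlt_le, exp_pos|].
    replace ((b + INR n) / INR (S n)) with (1 - (1 - b) * h).
    2:{ unfold h. rewrite S_INR in *. field. lra. }
    assert (Hl : ln (1 + h) <= h).
    { pose proof (exp_ineq1_le (ln (1 + h))) as H. rewrite exp_ln in H by lra. lra. }
    assert (Hq : 1 - (1 - b) * h = (b + INR n) * h).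
    { unfold h. rewrite S_INR in *. field. lra. }
    assert (H1 : Rpower (1 + h) (1 - b) <= exp ((1 - b) * h)).
    { apply exp_nondecreasing. apply Rmult_le_compat_l; lra. }
    assert (H2 : 1 - (1 - b) * h <= exp (- ((1 - b) * h))).
    { pose proof (exp_ineq1_le (- ((1 - b) * h))). lra. }
    apply Rle_trans with (exp (- ((1 - b) * h)) * exp ((1 - b) * h)).
    - apply Rmult_le_compat; auto; [rewrite Hq; nra|apply Rlt_le, exp_pos].
    - rewrite <- exp_plus, Rplus_opp_l, exp_0. lra. }
  set (K := Rabs (bin_seq b (S N)) * Rpower (INR (S (S N))) (1 - b)).
  assert (Hall : forall k, Rabs (bin_seq b (S N + k)) * Rpower (INR (S (S N + k))) (1 - b) <= K).
  { induction k as [|k IH]; [rewrite Nat.add_0_r; unfold K; lra|].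
    rewrite Nat.add_succ_r. eapply Rle_trans; [apply Hstep; lia|exact IH]. }
  exists K, (S N). split.
  { apply Rmult_le_pos; [apply Rabs_pos|apply Rlt_le, exp_pos]. }
  intros n Hn. specialize (Hall (n - S N)%nat).
  replace (S N + (n - S N))%nat with n in Hall by lia.
  assert (Hp : 0 < Rpower (INR n) (1 - b)) by apply exp_pos.
  replace (b - 1) with (- (1 - b)) by ring. rewrite Rpower_Ropp.
  apply (Rmult_le_reg_r (Rpower (INR n) (1 - b))); [exact Hp|].
  rewrite Rmult_assoc, Rinv_l, Rmult_1_r by lra.
  eapply Rle_trans; [|exact Hall]. apply Rmult_le_compat_l; [apply Rabs_pos|].
  apply Rle_Rpower_l; [lra|]. split; [apply lt_0_INR; lia|apply le_INR; lia].
Qed.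

(** The derivative of the remainder of order J + 1 for s is -s times the remainder of order J for s
    - 1, so the mean value theorem gains one power of h. The restriction h <= 1/2 bounds the
    remainder of order 0 by 2^|s|. *)
Lemma binomial_taylor (J : nat) : forall s, exists K, 0 <= K /\ forall h, 0 <= h <= / 2 ->
  Rabs (Rpower (1 - h) s - rsum (fun j => bin_seq (- s) j * h ^ j) J) <= K * h ^ J.
Proof.
  induction J as [|J IH]; intros s.
  - exists (exp (Rabs s * ln 2)). split; [apply Rlt_le, exp_pos|]. intros h Hh. simpl.
    rewrite Rminus_0_r, Rmult_1_r, Rabs_pos_eq by apply Rlt_le, exp_pos.
    apply exp_nondecreasing. eapply Rle_trans; [apply Rle_abs|]. rewrite Rabs_mult.
    apply Rmult_le_compat_l; [apply Rabs_pos|].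
    assert (Hl : - ln 2 <= ln (1 - h)).
    { rewrite <- ln_Rinv by lra. destruct (Req_dec (1 - h) (/ 2)) as [->|Hne]; [lra|].
      apply Rlt_le, ln_increasing; lra. }
    assert (Hl2 : ln (1 - h) <= 0).
    { rewrite <- ln_1. destruct (Req_dec h 0) as [->|Hne]; [rewrite Rminus_0_r; lra|].
      apply Rlt_le, ln_increasing; lra. }
    rewrite Rabs_left1; lra.
  - destruct (IH (s - 1)) as (K & HK & H). exists (Rabs s * K).
    split; [apply Rmult_le_pos; [apply Rabs_pos|exact HK]|]. intros h Hh.
    set (f := fun h => Rpower (1 - h) s - rsum (fun j => bin_seq (- s) j * h ^ j) (S J)).
    set (df := fun h => - s * (Rpower (1 - h) (s - 1) - rsum (fun j => bin_seq (- (s - 1)) j * h ^ j) J)).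
    assert (Hd : forall x, x < 1 -> is_derive f x (df x)).
    { intros x Hx. unfold f, df. rewrite Rmult_minus_distr_l.
      apply (is_derive_minus (K := R_AbsRing) (V := R_NormedModule) (fun h => Rpower (1 - h) s)).
      - unfold Rpower. auto_derive; [lra|].
        replace ((s - 1) * ln (1 - x)) with (s * ln (1 - x) + - ln (1 - x)) by ring.
        rewrite exp_plus, exp_Ropp, exp_ln by lra. unfold Rminus. field. lra.
      - clear. induction J as [|J IH].
        + simpl. auto_derive; [easy|ring].
        + simpl rsum. rewrite Rmult_plus_distr_l.
          apply (is_derive_plus (K := R_AbsRing) (V := R_NormedModule) (fun h => rsum (fun j => bin_seq (- s) j * h ^ j) J + bin_seq (- s) J * h ^ J)).
          * exact IH.
          * pose proof (bin_seq_S (- s) J) as H1. pose proof (bin_seq_up (- s) J) as H2.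
            replace (- s + 1) with (- (s - 1)) in H2 by ring.
            apply (is_derive_ext (fun h => bin_seq (- s) (S J) * h ^ S J)); [reflexivity|].
            auto_derive; [easy|]. change (bin_seq (- s) (S J) * (1 * (INR (S J) * x ^ J)) = - s * (bin_seq (- (s - 1)) J * x ^ J)).
            transitivity ((- s * bin_seq (- (s - 1)) J) * x ^ J); [|ring]. rewrite H2, <- H1. ring. }
    destruct (MVT_gen f 0 h df) as [c [Hc E]].
    + intros x Hx. rewrite Rmin_left, Rmax_right in Hx by lra. apply Hd. lra.
    + intros x Hx. rewrite Rmin_left, Rmax_right in Hx by lra.
      apply continuity_pt_filterlim, (ex_derive_continuous (V := R_NormedModule)). eexists. apply Hd. lra.
    + rewrite Rmin_left, Rmax_right in Hc by lra.
      assert (Hf0 : f 0 = 0).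
      { unfold f. rewrite Rminus_0_r. unfold Rpower. rewrite ln_1, Rmult_0_r, exp_0.
        rewrite rsum_S_l, (rsum_ext _ (fun _ => 0)), rsum_const; [simpl; ring|].
        intros k _. simpl. ring. }
      rewrite Hf0, !Rminus_0_r in E. change (Rabs (f h) <= Rabs s * K * h ^ S J). rewrite E.
      unfold df. rewrite !Rabs_mult, Rabs_Ropp, (Rabs_pos_eq h) by lra. simpl.
      specialize (H c ltac:(lra)).
      assert (Hcp : c ^ J <= h ^ J) by (apply pow_incr; lra).
      pose proof (Rabs_pos s). pose proof (pow_le c J ltac:(lra)).
      assert (H3 : Rabs (Rpower (1 - c) (s - 1) - rsum (fun j => bin_seq (- (s - 1)) j * c ^ j) J) <= K * h ^ J) by nra.
      apply Rle_trans with (Rabs s * (K * h ^ J) * h); [|right; ring].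
      apply Rmult_le_compat_r; [lra|]. now apply Rmult_le_compat_l.
Qed.

Lemma Rpower_INR_pred (s : R) (n : nat) : (1 <= n)%nat ->
  Rpower (INR n) s = Rpower (INR (S n)) s * Rpower (1 - / INR (S n)) s.
Proof.
  intros Hn. assert (H : 0 < INR n) by (apply lt_0_INR; lia). pose proof (S_INR n) as HS.
  assert (Hi : / INR (S n) < 1) by (rewrite <- Rinv_1; apply Rinv_lt_contravar; lra).
  rewrite Rpower_mult_distr by lra. f_equal. rewrite HS. field. lra.
Qed.

Lemma lim_of_summable_steps (r : nat -> R) (l K : R) (N k : nat) : 0 <= K -> (1 <= N)%nat -> (1 <= k)%nat ->
  is_lim_seq r l ->
  (forall n, (N <= n)%nat -> Rabs (r n - r (S n)) <= K * (/ INR (S n)) ^ S k) ->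
  forall n, (N <= n)%nat -> Rabs (r n - l) <= K * (/ INR n) ^ k.
Proof.
  intros HK HN Hk Hl Hstep n Hn.
  (* (1/(m+1))^(k+1) <= (1/m)^k - (1/(m+1))^k, so the steps telescope. *)
  assert (Htel : forall m, (1 <= m)%nat -> (/ INR (S m)) ^ S k <= (/ INR m) ^ k - (/ INR (S m)) ^ k).
  { intros m Hm. assert (H0 : 0 < INR m) by (apply lt_0_INR; lia). pose proof (S_INR m) as HS.
    set (h := / INR (S m)). assert (Hh : 0 < h) by (apply Rinv_0_lt_compat; lra).
    assert (E : / INR m = h * (1 + / INR m)) by (unfold h; rewrite HS; field; lra).
    assert (Hm0 : 0 < / INR m) by now apply Rinv_0_lt_compat.
    assert (H1 : h ^ k * (1 + / INR m) <= (/ INR m) ^ k).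
    { rewrite E at 2. rewrite Rpow_mult_distr. apply Rmult_le_compat_l; [apply pow_le; lra|].
      rewrite <- (pow_1 (1 + / INR m)) at 1. apply Rle_pow; [lra|lia]. }
    assert (H2 : h <= / INR m) by nra.
    assert (0 < h ^ k) by now apply pow_lt.
    change (h ^ S k) with (h * h ^ k). nra. }
  assert (Hfin : forall m, Rabs (r n - r (n + m)%nat) <= K * ((/ INR n) ^ k - (/ INR (n + m)) ^ k)).
  { induction m as [|m IH].
    - rewrite Nat.add_0_r, !Rminus_diag, Rabs_R0. lra.
    - rewrite Nat.add_succ_r. specialize (Hstep (n + m)%nat ltac:(lia)). specialize (Htel (n + m)%nat ltac:(lia)).
      pose proof (Rabs_triang (r n - r (n + m)%nat) (r (n + m)%nat - r (S (n + m)))) as Ht.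
      replace (r n - r (n + m)%nat + (r (n + m)%nat - r (S (n + m)))) with (r n - r (S (n + m))) in Ht by ring.
      assert (K * (/ INR (S (n + m))) ^ S k <= K * ((/ INR (n + m)) ^ k - (/ INR (S (n + m))) ^ k))
        by (apply Rmult_le_compat_l; lra). lra. }
  assert (Hfin' : forall m, Rabs (r n - r (m + n)%nat) <= K * (/ INR n) ^ k).
  { intros m. rewrite Nat.add_comm. eapply Rle_trans; [apply Hfin|].
    assert (0 < (/ INR (n + m)) ^ k) by (apply pow_lt, Rinv_0_lt_compat, lt_0_INR; lia). nra. }
  assert (Hlim : is_lim_seq (fun m => Rabs (r n - r (m + n)%nat)) (Rabs (r n - l))).
  { apply (is_lim_seq_abs _ (r n - l)). apply (is_lim_seq_minus' (fun _ => r n)); [apply is_lim_seq_const|].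
    now apply (is_lim_seq_incr_n r n). }
  exact (is_lim_seq_le _ (fun _ => K * (/ INR n) ^ k) (Rabs (r n - l)) (K * (/ INR n) ^ k) Hfin' Hlim (is_lim_seq_const _)).
Qed.

Lemma bigO_bin_seq_le (b e : R) : b - 1 <= e -> pow_bigO e (bin_seq b).
Proof. intros H. apply (bigO_weaken (b - 1)); [exact H|apply bigO_bin_seq]. Qed.

Lemma bigO_pow_part (s : R) : pow_bigO s (pow_part s 0).
Proof.
  unfold pow_part. cbn [rsum Nat.sub Nat.add].
  apply (bigO_ext _ (fun n => rsum (fun k => pow_coef k (s - INR 0) * bin_seq (s + 1 - INR k) n) 8) _ 0);
    [reflexivity|].
  generalize 8%nat. induction n as [|m IH]; simpl rsum.
  - replace s with (0 + s) by ring.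
    apply (bigO_ext _ (fun n => 0 * Rpower (INR n) s) _ 0); [intros; ring|].
    apply bigO_mul; [apply bigO_const|apply bigO_Rpower].
  - apply bigO_add; [exact IH|]. apply bigO_scal, bigO_bin_seq_le. pose proof (pos_INR m). lra.
Qed.

Lemma pow_part_lim (s : R) : -1 < s ->
  is_lim_seq (fun n => pow_part s 0 n / Rpower (INR n) s) (/ Gamma (s + 1)).
Proof.
  intros Hs. pose proof (Gamma_pos (s + 1) ltac:(lra)) as HG.
  apply (is_lim_seq_ext (fun n => / Gamma (s + 1) * (bin_seq (s + 1) n * Gamma (s + 1) / Rpower (INR n) (s + 1 - 1))
    + rsum (fun k => pow_coef (S k) (s - INR 0) * bin_seq (s + 1 - INR (S k)) n) 7 * Rpower (INR n) (- s))).
  - intros n. unfold pow_part. change (8 - 0)%nat with 8%nat. rewrite (rsum_S_l _ 7).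
    replace (s + 1 - 1) with s by ring. rewrite Rpower_Ropp.
    assert (0 < Rpower (INR n) s) by apply exp_pos.
    replace (s + 1 - INR (0 + 0)) with (s + 1) by (simpl; ring).
    cbn [pow_coef ng_coef Nat.add]. field. lra.
  - replace (Finite (/ Gamma (s + 1))) with (Finite (/ Gamma (s + 1) * 1 + 0)) by (f_equal; ring).
    apply is_lim_seq_plus'.
    + apply (is_lim_seq_scal_l _ (/ Gamma (s + 1)) 1). apply bin_seq_lim. lra.
    + apply (bigO_neg_lim (s - 1 + - s)); [lra|]. apply bigO_mul; [|apply bigO_Rpower].
      generalize 7%nat. induction n as [|m IH]; simpl rsum.
      * apply (bigO_ext _ (fun n => 0 * Rpower (INR n) (s - 1)) _ 0); [intros; ring|].
        apply bigO_scal, bigO_Rpower.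
      * apply bigO_add; [exact IH|]. apply bigO_scal, bigO_bin_seq_le.
        change (s + 1 - INR (S m) - 1 <= s - 1). rewrite S_INR. pose proof (pos_INR m). lra.
Qed.

(** Repeated division of [pow_part_theta] by n turns the j-th expansion into a multiple of n^(-j)
    times the zeroth one, as differentiation does for n^s; the factors are the Taylor coefficients
    of (1-h)^s. The cut-off at each step costs n^(-1) O(n^(s-7)). *)
Lemma pow_part_powers (s : R) (j : nat) : (j <= 7)%nat ->
  pow_bigO (s - 8) (fun n => (-1) ^ j / INR (fact j) * pow_part s j n
      - bin_seq (- s) j * (/ INR n) ^ j * pow_part s 0 n).
Proof.
  induction j as [|j IH]; intros Hj.
  - apply (bigO_ext _ (fun n => 0 * Rpower (INR n) (s - 8)) _ 0); [|apply bigO_scal, bigO_Rpower].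
    intros. simpl. field.
  - destruct (pow_part_theta s j) as [kappa Hk]; [lia|].
    apply (bigO_ext _ (fun n => (INR j - s) / INR (S j) * (/ INR n * ((-1) ^ j / INR (fact j) * pow_part s j n
      - bin_seq (- s) j * (/ INR n) ^ j * pow_part s 0 n))
      + (-1) ^ S j / INR (fact (S j)) * kappa * (/ INR n * bin_seq (s - 6) n)) _ 1).
    + intros n Hn. assert (HnR : 0 < INR n) by (apply lt_0_INR; lia).
      specialize (Hk n).
      assert (E : pow_part s (S j) n = / INR n * ((s - INR j) * pow_part s j n + kappa * bin_seq (s - 6) n)).
      { rewrite <- Hk. field. lra. }
      rewrite E. change (bin_seq (- s) (S j)) with (bin_seq (- s) j * ((- s + INR j) / INR (S j))).
      rewrite fact_simpl, mult_INR. pose proof (INR_fact_neq_0 j). pose proof (not_0_INR (S j) ltac:(lia)).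
      simpl pow. field. repeat split; auto; lra.
    + apply bigO_add; apply bigO_scal.
      * apply (bigO_weaken (- 1 + (s - 8))); [lra|]. apply bigO_mul; [apply bigO_inv|apply IH; lia].
      * replace (s - 8) with (- 1 + (s - 6 - 1)) by ring. apply bigO_mul; [apply bigO_inv|apply bigO_bin_seq].
Qed.

(** The recurrence (n-1)^s = (1-1/n)^s n^s, up to O(n^(s-8)): [pow_part_diff] expresses the value at
    n - 1 by the eight expansions at n, and [pow_part_powers] turns these into the Taylor polynomial
    of (1-1/n)^s. *)
Lemma pow_part_step (s : R) :
  pow_bigO (s - 8) (fun n => match n with O => 0 | S k =>
     pow_part s 0 k - Rpower (1 - / INR n) s * pow_part s 0 n end).
Proof.
  destruct (binomial_taylor 8 s) as (K & HK & HT).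
  assert (Hrem : pow_bigO (- INR 8) (fun n => rsum (fun j => bin_seq (- s) j * (/ INR n) ^ j) 8 - Rpower (1 - / INR n) s)).
  { exists K, 2%nat. split; [exact HK|]. intros n Hn. rewrite Rpower_INR_opp_nat by lia.
    rewrite Rabs_minus_sym. apply HT. split; [apply Rlt_le, Rinv_0_lt_compat, lt_0_INR; lia|].
    apply Rinv_le_contravar; [lra|]. apply (le_INR 2). lia. }
  apply (bigO_ext _ (fun n =>
    rsum (fun j => (-1) ^ j / INR (fact j) * pow_part s j n
        - bin_seq (- s) j * (/ INR n) ^ j * pow_part s 0 n) 8
    - pow_coef 7 s * bin_seq (s - 7) n
    + (rsum (fun j => bin_seq (- s) j * (/ INR n) ^ j) 8 - Rpower (1 - / INR n) s) * pow_part s 0 n) _ 1).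
  - intros [|n] Hn; [lia|]. rewrite (pow_part_diff s n).
    set (h := / INR (S n)). rewrite rsum_sub.
    assert (E : rsum (fun k => bin_seq (- s) k * h ^ k * pow_part s 0 (S n)) 8 =
      pow_part s 0 (S n) * rsum (fun k => bin_seq (- s) k * h ^ k) 8).
    { rewrite <- rsum_scal. apply rsum_ext. intros; ring. }
    rewrite E. assert (E2 : rsum (fun k => (-1) ^ k / INR (fact k) * pow_part s k (S n)) 8 =
      pow_part s 0 (S n) - pow_part s 1 (S n) + pow_part s 2 (S n) / 2 - pow_part s 3 (S n) / 6
      + pow_part s 4 (S n) / 24 - pow_part s 5 (S n) / 120 + pow_part s 6 (S n) / 720
      - pow_part s 7 (S n) / 5040).
    { cbn [rsum]. rewrite !INR_IZR_INZ. simpl Z.of_nat. simpl pow. field. }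
    rewrite E2. ring.
  - apply bigO_add; [apply bigO_sub|].
    + assert (H : forall m, (m <= 8)%nat -> pow_bigO (s - 8) (fun n => rsum (fun j => (-1) ^ j / INR (fact j) * pow_part s j n
        - bin_seq (- s) j * (/ INR n) ^ j * pow_part s 0 n) m)); [|apply H; lia].
      induction m as [|m IH]; intros Hm; simpl rsum.
      * apply (bigO_ext _ (fun n => 0 * Rpower (INR n) (s - 8)) _ 0); [intros; ring|].
        apply bigO_scal, bigO_Rpower.
      * apply bigO_add; [apply IH; lia|]. apply pow_part_powers. lia.
    + apply bigO_scal, bigO_bin_seq_le. lra.
    + replace (s - 8) with (- INR 8 + s) by (simpl; ring). apply bigO_mul; [exact Hrem|apply bigO_pow_part].
Qed.

(** After division by n^s the steps of the quotient are O(n^(-8)), so it reaches its limit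
    1/Gamma(s+1) with error O(n^(-7)). Multiplied by n^s, this tends to zero because s < 7. *)
Lemma pow_expansion (s : R) : -1 < s < 7 ->
  is_lim_seq (fun n => Gamma (s + 1) * pow_part s 0 n - Rpower (INR n) s) 0.
Proof.
  intros Hs. pose proof (Gamma_pos (s + 1) ltac:(lra)) as HG.
  pose proof (pow_part_lim s ltac:(lra)) as Hlim.
  set (r := fun n => pow_part s 0 n / Rpower (INR n) s) in *.
  destruct (pow_part_step s) as (K & N & HK & HN).
  (* Order 0 serves only to bound (1-h)^(-s) by L for h <= 1/2. *)
  destruct (binomial_taylor 0 (- s)) as (L & HL & HTL).
  assert (Hstep : forall n, (S N <= n)%nat -> Rabs (r n - r (S n)) <= (K * L) * (/ INR (S n)) ^ 8).
  { intros n Hn. specialize (HN (S n) ltac:(lia)). cbv beta iota in HN.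
    set (h := / INR (S n)) in *.
    assert (Hh : 0 <= h <= / 2).
    { split; [apply Rlt_le, Rinv_0_lt_compat, lt_0_INR; lia|].
      apply Rinv_le_contravar; [lra|]. apply (le_INR 2). lia. }
    specialize (HTL h Hh). simpl in HTL. rewrite Rminus_0_r, Rmult_1_r, Rabs_pos_eq in HTL by apply Rlt_le, exp_pos.
    assert (P1 : 0 < Rpower (INR (S n)) s) by apply exp_pos.
    assert (P2 : 0 < Rpower (1 - h) s) by apply exp_pos.
    assert (E : r n - r (S n) = (pow_part s 0 n - Rpower (1 - h) s * pow_part s 0 (S n))
        * (/ Rpower (INR (S n)) s * Rpower (1 - h) (- s))).
    { unfold r. rewrite (Rpower_INR_pred s n) by lia. fold h. rewrite Rpower_Ropp. field. lra. }
    rewrite E, Rabs_mult.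
    replace (s - 8) with (s + - INR 8) in HN by (simpl; ring).
    rewrite Rpower_plus, Rpower_INR_opp_nat in HN by lia. fold h in HN.
    rewrite (Rabs_pos_eq (/ Rpower (INR (S n)) s * Rpower (1 - h) (- s))).
    2:{ apply Rlt_le, Rmult_lt_0_compat; [now apply Rinv_0_lt_compat|apply exp_pos]. }
    apply Rle_trans with (K * (Rpower (INR (S n)) s * h ^ 8) * (/ Rpower (INR (S n)) s * L)).
    - apply Rmult_le_compat; [apply Rabs_pos| |exact HN|].
      + apply Rlt_le, Rmult_lt_0_compat; [now apply Rinv_0_lt_compat|apply exp_pos].
      + apply Rmult_le_compat_l; [apply Rlt_le; now apply Rinv_0_lt_compat|exact HTL].
    - right. field. lra. }
  assert (HKL : 0 <= K * L) by now apply Rmult_le_pos.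
  pose proof (lim_of_summable_steps r _ _ (S N) 7 HKL ltac:(lia) ltac:(lia) Hlim Hstep) as Hfin.
  apply (bigO_neg_lim (s - 7)); [lra|].
  exists (Gamma (s + 1) * (K * L)), (S N). split; [apply Rmult_le_pos; lra|]. intros n Hn.
  specialize (Hfin n Hn).
  assert (P : 0 < Rpower (INR n) s) by apply exp_pos.
  replace (Gamma (s + 1) * pow_part s 0 n - Rpower (INR n) s) with
    (Gamma (s + 1) * Rpower (INR n) s * (r n - / Gamma (s + 1))) by (unfold r; field; lra).
  rewrite Rabs_mult, (Rabs_pos_eq (_ * _)) by (apply Rmult_le_pos; lra).
  replace (s - 7) with (s + - INR 7) by (simpl; ring).
  rewrite Rpower_plus, Rpower_INR_opp_nat by lia.
  apply Rle_trans with (Gamma (s + 1) * Rpower (INR n) s * (K * L * (/ INR n) ^ 7)).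
  - apply Rmult_le_compat_l; [apply Rmult_le_pos; lra|exact Hfin].
  - right. ring.
Qed.

(** * Convolution quadrature *)

Lemma RtoC_neq_0 (x : R) : x <> 0 -> RtoC x <> RtoC 0.
Proof. intros H E. apply H. now apply RtoC_inj. Qed.

Definition fR (u : nat -> R) : fps := fun n => RtoC (u n).
Definition cbin (b : R) : fps := fR (bin_seq b).

Lemma cbin_theta (b : R) : (fX * ftheta (cbin b))%fps = (fK (RtoC b) * (fz * cbin b))%fps.
Proof.
  apply functional_extensionality; intros [|n].
  - rewrite fX_mul_O, fmul_K_l, fmul_O. unfold ftheta; simpl. ring.
  - rewrite fX_mul_S, fmul_K_l, fz_mul_S. unfold ftheta, cbin, fR.
    rewrite <- !RtoC_mult, <- RtoC_minus, bin_seq_S. f_equal. ring.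
Qed.

(** The equation X (z d/dz u) = c z u is a first-order recurrence on coefficients. Identities
    between binomial series are checked on it instead of on convolutions. *)
Lemma theta_ode_unique (c : R) (u v : fps) : u O = v O ->
  (fX * ftheta u)%fps = (fK (RtoC c) * (fz * u))%fps ->
  (fX * ftheta v)%fps = (fK (RtoC c) * (fz * v))%fps -> u = v.
Proof.
  intros H0 Hu Hv. fps_ext n. induction n as [|n IH]; [exact H0|].
  assert (HS : forall w : fps, (fX * ftheta w)%fps = (fK (RtoC c) * (fz * w))%fps ->
     (RtoC (INR (S n)) * w (S n) = RtoC (INR n) * w n + RtoC c * w n)%C).
  { intros w Hw. apply (f_equal (fun f : fps => f (S n))) in Hw.
    rewrite fX_mul_S, fmul_K_l, fz_mul_S in Hw. unfold ftheta in Hw. rewrite <- Hw. ring. }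
  assert (Hn : RtoC (INR (S n)) <> RtoC 0) by (apply RtoC_neq_0, not_0_INR; lia).
  pose proof (HS u Hu) as E1. pose proof (HS v Hv) as E2. rewrite IH, <- E2 in E1.
  apply (f_equal (fun x => / RtoC (INR (S n)) * x)%C) in E1.
  rewrite !Cmult_assoc, Cinv_l, !Cmult_1_l in E1 by exact Hn. exact E1.
Qed.

Lemma cbin_mul (a b : R) : (cbin a * cbin b)%fps = cbin (a + b).
Proof.
  apply (theta_ode_unique (a + b)).
  - rewrite fmul_O. unfold cbin, fR; simpl. ring.
  - rewrite ftheta_mul, RtoC_plus, fK_add.
    transitivity ((fX * ftheta (cbin a)) * cbin b + cbin a * (fX * ftheta (cbin b)))%fps; [ring|].
    rewrite !cbin_theta. ring.
  - apply cbin_theta.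
Qed.

Lemma cbin_0 : cbin 0 = 1%fps.
Proof.
  apply functional_extensionality; intros [|n]; [reflexivity|]. unfold cbin, fR.
  induction n as [|n IH].
  - change (bin_seq 0 1) with (1 * ((0 + INR 0) / INR 1)). simpl. unfold Rdiv. f_equal. ring.
  - change (bin_seq 0 (S (S n))) with (bin_seq 0 (S n) * ((0 + INR (S n)) / INR (S (S n)))).
    rewrite RtoC_mult, IH. simpl. ring.
Qed.

Lemma cbin_X (k : nat) : cbin (- INR k) = (fX ^ k)%fps.
Proof.
  induction k as [|k IH].
  - simpl. rewrite Ropp_0. apply cbin_0.
  - rewrite S_INR. replace (- (INR k + 1)) with (- (1) + - INR k) by ring.
    rewrite <- cbin_mul, IH. simpl fpow. f_equal. apply (theta_ode_unique (- (1))).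
    + unfold cbin, fR, fX, fsub; simpl. ring.
    + apply cbin_theta.
    + rewrite ftheta_X, RtoC_opp, fK_opp. ring.
Qed.

Lemma cbin_X_mul (b : R) (k : nat) : (cbin b * fX ^ k)%fps = cbin (b - INR k).
Proof. rewrite <- cbin_X. apply cbin_mul. Qed.

Lemma null_of_lim (u : nat -> R) : is_lim_seq u 0 -> null_seq (fR u).
Proof.
  intros H eps He. apply is_lim_seq_Reals in H. destruct (H eps He) as [N HN].
  exists N. intros n Hn. unfold fR. rewrite Cmod_R. specialize (HN n Hn).
  unfold R_dist in HN. rewrite Rminus_0_r in HN. lra.
Qed.

Lemma cbin_null (b : R) : b < 1 -> null_seq (cbin b).
Proof. intros Hb. apply null_of_lim, (bigO_neg_lim (b - 1)); [lra|apply bigO_bin_seq]. Qed.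

(* Beyond some index the terms have constant sign, and the partial sums are the
   coefficients of (1 - z)^(g-1). *)
Lemma cbin_l1 (g : R) : 0 < g -> l1 (cbin (- g)).
Proof.
  intros Hg. destruct (nfloor_ex g) as [N0 HN0]; [lra|]. set (N := S N0).
  assert (HN : g < INR N) by (unfold N; rewrite S_INR; lra).
  assert (Hpart : forall n, rsum (bin_seq (- g)) (S n) = bin_seq (- g + 1) n).
  { induction n as [|n IH]; [simpl; ring|].
    change (rsum (bin_seq (- g)) (S (S n))) with (rsum (bin_seq (- g)) (S n) + bin_seq (- g) (S n)).
    rewrite IH. pose proof (bin_seq_diff (- g + 1) n) as H.
    replace (- g + 1 - 1) with (- g) in H by ring. lra. }
  destruct (null_bounded _ (cbin_null (- g + 1) ltac:(lra))) as [B HB].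
  assert (HB' : forall n, Rabs (rsum (bin_seq (- g)) (S n)) <= B).
  { intros n. rewrite Hpart, <- Cmod_R. apply HB. }
  assert (Hsign : exists e, Rabs e = 1 /\ forall k, Rabs (bin_seq (- g) (N + k)) = e * bin_seq (- g) (N + k)).
  { assert (Hstep : forall e, 0 <= e * bin_seq (- g) N -> forall k, 0 <= e * bin_seq (- g) (N + k)).
    { intros e He. induction k as [|k IH]; [now rewrite Nat.add_0_r|].
      rewrite Nat.add_succ_r.
      change (bin_seq (- g) (S (N + k))) with (bin_seq (- g) (N + k) * ((- g + INR (N + k)) / INR (S (N + k)))).
      rewrite <- Rmult_assoc. apply Rmult_le_pos; [exact IH|].
      apply Rmult_le_pos; [rewrite plus_INR; pose proof (pos_INR k); lra|].
      apply Rlt_le, Rinv_0_lt_compat, lt_0_INR. lia. }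
    destruct (Rle_dec 0 (bin_seq (- g) N)) as [H|H].
    - exists 1. split; [apply Rabs_R1|]. intros k. specialize (Hstep 1 ltac:(lra) k).
      rewrite Rabs_pos_eq; lra.
    - exists (-1). split; [rewrite Rabs_left; lra|]. intros k. specialize (Hstep (-1) ltac:(lra) k).
      rewrite Rabs_left1; lra. }
  destruct Hsign as [e [He Hek]].
  exists (rsum (fun k => Cmod (cbin (- g) k)) N + 2 * B). intros n.
  apply Rle_trans with (rsum (fun k => Cmod (cbin (- g) k)) (N + S n)).
  { apply rsum_mono; [intros; apply Cmod_ge_0|lia]. }
  rewrite rsum_app. apply Rplus_le_compat_l.
  rewrite (rsum_ext _ (fun k => e * bin_seq (- g) (N + k))).
  2:{ intros k _. unfold cbin, fR. rewrite Cmod_R. apply Hek. }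
  rewrite rsum_scal.
  assert (E : rsum (fun k => bin_seq (- g) (N + k)) (S n) =
     rsum (bin_seq (- g)) (S (N + n)) - rsum (bin_seq (- g)) (S N0)).
  { replace (S (N + n)) with (N + S n)%nat by lia. rewrite rsum_app. fold N. ring. }
  eapply Rle_trans; [apply Rle_abs|]. rewrite Rabs_mult, He, E, Rmult_1_l.
  pose proof (HB' (N + n)%nat). pose proof (HB' N0).
  unfold Rminus. eapply Rle_trans; [apply Rabs_triang|]. rewrite Rabs_Ropp. lra.
Qed.

(** ** Polynomials in X = 1 - z *)

(** Horner form of the sum of a_k X^k over k < d; the coefficients belong to powers of X, not of
    z. *)
Fixpoint pol (a : nat -> C) (d : nat) : fps :=
  match d with O => fK (RtoC 0) | S k => (fK (a O) + fX * pol (fshift a) k)%fps end.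

Lemma pol_l1 (a : nat -> C) (d : nat) : l1 (pol a d).
Proof.
  revert a. induction d as [|d IH]; intros a; simpl; [apply l1_K|].
  apply l1_add; [apply l1_K|]. apply l1_mul; [apply l1_X|apply IH].
Qed.

Lemma pol_ext (a b : nat -> C) (d : nat) :
  (forall k, (k < d)%nat -> a k = b k) -> pol a d = pol b d.
Proof.
  revert a b. induction d as [|d IH]; intros a b H; simpl; [reflexivity|].
  rewrite (H O) by lia. rewrite (IH (fshift a) (fshift b)); [reflexivity|].
  intros k Hk. apply H. lia.
Qed.

Lemma pol_add (a b : fps) (d : nat) : pol (a + b)%fps d = (pol a d + pol b d)%fps.
Proof.
  revert a b. induction d as [|d IH]; intros a b; simpl.
  - ring.
  - change (fshift (a + b)%fps) with (fshift a + fshift b)%fps. rewrite IH.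
    unfold fadd at 2. rewrite fK_add. ring.
Qed.

Lemma pol_scal (c : C) (a : fps) (d : nat) : pol (fun i => c * a i)%C d = (fK c * pol a d)%fps.
Proof.
  revert a. induction d as [|d IH]; intros a; simpl.
  - ring.
  - change (fshift (fun i => c * a i)%C) with (fun i => c * fshift a i)%C.
    rewrite IH, fK_mul. ring.
Qed.

Lemma pol_last (a : nat -> C) (d : nat) : pol a (S d) = (pol a d + fK (a d) * fX ^ d)%fps.
Proof.
  revert a. induction d as [|d IH]; intros a.
  - simpl. ring.
  - change (pol a (S (S d))) with (fK (a O) + fX * pol (fshift a) (S d))%fps.
    rewrite IH. simpl. unfold fshift at 2. ring.
Qed.

Lemma pol_truncate (a : nat -> C) (p d : nat) : (p <= d)%nat ->
  exists Q, l1 Q /\ pol a d = (pol a p + fX ^ p * Q)%fps.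
Proof.
  intros H. exists (pol (fun k => a (p + k)%nat) (d - p)). split; [apply pol_l1|].
  revert a d H. induction p as [|p IH]; intros a d H.
  - rewrite Nat.sub_0_r. change (fun k => a (0 + k)%nat) with a. simpl. ring.
  - destruct d as [|d]; [lia|]. simpl. rewrite (IH (fshift a) d) by lia.
    change (fun k => fshift a (p + k)%nat) with (fun k => a (S (p + k))). ring.
Qed.

Lemma fshift_mul (a b : fps) :
  fshift (a * b)%fps = ((fun i => a O * fshift b i)%C + fshift a * b)%fps.
Proof. fps_ext n. apply fmul_S_l. Qed.

(** The quadrature compares series modulo X^p; the excess is kept as a summable cofactor of X^p,
    whose shape does not matter. *)
Lemma pol_mul (a b : fps) (p d : nat) : (p <= d)%nat ->
  exists Q, l1 Q /\ (pol a p * pol b d)%fps = (pol (a * b)%fps p + fX ^ p * Q)%fps.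
Proof.
  revert a b d. induction p as [|p IH]; intros a b d H.
  - exists 0%fps. split; [apply l1_K|]. simpl. ring.
  - destruct d as [|d]; [lia|].
    destruct (IH (fshift a) b (S d) ltac:(lia)) as [Q1 [HQ1 E1]].
    destruct (pol_truncate (fshift b) p d ltac:(lia)) as [Q2 [HQ2 E2]].
    exists (Q1 + fK (a O) * Q2)%fps. split; [apply l1_add, l1_mul; auto using l1_K|].
    transitivity (fK (a O) * pol b (S d) + fX * (pol (fshift a) p * pol b (S d)))%fps; [simpl; ring|].
    rewrite E1.
    transitivity (fK (a O) * fK (b O) + fX * (fK (a O) * pol (fshift b) d)
       + fX * (pol (fshift a * b)%fps p + fX ^ p * Q1))%fps; [simpl; ring|].
    rewrite E2. simpl pol. rewrite fshift_mul, pol_add, pol_scal, fmul_O, fK_mul. simpl. ring.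
Qed.

Definition ng_pol (p : nat) (alpha : R) : fps := pol (fR (fun k => ng_coef k alpha)) p.

Lemma fmul_fR (a b : nat -> R) (n : nat) :
  fmul (fR a) (fR b) n = RtoC (rsum (fun j => a (n - j)%nat * b j) (S n)).
Proof.
  unfold fmul, fR. generalize (S n). intros m.
  induction m as [|m IH]; simpl; [reflexivity|]. rewrite IH, RtoC_plus, RtoC_mult. reflexivity.
Qed.

(** The law L^alpha L^(-s-1) = L^(-(s-alpha)-1) for L = -ln(1-X)/X, read off coefficientwise. The
    orders up to 5 cover all those below X^p, as p <= 6. *)
Lemma ng_coef_pow_coef (alpha s : R) (k : nat) : (k <= 5)%nat ->
  fmul (fR (fun k => ng_coef k alpha)) (fR (fun k => pow_coef k s)) k = RtoC (pow_coef k (s - alpha)).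
Proof.
  intros Hk.
  rewrite fmul_fR. f_equal.
  do 6 (destruct k as [|k]; [cbn [rsum Nat.sub pow_coef]; unfold ng_coef; field|]). lia.
Qed.

Lemma pow_part_pol (s : R) : fR (pow_part s 0) = (cbin (s + 1) * pol (fR (fun k => pow_coef k s)) 8)%fps.
Proof.
  assert (E : forall d, (cbin (s + 1) * pol (fR (fun k => pow_coef k s)) d)%fps =
    fR (fun n => rsum (fun k => pow_coef k s * bin_seq (s + 1 - INR k) n) d)).
  { induction d as [|d IH].
    - simpl pol. fps_ext n. rewrite fmul_comm, fmul_K_l.
      unfold fR; simpl. ring.
    - rewrite pol_last.
      transitivity (cbin (s + 1) * pol (fR (fun k => pow_coef k s)) d
          + fK (RtoC (pow_coef d s)) * (cbin (s + 1) * fX ^ d))%fps; [unfold fR; ring|].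
      rewrite IH, cbin_X_mul. fps_ext n.
      unfold fadd. rewrite fmul_K_l. unfold cbin, fR. simpl rsum. now rewrite RtoC_plus, RtoC_mult. }
  rewrite E. fps_ext n. unfold fR, pow_part. f_equal.
  apply rsum_ext. intros k _. simpl INR. now rewrite Rminus_0_r.
Qed.

(** * Quadrature error on powers of n *)

Definition order_structure (p : nat) (alpha : R) (om : fps) : Prop :=
  exists H, l1 H /\ om = (cbin (- alpha) * (ng_pol p alpha + fX ^ p * H))%fps.

Section Quadrature.
Variables (p : nat) (alpha : R) (om : fps).
Hypothesis Halpha : 0 < alpha <= 1.
Hypothesis Hp : (1 <= p <= 6)%nat.
Hypothesis Hom : order_structure p alpha om.

Lemma order_structure_l1 : l1 om.
Proof.
  destruct Hom as [H [HH ->]]. apply l1_mul; [apply cbin_l1; lra|].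
  apply l1_add; [apply pol_l1|apply l1_mul; [apply l1_pow, l1_X|exact HH]].
Qed.

Lemma null_pol_cbin (a : nat -> C) (d : nat) (b : R) : b < 1 -> null_seq (cbin b * pol a d)%fps.
Proof.
  intros Hb. rewrite fmul_comm. apply null_l1_mul; [apply pol_l1|now apply cbin_null].
Qed.

(** [cbin 1] is the constant sequence 1, so these are the partial sums of [om], the factor of U_0 in
    the scheme. Their generating function is X^(alpha-1) times a summable one, and X^(alpha-1) has
    null coefficients as alpha > 0. *)
Lemma order_structure_sums_null : null_seq (om * cbin 1)%fps.
Proof.
  destruct Hom as [H [HH ->]].
  replace (cbin (- alpha) * (ng_pol p alpha + fX ^ p * H) * cbin 1)%fps with
    ((cbin (- alpha) * cbin 1) * ng_pol p alpha + H * ((cbin (- alpha) * cbin 1) * fX ^ p))%fps by ring.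
  rewrite cbin_mul, cbin_X_mul. pose proof (pos_INR p).
  apply null_add; [apply null_pol_cbin; lra|]. apply null_l1_mul; [exact HH|apply cbin_null; lra].
Qed.

Lemma quadrature_error (sigma : R) : 0 < sigma < alpha + INR p ->
  null_seq (fun n =>
    (fmul om (fR (fun j => rpow (INR j) sigma)) n
     - RtoC (Gamma (sigma + 1) / Gamma (sigma + 1 - alpha) * rpow (INR n) (sigma - alpha)))%C).
Proof.
  intros Hs. pose proof order_structure_l1 as Hl1.
  assert (Hp6 : INR p <= 6) by (change 6 with (IZR (Z.of_nat 6)); rewrite <- INR_IZR_INZ; apply le_INR; lia).
  assert (Hp1 : 1 <= INR p) by (change 1 with (INR 1); apply le_INR; lia).
  set (Gs := Gamma (sigma + 1)). set (Ga := Gamma (sigma + 1 - alpha)).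
  assert (HGa : 0 < Ga) by (apply Gamma_pos; lra).
  assert (Hpow : forall n s, (1 <= n)%nat -> rpow (INR n) s = Rpower (INR n) s).
  { intros n s Hn. unfold rpow. destruct (Rle_dec (INR n) 0) as [H|H]; [|reflexivity].
    pose proof (lt_0_INR n ltac:(lia)). lra. }
  set (nu := fR (fun n => Gs * pow_part sigma 0 n - rpow (INR n) sigma)).
  assert (Hnu : null_seq nu).
  { apply null_of_lim. apply (is_lim_seq_ext_loc (fun n => Gs * pow_part sigma 0 n - Rpower (INR n) sigma)).
    - exists 1%nat. intros n Hn. now rewrite Hpow.
    - apply pow_expansion. lra. }
  set (nu' := fR (fun n => Ga * pow_part (sigma - alpha) 0 n - rpow (INR n) (sigma - alpha))).
  assert (Hnu' : null_seq nu').
  { apply null_of_lim. apply (is_lim_seq_ext_loc (fun n => Ga * pow_part (sigma - alpha) 0 n - Rpower (INR n) (sigma - alpha))).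
    - exists 1%nat. intros n Hn. now rewrite Hpow.
    - unfold Ga. replace (sigma + 1 - alpha) with (sigma - alpha + 1) by ring. apply pow_expansion. lra. }
  assert (Eu : fR (fun j => rpow (INR j) sigma) = (fK (RtoC Gs) * fR (pow_part sigma 0) - nu)%fps).
  { fps_ext n. unfold fsub. rewrite fmul_K_l. unfold nu, fR.
    rewrite <- RtoC_mult, <- RtoC_minus. f_equal. ring. }
  assert (Ev : fR (fun n => Gs / Ga * rpow (INR n) (sigma - alpha)) =
     (fK (RtoC Gs) * fR (pow_part (sigma - alpha) 0) - fK (RtoC (Gs / Ga)%R) * nu')%fps).
  { fps_ext n. unfold fsub. rewrite !fmul_K_l. unfold nu', fR.
    rewrite <- !RtoC_mult, <- RtoC_minus. f_equal. field. lra. }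
  change (null_seq (fsub (fmul om (fR (fun j => rpow (INR j) sigma)))
    (fR (fun n => Gs / Ga * rpow (INR n) (sigma - alpha))))).
  rewrite Eu, Ev, !pow_part_pol.
  destruct Hom as [H [HH E]].
  set (cs := fR (fun k => pow_coef k sigma)). set (ca := fR (fun k => pow_coef k (sigma - alpha))).
  (* Below X^p the product of the two polynomials has the coefficients [ca] of the target; the
     mismatch sits in the cofactors [Q1] and [Q2] of X^p. *)
  destruct (pol_mul (fR (fun k => ng_coef k alpha)) cs p 8 ltac:(lia)) as [Q1 [HQ1 E1]].
  destruct (pol_truncate ca p 8 ltac:(lia)) as [Q2 [HQ2 E2]].
  fold (ng_pol p alpha) in E1.
  rewrite (pol_ext _ ca p) in E1 by (intros k Hk; apply ng_coef_pow_coef; lia).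
  replace (om * (fK (RtoC Gs) * (cbin (sigma + 1) * pol cs 8) - nu)
     - (fK (RtoC Gs) * (cbin (sigma - alpha + 1) * pol ca 8) - fK (RtoC (Gs / Ga)%R) * nu'))%fps with
    (fK (RtoC Gs) * ((Q1 - Q2 + H * pol cs 8) * cbin (sigma - alpha + 1 - INR p))
     + ((- om) * nu + fK (RtoC (Gs / Ga)%R) * nu'))%fps.
  - apply null_add; [|apply null_add].
    (* The factor X^p turns X^(alpha-sigma-1) into X^(p+alpha-sigma-1), whose coefficients tend to
       zero since sigma < alpha + p. *)
    + apply null_l1_mul; [apply l1_K|]. apply null_l1_mul; [|apply cbin_null; lra].
      apply l1_add; [now apply l1_sub|apply l1_mul; [exact HH|apply pol_l1]].
    + apply null_l1_mul; [now apply l1_opp|exact Hnu].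
    + apply null_l1_mul; [apply l1_K|exact Hnu'].
  - rewrite <- cbin_X_mul.
    transitivity (fK (RtoC Gs) * ((om * cbin (sigma + 1)) * pol cs 8 - cbin (sigma - alpha + 1) * pol ca 8)
      - om * nu + fK (RtoC (Gs / Ga)%R) * nu')%fps; [|ring].
    assert (E3 : (om * cbin (sigma + 1))%fps =
      (cbin (sigma - alpha + 1) * (ng_pol p alpha + fX ^ p * H))%fps).
    { rewrite E. replace (sigma - alpha + 1) with (- alpha + (sigma + 1)) by ring.
      rewrite <- (cbin_mul (- alpha) (sigma + 1)). ring. }
    rewrite E3, E2.
    transitivity (fK (RtoC Gs) * (cbin (sigma - alpha + 1) * ((ng_pol p alpha * pol cs 8) + fX ^ p * H * pol cs 8)
       - cbin (sigma - alpha + 1) * (pol ca p + fX ^ p * Q2)) - om * nu + fK (RtoC (Gs / Ga)%R) * nu')%fps; [|ring].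
    rewrite E1. ring.
Qed.
End Quadrature.

(** * Generating functions on the real axis *)

(** Geometric decay, that is, analyticity beyond the unit circle. Unlike [l1], it is preserved by z
    d/dz and, for a series that vanishes at z = 1, by division by X. *)
Definition geo (a : nat -> C) : Prop :=
  exists K r, 0 <= K /\ 0 <= r < 1 /\ forall n, Cmod (a n) <= K * r ^ n.

Lemma geo_l1 (a : nat -> C) : geo a -> l1 a.
Proof.
  intros (K & r & HK & Hr & H). exists (K * / (1 - r)). intros n.
  apply Rle_trans with (rsum (fun k => K * r ^ k) n).
  - apply rsum_le. intros k _. apply H.
  - rewrite rsum_scal. apply Rmult_le_compat_l; [exact HK|]. now apply rsum_geom.
Qed.

Lemma geo_scale (a : fps) (B : R) (z : C) : (forall n, Cmod (a n) <= B) -> Cmod z < 1 -> geo (scale z a).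
Proof.
  intros HB Hz. exists B, (Cmod z). split.
  - eapply Rle_trans; [apply Cmod_ge_0|apply (HB O)].
  - split; [split; [apply Cmod_ge_0|exact Hz]|]. intros n. unfold scale. rewrite Cmod_mult, Cmod_pow.
    apply Rmult_le_compat_r; [apply pow_le, Cmod_ge_0|apply HB].
Qed.

Lemma geo_theta (a : fps) : geo a -> geo (ftheta a).
Proof.
  intros (K & r & HK & Hr & H).
  set (r' := (1 + r) / 2). assert (Hr' : r < r' < 1) by (unfold r'; lra).
  assert (Hq : 0 <= r / r' < 1).
  { split; [apply Rmult_le_pos; [lra|apply Rlt_le, Rinv_0_lt_compat; lra]|].
    apply (Rmult_lt_reg_r r'); [lra|]. unfold Rdiv. rewrite Rmult_assoc, Rinv_l; lra. }
  exists (K * / (1 - r / r')), r'. split; [|split; [lra|]].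
  - apply Rmult_le_pos; [exact HK|]. apply Rlt_le, Rinv_0_lt_compat. lra.
  - intros n. unfold ftheta. rewrite Cmod_mult, Cmod_R, Rabs_pos_eq by apply pos_INR.
    assert (E : r ^ n = (r / r') ^ n * r' ^ n) by (rewrite <- Rpow_mult_distr; f_equal; field; lra).
    assert (H1 : INR n * (r / r') ^ n <= / (1 - r / r')).
    { eapply Rle_trans; [|apply (rsum_geom _ n Hq)]. rewrite <- rsum_const. apply rsum_le.
      intros k Hk. replace n with (k + (n - k))%nat by lia. rewrite pow_add.
      rewrite <- (Rmult_1_r ((r / r') ^ k)) at 2. apply Rmult_le_compat_l; [apply pow_le; lra|].
      rewrite <- (pow1 (n - k)). apply pow_incr. lra. }
    specialize (H n). rewrite E in H. pose proof (pos_INR n). pose proof (pow_le r' n ltac:(lra)).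
    apply Rle_trans with (INR n * (K * ((r / r') ^ n * r' ^ n))); [now apply Rmult_le_compat_l|].
    replace (INR n * (K * ((r / r') ^ n * r' ^ n))) with (K * (INR n * (r / r') ^ n) * r' ^ n) by ring.
    apply Rmult_le_compat_r; [assumption|]. now apply Rmult_le_compat_l.
Qed.

Lemma Re_mul_real (c : C) (x : R) : Re (c * RtoC x) = Re c * x.
Proof. destruct c. unfold Re, RtoC, Cmult; simpl. ring. Qed.
Lemma Im_mul_real (c : C) (x : R) : Im (c * RtoC x) = Im c * x.
Proof. destruct c. unfold Im, RtoC, Cmult; simpl. ring. Qed.

Lemma tsum_scale_real (a : fps) (x : R) :
  tsum (scale (RtoC x) a) = (PSeries (fun n => Re (a n)) x, PSeries (fun n => Im (a n)) x).
Proof.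
  unfold tsum, PSeries. f_equal; apply Series_ext; intros n; unfold scale;
    rewrite <- RtoC_pow; [apply Re_mul_real|apply Im_mul_real].
Qed.

Lemma tsum_scale_theta_real (a : fps) (x : R) :
  tsum (scale (RtoC x) (ftheta a)) =
  (x * PSeries (PS_derive (fun n => Re (a n))) x, x * PSeries (PS_derive (fun n => Im (a n))) x).
Proof.
  rewrite tsum_scale_real, <- !PSeries_incr_1. f_equal; apply PSeries_ext; intros [|n];
    unfold ftheta; rewrite Cmult_comm, ?Re_mul_real, ?Im_mul_real; unfold PS_incr_1, PS_derive.
  - simpl. apply Rmult_0_r. - apply Rmult_comm. - simpl. apply Rmult_0_r. - apply Rmult_comm.
Qed.

Lemma CV_radius_ge (s : nat -> R) (B r : R) : (forall n, Rabs (s n * r ^ n) <= B) -> Rbar_le r (CV_radius s).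
Proof. intros H. apply (proj1 (CV_radius_bounded s)). now exists B. Qed.

Lemma CV_radius_bounded_coef (s : nat -> R) (B x : R) : (forall n, Rabs (s n) <= B) ->
  Rabs x < 1 -> Rbar_lt (Rabs x) (CV_radius s).
Proof.
  intros H Hx. eapply Rbar_lt_le_trans; [|apply (CV_radius_ge s B 1)]; [exact Hx|].
  intros n. rewrite pow1, Rmult_1_r. apply H.
Qed.

(** Coefficients are determined by the values on a real segment, so complex branches have to be
    identified only there. The bounds at r supply a positive radius of convergence. *)
Lemma fps_eq_of_real (a b : fps) (K r : R) : 0 < r ->
  (forall n, Cmod (a n * RtoC r ^ n) <= K) -> (forall n, Cmod (b n * RtoC r ^ n) <= K) ->
  (forall x, -1 < x < 1 -> tsum (scale (RtoC x) a) = tsum (scale (RtoC x) b)) -> a = b.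
Proof.
  intros Hr Ha Hb H.
  assert (Hcv : forall c : fps, (forall n, Cmod (c n * RtoC r ^ n) <= K) ->
     Rbar_lt 0 (CV_radius (fun n => Re (c n))) /\ Rbar_lt 0 (CV_radius (fun n => Im (c n)))).
  { intros c Hc. split; (eapply Rbar_lt_le_trans; [|apply (CV_radius_ge _ K r)]; [exact Hr|]);
      intros n; specialize (Hc n); rewrite <- RtoC_pow in Hc.
    - rewrite <- Re_mul_real. eapply Rle_trans; [apply re_le_Cmod|exact Hc].
    - rewrite <- Im_mul_real. eapply Rle_trans; [apply im_le_Cmod|exact Hc]. }
  destruct (Hcv a Ha) as [Ha1 Ha2]. destruct (Hcv b Hb) as [Hb1 Hb2].
  assert (Hloc : locally 0 (fun x : R_UniformSpace => -1 < x < 1)).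
  { exists (mkposreal 1 Rlt_0_1). intros y Hy. unfold_ball_in Hy. apply Rabs_def2 in Hy. lra. }
  fps_ext n. apply injective_projections.
  - apply (PSeries_ext_recip (fun n => Re (a n)) (fun n => Re (b n)) n Ha1 Hb1).
    eapply filter_imp; [|exact Hloc]. intros x Hx. specialize (H x Hx). rewrite !tsum_scale_real in H.
    now injection H.
  - apply (PSeries_ext_recip (fun n => Im (a n)) (fun n => Im (b n)) n Ha2 Hb2).
    eapply filter_imp; [|exact Hloc]. intros x Hx. specialize (H x Hx). rewrite !tsum_scale_real in H.
    now injection H.
Qed.

(** By the equation, the product of the series and qf^(-al) has derivative zero, so it keeps its
    value at 0. *)
Lemma real_power_ode (s : nat -> R) (B al : R) (qf dq : R -> R) :
  (forall n, Rabs (s n) <= B) ->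
  (forall x, -1 < x < 1 -> 0 < qf x /\ is_derive qf x (dq x)) ->
  (forall x, -1 < x < 1 -> qf x * (x * PSeries (PS_derive s) x) = al * (x * dq x) * PSeries s x) ->
  forall x, -1 < x < 1 -> PSeries s x = s O * Rpower (qf x / qf 0) al.
Proof.
  intros HB Hq Hode x Hx.
  set (D := fun y => PSeries s y * exp (- al * ln (qf y))).
  assert (HD : forall y, -1 < y < 1 -> is_derive D y (PSeries (PS_derive s) y * exp (- al * ln (qf y))
     + PSeries s y * (- al * (dq y / qf y) * exp (- al * ln (qf y))))).
  { intros y Hy. destruct (Hq y Hy) as [Hp Hdq]. unfold D.
    apply (is_derive_mult (K := R_AbsRing) (PSeries s) (fun y => exp (- al * ln (qf y)))).
    - apply is_derive_PSeries, (CV_radius_bounded_coef s B); [exact HB|]. apply Rabs_def1; lra.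
    - apply (is_derive_comp (V := R_NormedModule) exp (fun y => - al * ln (qf y))).
      + apply is_derive_exp.
      + apply (is_derive_scal (fun y => ln (qf y)) y (- al) (dq y / qf y)).
        apply (is_derive_comp (V := R_NormedModule) ln qf); [now apply is_derive_ln|exact Hdq].
    - intros; apply Rmult_comm. }
  assert (Hmul : D x = D 0).
  { destruct (MVT_gen D 0 x (fun _ => 0)) as [c [_ E]].
    - intros y Hy.
      assert (Hy1 : -1 < y < 1).
      { split.
        - unfold Rmin, Rmax in Hy. destruct (Rle_dec 0 x); lra.
        - unfold Rmin, Rmax in Hy. destruct (Rle_dec 0 x); lra. }
      (* The equation carries a factor y from z d/dz. The mean value theorem needs the derivative
         only strictly between 0 and x, where y can be cancelled. *)
      assert (Hy0 : y <> 0) by (unfold Rmin, Rmax in Hy; destruct (Rle_dec 0 x); lra).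
      specialize (HD y Hy1). destruct (Hq y Hy1) as [Hp _]. specialize (Hode y Hy1).
      match type of HD with is_derive _ _ ?d => replace 0 with d; [exact HD|] end.
      apply (Rmult_eq_reg_l (qf y * y)); [|apply Rmult_integral_contrapositive_currified; lra].
      rewrite Rmult_0_r.
      transitivity (exp (- al * ln (qf y)) * (qf y * (y * PSeries (PS_derive s) y) - al * (y * dq y) * PSeries s y));
        [field; lra|]. rewrite Hode. ring.
    - intros y Hy. apply continuity_pt_filterlim, (ex_derive_continuous (V := R_NormedModule) D).
      eexists. apply HD. unfold Rmin, Rmax in Hy. destruct (Rle_dec 0 x); lra.
    - lra. }
  unfold D in Hmul. rewrite PSeries_0 in Hmul.
  destruct (Hq x Hx) as [Hpx _]. destruct (Hq 0 ltac:(lra)) as [Hp0 _].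
  apply (Rmult_eq_reg_r (exp (- al * ln (qf x)))); [|apply Rgt_not_eq, exp_pos].
  rewrite Hmul. unfold Rpower. rewrite Rmult_assoc, <- exp_plus. f_equal. f_equal.
  unfold Rdiv. rewrite ln_mult, ln_Rinv by (try apply Rinv_0_lt_compat; assumption). ring.
Qed.

(** As [q] is real, the complex equation splits into the same real equation for the real and the
    imaginary part of [a]. *)
Lemma power_series_value (a : fps) (q : nat -> R) (al B : R) :
  (forall n, Cmod (a n) <= B) -> (forall n, Rabs (q n) <= B) ->
  (fR q * ftheta a)%fps = (fK (RtoC al) * (ftheta (fR q) * a))%fps ->
  (forall x, -1 < x < 1 -> 0 < PSeries q x) ->
  forall x, -1 < x < 1 ->
    tsum (scale (RtoC x) a) = (a O * RtoC (Rpower (PSeries q x / PSeries q 0) al))%C.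
Proof.
  intros Ha Hq Hode Hpos.
  assert (Hqc : forall n, Cmod (fR q n) <= B) by (intros; unfold fR; rewrite Cmod_R; apply Hq).
  assert (Hqr : (fun n => Re (fR q n)) = q) by reflexivity.
  assert (Hqi : (fun n => Im (fR q n)) = fun _ => 0) by reflexivity.
  assert (Hz0 : forall x, PSeries (fun _ => 0) x = 0).
  { intros x. unfold PSeries. rewrite (Series_scal_l 0 (fun n => x ^ n)). ring. }
  assert (Hmain : forall x, -1 < x < 1 ->
     (RtoC (PSeries q x) * tsum (scale (RtoC x) (ftheta a)) =
      RtoC (al * (x * PSeries (PS_derive q) x)) * tsum (scale (RtoC x) a))%C).
  { intros x Hx. assert (Hx1 : Cmod (RtoC x) < 1) by (rewrite Cmod_R; apply Rabs_def1; lra).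
    apply (f_equal (fun f => tsum (scale (RtoC x) f))) in Hode.
    rewrite !scale_mul, scale_K in Hode.
    assert (G1 := geo_scale a B (RtoC x) Ha Hx1). assert (G2 := geo_scale (fR q) B (RtoC x) Hqc Hx1).
    assert (G3 : l1 (scale (RtoC x) (ftheta a))) by (rewrite scale_theta; apply geo_l1, geo_theta, G1).
    assert (G4 : l1 (scale (RtoC x) (ftheta (fR q)))) by (rewrite scale_theta; apply geo_l1, geo_theta, G2).
    apply geo_l1 in G1. apply geo_l1 in G2.
    rewrite !tsum_mul in Hode by auto using l1_mul, l1_K.
    rewrite tsum_scale_real, Hqr, Hqi, Hz0 in Hode.
    rewrite (tsum_scale_theta_real (fR q)), Hqr, Hqi in Hode.
    change (PSeries q x, 0) with (RtoC (PSeries q x)) in Hode.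
    replace (PSeries (PS_derive (fun _ => 0)) x) with 0 in Hode.
    2:{ rewrite <- (Hz0 x) at 1. apply PSeries_ext. intros n. unfold PS_derive. ring. }
    rewrite Rmult_0_r in Hode. change (?u, 0) with (RtoC u) in Hode.
    replace (tsum (fK (RtoC al))) with (RtoC al) in Hode.
    2:{ rewrite <- (scale_1 (fK (RtoC al))). symmetry. apply (ev_K (RtoC al) (RtoC 1)). }
    rewrite Hode, !RtoC_mult. ring. }
  assert (Hder : forall x, -1 < x < 1 -> 0 < PSeries q x /\ is_derive (PSeries q) x (PSeries (PS_derive q) x)).
  { intros x Hx. split; [now apply Hpos|].
    apply is_derive_PSeries, (CV_radius_bounded_coef q B); [exact Hq|]. apply Rabs_def1; lra. }
  intros x Hx. rewrite tsum_scale_real.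
  rewrite (real_power_ode (fun n => Re (a n)) B al (PSeries q) (PSeries (PS_derive q))); auto.
  - rewrite (real_power_ode (fun n => Im (a n)) B al (PSeries q) (PSeries (PS_derive q))); auto.
    + apply injective_projections; simpl; [symmetry; apply Re_mul_real|symmetry; apply Im_mul_real].
    + intros n. eapply Rle_trans; [apply im_le_Cmod|apply Ha].
    + intros y Hy. specialize (Hmain y Hy). rewrite tsum_scale_theta_real, tsum_scale_real in Hmain.
      apply (f_equal Im) in Hmain. unfold Im, RtoC, Cmult in Hmain; simpl in Hmain. unfold Im. lra.
  - intros n. eapply Rle_trans; [apply re_le_Cmod|apply Ha].
  - intros y Hy. specialize (Hmain y Hy). rewrite tsum_scale_theta_real, tsum_scale_real in Hmain.
    apply (f_equal Re) in Hmain. unfold Re, RtoC, Cmult in Hmain; simpl in Hmain. unfold Re. lra.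
Qed.

(* On (-1, 1) the values of cos (Im L) are 1, so Im L is constant there and
   contributes only a constant factor, which is 1 by positivity at 0. *)
Lemma power_branch_real (b f : C -> C) (alpha : R) (br : R -> R) :
  is_power_branch b alpha f ->
  (forall x, -1 < x < 1 -> b (RtoC x) = RtoC (br x) /\ 0 < br x) ->
  forall x, -1 < x < 1 -> f (RtoC x) = RtoC (Rpower (br x) alpha).
Proof.
  intros [[L HL] [[Hp0 Hi0] _]] Hb.
  assert (Hmod : forall x, -1 < x < 1 -> Cmod (RtoC x) < 1) by (intros; rewrite Cmod_R; apply Rabs_def1; lra).
  assert (Hexp : forall x, -1 < x < 1 ->
     Re (L (RtoC x)) = ln (br x) /\ cos (Im (L (RtoC x))) = 1 /\ sin (Im (L (RtoC x))) = 0).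
  { intros x Hx. destruct (HL _ (Hmod x Hx)) as [_ [E _]]. destruct (Hb x Hx) as [E' Hpos].
    rewrite E' in E. unfold Cexp in E. injection E as E1 E2.
    set (u := Re (L (RtoC x))) in *. set (v := Im (L (RtoC x))) in *. pose proof (exp_pos u) as Hu.
    assert (Hs : sin v = 0) by (apply (Rmult_eq_reg_l (exp u)); lra).
    assert (Hc : cos v = 1).
    { pose proof (sin2_cos2 v) as H. rewrite Hs in H. unfold Rsqr in H.
      assert (0 < cos v) by nra. nra. }
    rewrite Hc, Rmult_1_r in E1. rewrite <- E1, ln_exp. auto. }
  set (psi := fun x => Im (L (RtoC x)) - Im (L (RtoC 0))).
  assert (Hcont : forall x, -1 < x < 1 -> continuity_pt psi x).
  { intros x Hx. apply continuity_pt_filterlim.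
    apply (continuous_minus (V := R_NormedModule) (fun x => Im (L (RtoC x))) (fun _ => Im (L (RtoC 0))));
      [|apply continuous_const].
    destruct (HL _ (Hmod x Hx)) as [HLd _]. apply ex_derive_continuous in HLd.
    apply (continuous_comp (V := C_UniformSpace) (fun x => L (RtoC x)) (fun z : C => Im z)).
    - apply (continuous_comp (U := R_UniformSpace) (V := AbsRing_UniformSpace C_AbsRing) (W := C_UniformSpace) RtoC L); [|exact HLd].
      intros P [eps HP]. exists eps. intros y Hy. apply HP.
      unfold_ball.
      change (Cmod (RtoC y - RtoC x) < eps). rewrite <- RtoC_minus, Cmod_R. exact Hy.
    - exact (continuous_snd (U := R_UniformSpace) (V := R_UniformSpace) (Re (L (RtoC x))) (Im (L (RtoC x)))). }
  assert (Hcos : forall x, -1 < x < 1 -> cos (psi x) = 1).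
  { intros x Hx. unfold psi. rewrite cos_minus.
    destruct (Hexp x Hx) as [_ [-> ->]]. destruct (Hexp 0 ltac:(lra)) as [_ [-> ->]]. ring. }
  assert (Hpsi : forall x, -1 < x < 1 -> psi x = 0).
  { intros x Hx. apply NNPP. intros Hne.
    assert (He : exists e, Rabs e = 1 /\ 0 < e * psi x).
    { destruct (Rtotal_order (psi x) 0) as [H|[H|H]]; [|contradiction|].
      - exists (-1). split; [rewrite Rabs_left; lra|lra].
      - exists 1. split; [apply Rabs_R1|lra]. }
    (* If psi x were nonzero, e psi would take the value v in (0, 1/2] between 0 and x, but cos v <
       1 there. *)
    destruct He as [e [He Hpe]]. set (v := Rmin (e * psi x) 1 / 2).
    assert (Hm : 0 < Rmin (e * psi x) 1) by (apply Rmin_pos; lra).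
    pose proof (Rmin_l (e * psi x) 1). pose proof (Rmin_r (e * psi x) 1).
    destruct (IVT_interv (fun t => e * psi (t * x) - v) 0 1) as [t [Ht E]].
    - intros t Ht. apply continuity_pt_filterlim.
      apply (continuous_minus (V := R_NormedModule) (fun t => e * psi (t * x)) (fun _ => v)); [|apply continuous_const].
      apply (continuous_scal_r (V := R_NormedModule) e (fun t => psi (t * x))).
      apply (continuous_comp (fun t => t * x) psi).
      + apply (ex_derive_continuous (V := R_NormedModule) (fun t => t * x)). auto_derive. easy.
      + apply continuity_pt_filterlim, Hcont. nra.
    - lra.
    - rewrite Rmult_0_l. unfold psi. rewrite Rminus_diag. unfold v. lra.
    - rewrite Rmult_1_l. unfold v. lra.
    - assert (Htx : -1 < t * x < 1) by nra.
      pose proof (Hcos _ Htx) as Hc1.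
      assert (Hv : cos v = 1).
      { replace v with (e * psi (t * x)) by lra.
        assert (He' : e = 1 \/ e = -1) by (unfold Rabs in He; destruct (Rcase_abs e); lra).
        destruct He' as [-> | ->]; [now rewrite Rmult_1_l|].
        replace (-1 * psi (t * x)) with (- psi (t * x)) by ring. now rewrite cos_neg. }
      replace v with (2 * (v / 2)) in Hv by field. rewrite cos_2a_sin in Hv.
      assert (0 < sin (v / 2)); [|nra]. apply sin_gt_0; unfold v; pose proof PI_4; pose proof PI_RGT_0; try lra.
      pose proof PI2_1. lra. }
  intros x Hx. destruct (HL _ (Hmod x Hx)) as [_ [_ ->]].
  destruct (HL _ (Hmod 0 ltac:(lra))) as [_ [_ E0]]. rewrite E0 in Hp0, Hi0.
  assert (Hform : forall y, -1 < y < 1 -> Cexp (RtoC alpha * L (RtoC y)) =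
     (exp (alpha * ln (br y)) * cos (alpha * Im (L (RtoC 0))), exp (alpha * ln (br y)) * sin (alpha * Im (L (RtoC 0))))).
  { intros y Hy. unfold Cexp.
    replace (Re (RtoC alpha * L (RtoC y))) with (alpha * ln (br y)).
    2:{ rewrite Cmult_comm, Re_mul_real. destruct (Hexp y Hy) as [-> _]. ring. }
    replace (Im (RtoC alpha * L (RtoC y))) with (alpha * Im (L (RtoC 0))); [reflexivity|].
    rewrite Cmult_comm, Im_mul_real. specialize (Hpsi y Hy). unfold psi in Hpsi.
    replace (Im (L (RtoC y))) with (Im (L (RtoC 0))) by lra. ring. }
  rewrite Hform in Hp0, Hi0 by lra. rewrite Hform by exact Hx. simpl in Hp0, Hi0.
  pose proof (exp_pos (alpha * ln (br 0))) as Hp.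
  set (w := alpha * Im (L (RtoC 0))) in *.
  assert (Hs : sin w = 0) by (apply (Rmult_eq_reg_l (exp (alpha * ln (br 0)))); lra).
  assert (Hc : cos w = 1).
  { pose proof (sin2_cos2 w) as H. rewrite Hs in H. unfold Rsqr in H.
    assert (0 < cos w) by nra. nra. }
  rewrite Hs, Hc. unfold RtoC, Rpower. f_equal; ring.
Qed.

Lemma taylor_series (omega : C -> C) (om : nat -> C) (z : C) : is_taylor_coef omega om -> Cmod z < 1 ->
  is_series (fun n => Re (scale z om n)) (Re (omega z)) /\
  is_series (fun n => Im (scale z om n)) (Im (omega z)).
Proof.
  intros H Hz. specialize (H z Hz).
  unfold is_pseries, is_series in H.
  assert (Hpow : forall n, pow_n (K := C_AbsRing) z n = (z ^ n)%C).
  { induction n as [|n IH]; [reflexivity|]. simpl. now rewrite IH. }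
  assert (Hsum : forall n, sum_n (fun k => scal (V := C_NormedModule) (pow_n (K := C_AbsRing) z k) (om k)) n = fsum (scale z om) (S n)).
  { induction n as [|n IH].
    - rewrite sum_O. rewrite Hpow. unfold scale. simpl. unfold scal; simpl. unfold mult; simpl. ring.
    - rewrite sum_Sn, IH, Hpow. simpl. unfold scale. unfold plus, scal; simpl. unfold mult; simpl. ring. }
  split.
  - apply (filterlim_comp _ _ _ _ (fun z : C => Re z) eventually (locally (omega z)) (locally (Re (omega z)))) in H.
    + eapply filterlim_ext; [|exact H]. intros n. etransitivity; [exact (f_equal Re (Hsum n))|]. rewrite fsum_re. symmetry. apply rsum_sum_n.
    + exact (continuous_fst (U := R_UniformSpace) (V := R_UniformSpace) (Re (omega z)) (Im (omega z))).
  - apply (filterlim_comp _ _ _ _ (fun z : C => Im z) eventually (locally (omega z)) (locally (Im (omega z)))) in H.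
    + eapply filterlim_ext; [|exact H]. intros n. etransitivity; [exact (f_equal Im (Hsum n))|]. rewrite fsum_im. symmetry. apply rsum_sum_n.
    + exact (continuous_snd (U := R_UniformSpace) (V := R_UniformSpace) (Re (omega z)) (Im (omega z))).
Qed.

Lemma taylor_tsum (omega : C -> C) (om : nat -> C) (z : C) : is_taylor_coef omega om -> Cmod z < 1 ->
  tsum (scale z om) = omega z.
Proof. intros H Hz. destruct (taylor_series omega om z H Hz). now apply tsum_unique. Qed.

(** * Structure of the generating functions *)

Lemma ev_pol (a : nat -> C) (d : nat) (z : C) : Cmod z <= 1 ->
  ev (pol a d) z = fsum (fun k => a k * (1 - z) ^ k)%C d.
Proof.
  intros Hz. induction d as [|d IH]; [apply ev_K|].
  rewrite pol_last, ev_add, ev_mul, ev_pow, ev_K, ev_X, IH;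
    auto using pol_l1, l1_mul, l1_K, l1_pow, l1_X.
Qed.

Lemma fsum_fR (u : nat -> R) (n : nat) : fsum (fun k => RtoC (u k)) n = RtoC (rsum u n).
Proof. induction n as [|n IH]; simpl; [reflexivity|]. now rewrite IH, RtoC_plus. Qed.

Lemma ev_pol_real (a : nat -> R) (d : nat) (x : R) : -1 <= x <= 1 ->
  ev (pol (fR a) d) (RtoC x) = RtoC (rsum (fun k => a k * (1 - x) ^ k) d).
Proof.
  intros Hx. rewrite ev_pol by (rewrite Cmod_R; apply Rabs_le; lra).
  rewrite <- fsum_fR. apply fsum_ext. intros k _. unfold fR.
  rewrite RtoC_mult, RtoC_pow, RtoC_minus. reflexivity.
Qed.

Lemma fX_real : exists r, fX = fR r.
Proof.
  exists (fun n => match n with O => 1 | 1%nat => -1 | _ => 0 end).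
  apply functional_extensionality; intros [|[|n]]; unfold fX, fsub, fR; simpl.
  - ring. - change (-1) with (- (1)); rewrite RtoC_opp. ring. - ring.
Qed.

Lemma fR_mul (a b : nat -> R) : exists r, (fR a * fR b)%fps = fR r.
Proof.
  eexists. fps_ext n. apply fmul_fR.
Qed.

Lemma pol_real (a : nat -> R) (d : nat) : exists r, pol (fR a) d = fR r.
Proof.
  revert a. induction d as [|d IH]; intros a.
  - exists (fun _ => 0). apply functional_extensionality; intros [|n]; reflexivity.
  - simpl. destruct (IH (fun k => a (S k))) as [r Hr]. change (fshift (fR a)) with (fR (fun k => a (S k))).
    rewrite Hr. destruct fX_real as [x ->]. destruct (fR_mul x r) as [m ->].
    exists (fun n => match n with O => a O + m O | _ => m n end).
    apply functional_extensionality; intros [|n]; unfold fadd, fR; simpl; [now rewrite RtoC_plus|ring].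
Qed.

Lemma bounded_of_l1 (a : nat -> C) : l1 a -> exists B, forall n, Cmod (a n) <= B.
Proof. intros [B HB]. exists B. intros n. now apply sums_le_coef. Qed.

Lemma power_series_value_pol (a : fps) (w : nat -> R) (d : nat) (al B : R) :
  (forall n, Cmod (a n) <= B) ->
  (pol (fR w) d * ftheta a)%fps = (fK (RtoC al) * (ftheta (pol (fR w) d) * a))%fps ->
  (forall x, -1 < x < 1 -> 0 < rsum (fun k => w k * (1 - x) ^ k) d) ->
  forall x, -1 < x < 1 -> tsum (scale (RtoC x) a) =
    (a O * RtoC (Rpower (rsum (fun k => (w k * (1 - x) ^ k)%R) d / rsum (fun k => (w k * (1 - 0) ^ k)%R) d) al))%C.
Proof.
  intros Ha Hode Hpos.
  destruct (pol_real w d) as [r Hr]. destruct (bounded_of_l1 _ (pol_l1 (fR w) d)) as [B' HB'].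
  assert (Hval : forall x, -1 < x < 1 -> PSeries r x = rsum (fun k => w k * (1 - x) ^ k) d).
  { intros x Hx. pose proof (ev_pol_real w d x ltac:(lra)) as H. unfold ev in H.
    rewrite Hr, tsum_scale_real in H. apply (f_equal Re) in H. exact H. }
  intros x Hx. rewrite <- !Hval by lra. rewrite Hr in *.
  apply (power_series_value a r al (Rmax B B')); auto.
  - intros n. eapply Rle_trans; [apply Ha|apply Rmax_l].
  - intros n. specialize (HB' n). unfold fR in HB'. rewrite Cmod_R in HB'.
    eapply Rle_trans; [exact HB'|apply Rmax_r].
  - intros y Hy. rewrite Hval by exact Hy. now apply Hpos.
Qed.

Lemma cbin_value (alpha x : R) : 0 < alpha -> -1 < x < 1 ->
  tsum (scale (RtoC x) (cbin (- alpha))) = RtoC (Rpower (1 - x) alpha).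
Proof.
  intros Ha Hx. destruct (bounded_of_l1 _ (cbin_l1 alpha Ha)) as [B HB].
  set (w := fun k : nat => match k with 1%nat => 1 | _ => 0 end).
  assert (Hw : pol (fR w) 2 = fX) by (unfold w; simpl; unfold fR, fshift; simpl; ring).
  assert (Hs : forall y, rsum (fun k => w k * (1 - y) ^ k) 2 = 1 - y) by (intros; unfold w; simpl; ring).
  rewrite (power_series_value_pol _ w 2 alpha B HB).
  - rewrite !Hs. unfold cbin, fR; simpl. rewrite Cmult_1_l. do 2 f_equal. field.
  - rewrite Hw, cbin_theta, ftheta_X, RtoC_opp, fK_opp. ring.
  - intros y Hy. rewrite Hs. lra.
  - exact Hx.
Qed.

(** Convergence at z = 1/2 bounds the terms there, which gives [om] a positive radius of convergence
    before its summability is known. *)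
Lemma taylor_bounded (omega : C -> C) (om : nat -> C) : is_taylor_coef omega om ->
  exists K, forall n, Cmod (om n * RtoC (1 / 2) ^ n) <= K.
Proof.
  intros H. assert (Hz : Cmod (RtoC (1 / 2)) < 1) by (rewrite Cmod_R, Rabs_pos_eq; lra).
  destruct (taylor_series omega om _ H Hz) as [H1 H2].
  assert (Hb : forall u : nat -> R, ex_series u -> exists B, forall n, Rabs (u n) <= B).
  { intros u Hu. apply ex_series_lim_0, null_of_lim, null_bounded in Hu. destruct Hu as [B HB].
    exists B. intros n. rewrite <- Cmod_R. apply HB. }
  destruct (Hb _ (ex_intro _ _ H1)) as [B1 HB1]. destruct (Hb _ (ex_intro _ _ H2)) as [B2 HB2].
  exists (B1 + B2). intros n. eapply Rle_trans; [apply Cmod_le_re_im|].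
  specialize (HB1 n). specialize (HB2 n). unfold scale in *. lra.
Qed.

Lemma taylor_eq (omega : C -> C) (om : nat -> C) (a : fps) : is_taylor_coef omega om -> l1 a ->
  (forall x, -1 < x < 1 -> omega (RtoC x) = tsum (scale (RtoC x) a)) -> om = a.
Proof.
  intros Hom [A HA] H. destruct (taylor_bounded omega om Hom) as [K HK].
  apply (fps_eq_of_real om a (Rmax K A) (1 / 2)); [lra| | |].
  - intros n. eapply Rle_trans; [apply HK|apply Rmax_l].
  - intros n. eapply Rle_trans; [|apply Rmax_r]. rewrite Cmod_mult.
    pose proof (sums_le_coef a A n HA). pose proof (Cmod_ge_0 (a n)).
    pose proof (Cpow_mod_le_1 (RtoC (1 / 2)) n). rewrite Cmod_R, Rabs_pos_eq in * by lra.
    specialize (H2 ltac:(lra)). pose proof (Cmod_ge_0 (RtoC (1 / 2) ^ n)). nra.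
  - intros x Hx. rewrite (taylor_tsum omega om) by (auto; rewrite Cmod_R; apply Rabs_def1; lra). now apply H.
Qed.

Lemma newton_gregory_structure (p : nat) (alpha : R) (omega : C -> C) (om : nat -> C) : 0 < alpha ->
  is_newton_gregory p alpha omega -> is_taylor_coef omega om -> order_structure p alpha om.
Proof.
  intros Ha [f [Hf Homega]] Hom. exists 0%fps. split; [apply l1_K|].
  replace (ng_pol p alpha + fX ^ p * 0)%fps with (ng_pol p alpha) by ring.
  assert (Hl : l1 (cbin (- alpha) * ng_pol p alpha)%fps) by (apply l1_mul; [now apply cbin_l1|apply pol_l1]).
  apply (taylor_eq omega); auto. intros x Hx.
  assert (Hx1 : Cmod (RtoC x) <= 1) by (rewrite Cmod_R; apply Rabs_le; lra).
  rewrite scale_mul, tsum_mul by (apply scale_l1; [exact Hx1|first [now apply cbin_l1|apply pol_l1]]).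
  rewrite cbin_value by auto. fold (ev (ng_pol p alpha) (RtoC x)). unfold ng_pol. rewrite ev_pol by exact Hx1.
  rewrite Homega by exact Hx1.
  rewrite (power_branch_real (fun z => 1 - z)%C f alpha (fun x => 1 - x)); auto.
  - rewrite csum_1_fsum. f_equal. apply fsum_ext. intros k _. simpl. now rewrite Nat.sub_0_r.
  - intros y Hy. split; [now rewrite RtoC_minus|lra].
Qed.

(** ** Fractional backward differences *)

(** Coefficients of -ln(1-X)/X; with g = [bdf_pol] the generating function is (X g)^alpha. *)
Definition bdf_coef (k : nat) : R := / INR (S k).
Definition bdf_pol (p : nat) : fps := pol (fR bdf_coef) p.

(** For |z| = 1 and y = 1 - z the conjugate yb of y satisfies z yb = -y, so z^m times the conjugated
    polynomial is again a polynomial in y and z. *)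
Lemma reversed_sum (c : nat -> C) (y z yb : C) (m : nat) : (z * yb = - y)%C ->
  (z ^ m * fsum (fun k => c k * yb ^ k) (S m) = fsum (fun k => c k * (- y) ^ k * z ^ (m - k)) (S m))%C.
Proof.
  intros H. rewrite <- fsum_scal. apply fsum_ext. intros k Hk. rewrite <- H, Cpow_mult_l.
  replace m with (k + (m - k))%nat at 1 by lia. rewrite Cpow_add_r. ring.
Qed.

Lemma bezout_zero (s t d u v : C) : s = RtoC 0 -> t = RtoC 0 -> d = (u * s + v * t)%C -> d = RtoC 0.
Proof. intros -> -> ->. ring. Qed.

(* On |z| = 1, conjugating g(z) = 0 gives a second polynomial equation g_rev(z) = 0;
   the polynomials given to bezout_zero are Bezout coefficients of g and g_rev. *)
Lemma bdf_pol_circle (p : nat) (z : C) : (1 <= p <= 6)%nat -> Cmod z = 1 ->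
  ev (bdf_pol p) z <> RtoC 0.
Proof.
  intros Hp Hz E. unfold bdf_pol in E. rewrite ev_pol in E by lra.
  set (y := (1 - z)%C) in *. set (yb := Cconj y).
  assert (Hzy : (z * yb = - y)%C).
  { unfold yb, y. replace (Cconj (1 - z)) with (1 - Cconj z)%C.
    - replace (z * (1 - Cconj z))%C with (z - z * Cconj z)%C by ring.
      rewrite <- Cmod2_conj, Hz. simpl. rewrite !Rmult_1_r. ring.
    - unfold Cconj, Cminus, Cplus, Copp, RtoC; simpl. f_equal. ring. }
  assert (Hc : forall n, fsum (fun k => fR bdf_coef k * yb ^ k)%C n = Cconj (fsum (fun k => fR bdf_coef k * y ^ k)%C n)).
  { induction n as [|n IH].
    - simpl. unfold Cconj, RtoC; simpl. f_equal. ring.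
    - simpl. rewrite IH. unfold yb. rewrite <- Cpow_conj.
      assert (Hr : Cconj (fR bdf_coef n) = fR bdf_coef n) by (unfold fR, Cconj, RtoC; simpl; f_equal; ring).
      rewrite Cplus_conj, Cmult_conj, Hr. reflexivity. }
  assert (Er : fsum (fun k => fR bdf_coef k * yb ^ k)%C p = RtoC 0).
  { rewrite Hc, E. unfold Cconj, RtoC; simpl. f_equal. ring. }
  destruct p as [|m]; [lia|].
  assert (Hr := reversed_sum (fR bdf_coef) y z yb m Hzy). rewrite Er, Cmult_0_r in Hr. symmetry in Hr.
  replace z with (1 - y)%C in Hr by (unfold y; ring).
  clearbody y. clear Er Hc Hzy yb Hz z.
  (* 60 is the least common multiple of 1, ..., 6 and makes the coefficients integers. In each case
     below the Bezout combination reduces to the nonzero constant D/60. *)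
  assert (Hk : forall k, (k <= 5)%nat -> fR bdf_coef k =
     (RtoC (nth k (60 :: 30 :: 20 :: 15 :: 12 :: 10 :: nil)%list 0) * RtoC (/ 60))%C).
  { intros k Hk. unfold fR, bdf_coef. rewrite <- RtoC_mult. f_equal.
    do 6 (destruct k as [|k]; [simpl; field|]). lia. }
  assert (Hfin : forall D, D <> 0 -> (RtoC D * RtoC (/ 60) = 0)%C -> False).
  { intros D HD H. rewrite <- RtoC_mult in H. apply RtoC_inj in H. lra. }
  destruct m as [|[|[|[|[|[|m]]]]]]; [| | | | | |lia];
    cbn [fsum Nat.sub] in E, Hr; rewrite ?Hk in E, Hr by lia; cbn [nth] in E, Hr.
  - apply (Hfin 60); [lra|]. rewrite <- E. ring.
  - apply (Hfin (60 * 4)); [lra|].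
    rewrite RtoC_mult.
    apply (bezout_zero _ _ _ (RtoC 3)%C (RtoC 1)%C E Hr). ring.
  - apply (Hfin (60 * 180)); [lra|].
    rewrite RtoC_mult.
    apply (bezout_zero _ _ _ (RtoC (171) * y ^ 0 + RtoC (-77) * y ^ 1)%C (RtoC (9) * y ^ 0 + RtoC (14) * y ^ 1)%C E Hr). ring.
  - apply (Hfin (60 * 2880)); [lra|].
    rewrite RtoC_mult.
    apply (bezout_zero _ _ _ (RtoC (3054) * y ^ 0 + RtoC (-2026) * y ^ 1 + RtoC (325) * y ^ 2)%C (RtoC (-174) * y ^ 0 + RtoC (-110) * y ^ 1 + RtoC (39) * y ^ 2)%C E Hr). ring.
  - apply (Hfin (60 * 2188800)); [lra|].
    rewrite RtoC_mult.
    apply (bezout_zero _ _ _ (RtoC (2119110) * y ^ 0 + RtoC (-706840) * y ^ 1 + RtoC (-971965) * y ^ 2 + RtoC (528683) * y ^ 3)%C (RtoC (69690) * y ^ 0 + RtoC (-39110) * y ^ 1 + RtoC (-102885) * y ^ 2 + RtoC (-46308) * y ^ 3)%C E Hr). ring.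
  - apply (Hfin (60 * 35380800)); [lra|].
    rewrite RtoC_mult.
    apply (bezout_zero _ _ _ (RtoC (33001830) * y ^ 0 + RtoC (-8819870) * y ^ 1 + RtoC (-11342205) * y ^ 2 + RtoC (-6770628) * y ^ 3 + RtoC (9471063) * y ^ 4)%C (RtoC (2378970) * y ^ 0 + RtoC (5403290) * y ^ 1 + RtoC (5128995) * y ^ 2 + RtoC (2600448) * y ^ 3 + RtoC (644290) * y ^ 4)%C E Hr). ring.
Qed.

Definition dcoef (a : nat -> R) (i : nat) : R := INR (S i) * a (S i).

(** Chain rule with z d/dz X = -z; [dcoef] is differentiation with respect to X. *)
Lemma pol_theta (a : nat -> R) (d : nat) :
  ftheta (pol (fR a) (S d)) = (- (fz * pol (fR (dcoef a)) d))%fps.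
Proof.
  revert a. induction d as [|d IH]; intros a.
  - simpl. rewrite ftheta_add, ftheta_mul, !ftheta_K, ftheta_X. ring.
  - change (pol (fR a) (S (S d))) with (fK (fR a O) + fX * pol (fR (fun k => a (S k))) (S d))%fps.
    rewrite ftheta_add, ftheta_mul, ftheta_K, ftheta_X, IH.
    assert (E : pol (fR (dcoef a)) (S d) =
      (pol (fR (fun k => a (S k))) (S d) + fX * pol (fR (dcoef (fun k => a (S k)))) d)%fps).
    { change (pol (fR (dcoef a)) (S d)) with (fK (fR (dcoef a) O) + fX * pol (fR (fun k => dcoef a (S k))) d)%fps.
      change (pol (fR (fun k => a (S k))) (S d)) with (fK (RtoC (a 1%nat)) + fX * pol (fR (fun k => a (S (S k)))) d)%fps.
      replace (pol (fR (fun k => dcoef a (S k))) d) with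
        (pol (fR (fun k => a (S (S k)))) d + pol (fR (dcoef (fun k => a (S k)))) d)%fps.
      - replace (fR (dcoef a) O) with (RtoC (a 1%nat)) by (unfold fR, dcoef; simpl; f_equal; ring). ring.
      - rewrite <- pol_add. apply pol_ext. intros k _. unfold fadd, fR, dcoef.
        rewrite <- RtoC_plus. f_equal. rewrite (S_INR (S k)). ring. }
    rewrite E. ring.
Qed.

(** With L = -ln(1-X)/X, this is L (L^alpha)' = alpha L' L^alpha in coefficients; the orders up to
    X^4 involve those of index at most 5. *)
Lemma ng_coef_ode (alpha : R) (k : nat) : (k <= 4)%nat ->
  fmul (fR (dcoef (fun k => ng_coef k alpha))) (fR bdf_coef) k =
  (RtoC alpha * fmul (fR (dcoef bdf_coef)) (fR (fun k => ng_coef k alpha)) k)%C.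
Proof.
  intros Hk.
  rewrite !fmul_fR, <- RtoC_mult. f_equal.
  do 5 (destruct k as [|k]; [cbn [rsum Nat.sub]; unfold dcoef, bdf_coef, ng_coef; simpl INR; field|]). lia.
Qed.

(** The polynomial of the g_k solves the equation of g^alpha only up to a multiple of X^(p-1):
    differentiation in X loses one order. *)
Lemma ng_pol_ode (p : nat) (alpha : R) : (1 <= p <= 6)%nat ->
  exists Q, l1 Q /\
    (bdf_pol p * ftheta (ng_pol p alpha) - fK (RtoC alpha) * (ftheta (bdf_pol p) * ng_pol p alpha))%fps
    = (- (fz * (fX ^ (p - 1) * Q)))%fps.
Proof.
  intros Hp. destruct p as [|d]; [lia|]. replace (S d - 1)%nat with d by lia.
  unfold bdf_pol, ng_pol. rewrite !pol_theta.
  destruct (pol_mul (fR (dcoef (fun k => ng_coef k alpha))) (fR bdf_coef) d (S d) ltac:(lia)) as [Q1 [H1 E1]].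
  destruct (pol_mul (fR (dcoef bdf_coef)) (fR (fun k => ng_coef k alpha)) d (S d) ltac:(lia)) as [Q2 [H2 E2]].
  exists (Q1 - fK (RtoC alpha) * Q2)%fps. split; [apply l1_sub, l1_mul; auto using l1_K|].
  rewrite (pol_ext (fR (dcoef (fun k => ng_coef k alpha)) * fR bdf_coef)%fps (fun i => RtoC alpha * fmul (fR (dcoef bdf_coef)) (fR (fun k => ng_coef k alpha)) i)%C) in E1
    by (intros k Hk; apply ng_coef_ode; lia).
  rewrite pol_scal in E1.
  transitivity (- (fz * (pol (fR (dcoef (fun k => ng_coef k alpha))) d * pol (fR bdf_coef) (S d)
     - fK (RtoC alpha) * (pol (fR (dcoef bdf_coef)) d * pol (fR (fun k => ng_coef k alpha)) (S d)))))%fps; [ring|].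
  rewrite E1, E2. ring.
Qed.

Lemma geo_finite (a : nat -> C) (N : nat) : (forall n, (N <= n)%nat -> a n = RtoC 0) -> geo a.
Proof.
  intros H. exists (rsum (fun k => Cmod (a k) * 2 ^ k) N), (/ 2). 
  assert (Hpos : forall k, 0 <= Cmod (a k) * 2 ^ k).
  { intros k. apply Rmult_le_pos; [apply Cmod_ge_0|apply pow_le; lra]. }
  split; [now apply rsum_nonneg|]. split; [lra|]. intros n.
  destruct (le_lt_dec N n) as [Hn|Hn].
  - rewrite H by exact Hn. rewrite Cmod_0. apply Rmult_le_pos; [now apply rsum_nonneg|apply pow_le; lra].
  - assert (H1 : Cmod (a n) * 2 ^ n <= rsum (fun k => Cmod (a k) * 2 ^ k) N).
    { pose proof (rsum_mono _ (S n) N Hpos Hn) as Hm. simpl in Hm.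
      pose proof (rsum_nonneg _ n Hpos). lra. }
    apply (Rmult_le_compat_r ((/ 2) ^ n)) in H1; [|apply pow_le; lra].
    rewrite Rmult_assoc, <- Rpow_mult_distr in H1. replace (2 * / 2) with 1 in H1 by field.
    rewrite pow1, Rmult_1_r in H1. exact H1.
Qed.

Lemma geo_sub (a b : fps) : geo a -> geo b -> geo (a - b)%fps.
Proof.
  intros (K & r & HK & Hr & Ha) (L & s & HL & Hs & Hb). exists (K + L), (Rmax r s).
  split; [lra|]. split; [split; [eapply Rle_trans; [apply Hr|apply Rmax_l]|apply Rmax_lub_lt; lra]|].
  intros n. unfold fsub, Cminus. eapply Rle_trans; [apply Cmod_triangle|]. rewrite Cmod_opp, Rmult_plus_distr_r.
  apply Rplus_le_compat.
  - eapply Rle_trans; [apply Ha|]. apply Rmult_le_compat_l; [exact HK|]. apply pow_incr. split; [lra|apply Rmax_l].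
  - eapply Rle_trans; [apply Hb|]. apply Rmult_le_compat_l; [exact HL|]. apply pow_incr. split; [lra|apply Rmax_r].
Qed.

Lemma pol_degree (a : nat -> C) (d n : nat) : (d <= n)%nat -> pol a d n = RtoC 0.
Proof.
  revert a n. induction d as [|d IH]; intros a n Hn.
  - destruct n; reflexivity.
  - destruct n as [|n]; [lia|]. simpl pol. unfold fadd. rewrite fX_mul_S.
    rewrite !IH by lia. simpl. ring.
Qed.

(** The coefficients of f/X are the partial sums of f. As the total sum is zero they are minus the
    tails, and tails of a geometrically decaying sequence decay geometrically. *)
Lemma geo_div_X (f : fps) : geo f -> ev f (RtoC 1) = RtoC 0 -> exists h, geo h /\ f = (fX * h)%fps.
Proof.
  intros Hf H1. pose proof (geo_l1 f Hf) as Hl. unfold ev in H1. rewrite scale_1 in H1.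
  destruct Hf as (K & r & HK & Hr & Hb).
  exists (fun n => fsum f (S n)). split.
  - exists (K * / (1 - r)), r. assert (Hi : 0 < / (1 - r)) by (apply Rinv_0_lt_compat; lra).
    split; [apply Rmult_le_pos; lra|]. split; [lra|]. intros n.
    replace (fsum f (S n)) with (- (tsum f - fsum f (S n)))%C by (rewrite H1; ring). rewrite Cmod_opp.
    apply tsum_tail_le; [exact Hl|]. intros m.
    apply Rle_trans with (rsum (fun k => K * r ^ n * r ^ k) m).
    + apply rsum_le. intros k _. eapply Rle_trans; [apply Hb|].
      rewrite Rmult_assoc, <- pow_add. apply Rmult_le_compat_l; [exact HK|].
      simpl. rewrite <- (Rmult_1_l (r ^ (n + k))) at 2. apply Rmult_le_compat_r; [apply pow_le; lra|lra].
    + rewrite rsum_scal. pose proof (rsum_geom r m Hr). pose proof (pow_le r n ltac:(lra)).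
      replace (K * / (1 - r) * r ^ n) with (K * r ^ n * / (1 - r)) by ring.
      apply Rmult_le_compat_l; [apply Rmult_le_pos; lra|assumption].
  - apply functional_extensionality; intros [|n].
    + rewrite fX_mul_O. simpl. ring.
    + rewrite fX_mul_S. change (fsum f (S (S n))) with (fsum f (S n) + f (S n))%C. ring.
Qed.

Lemma fX_pow_theta (k : nat) : (ftheta (fX ^ S k) = - (fK (RtoC (INR (S k))) * (fz * fX ^ k)))%fps.
Proof.
  induction k as [|k IH].
  - simpl fpow. rewrite ftheta_mul, ftheta_K, ftheta_X. simpl INR. ring.
  - change (fX ^ S (S k))%fps with (fX * fX ^ S k)%fps. rewrite ftheta_mul, IH, ftheta_X.
    rewrite (S_INR (S k)), RtoC_plus, fK_add. simpl fpow. ring.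
Qed.

Lemma fX_pow_O (k : nat) : fpow fX k O = RtoC 1.
Proof. induction k as [|k IH]; [reflexivity|]. simpl. now rewrite fX_mul_O. Qed.

Section FractionalBDF.
Variables (p : nat) (alpha : R).
Hypothesis Hp : (1 <= p <= 6)%nat.
Hypothesis Halpha : 0 < alpha.
Hypothesis Hne : forall z, Cmod z <= 1 -> ev (bdf_pol p) z <> RtoC 0.

Let g := bdf_pol p.

Lemma bdf_pol_at_1 : ev g (RtoC 1) = RtoC 1.
Proof.
  unfold g, bdf_pol. rewrite ev_pol by (rewrite Cmod_1; lra).
  destruct p as [|d]; [lia|]. rewrite fsum_S_l, (fsum_ext _ (fun _ => RtoC 0)), fsum_0.
  - unfold fR, bdf_coef. simpl. rewrite Rinv_1. ring.
  - intros k _. replace (1 - 1)%C with (RtoC 0) by ring. simpl. ring.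
Qed.

(** A polynomial of modulus at least mu on the closed disk changes by at most mu/2 under a small
    dilation. *)
Lemma scale_bdf_nonzero : exists R0, 1 < R0 /\ forall z, Cmod z <= 1 -> ev (scale (RtoC R0) g) z <> RtoC 0.
Proof.
  destruct (ev_bounded_below g (pol_l1 _ _) Hne) as [mu [Hmu Hb]].
  (* The weights 4^k come from (1+h)^k - 1 <= h 4^k for 0 <= h <= 1. *)
  set (S0 := rsum (fun k => Cmod (g k) * 4 ^ k) p).
  assert (HS : 0 <= S0) by (apply rsum_nonneg; intros; apply Rmult_le_pos; [apply Cmod_ge_0|apply pow_le; lra]).
  set (h := Rmin 1 (mu / 2 / (S0 + 1))).
  assert (Hh : 0 < h) by (apply Rmin_pos; [lra|repeat apply Rdiv_lt_0_compat; lra]).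
  pose proof (Rmin_l 1 (mu / 2 / (S0 + 1))) as Hh1. pose proof (Rmin_r 1 (mu / 2 / (S0 + 1))) as Hh2. fold h in Hh1, Hh2.
  exists (1 + h). split; [lra|]. intros z Hz E.
  assert (Hpow : forall k, 0 <= (1 + h) ^ k - 1 <= h * 4 ^ k).
  { induction k as [|k IH]; simpl; [lra|]. assert (1 <= 4 ^ k) by (apply pow_R1_Rle; lra). nra. }
  assert (Hdiff : sums_le (scale (RtoC (1 + h)) g - g)%fps (mu / 2)).
  { intros n. apply Rle_trans with (rsum (fun k => Cmod ((scale (RtoC (1 + h)) g - g)%fps k)) (p + n)).
    { apply rsum_mono; [intros; apply Cmod_ge_0|lia]. }
    rewrite rsum_app, (rsum_ext (fun k => Cmod ((scale (RtoC (1 + h)) g - g)%fps (p + k)%nat)) (fun _ => 0)).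
    2:{ intros k _. unfold fsub, scale, g, bdf_pol. rewrite pol_degree by lia.
        rewrite Cmult_0_l. replace (0 - 0)%C with (RtoC 0) by ring. apply Cmod_0. }
    rewrite rsum_const, Rmult_0_r, Rplus_0_r.
    apply Rle_trans with (rsum (fun k => h * (Cmod (g k) * 4 ^ k)) p).
    - apply rsum_le. intros k _. unfold fsub, scale.
      replace (g k * RtoC (1 + h) ^ k - g k)%C with (g k * RtoC ((1 + h) ^ k - 1))%C
        by (rewrite RtoC_minus, RtoC_pow; ring).
      rewrite Cmod_mult, Cmod_R, Rabs_pos_eq by apply Hpow.
      pose proof (Cmod_ge_0 (g k)). destruct (Hpow k). nra.
    - rewrite rsum_scal. fold S0.
      apply Rle_trans with (mu / 2 / (S0 + 1) * (S0 + 1)); [|right; field; lra].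
      apply Rmult_le_compat; lra. }
  pose proof (ev_bound z Hz _ _ Hdiff) as H1.
  rewrite ev_sub, E in H1.
  - replace (0 - ev g z)%C with (- ev g z)%C in H1 by ring. rewrite Cmod_opp in H1. specialize (Hb z Hz). lra.
  - exact Hz.
  - apply (l1_finite _ p). intros n Hn. unfold scale, g, bdf_pol. rewrite pol_degree by exact Hn. ring.
  - apply pol_l1.
Qed.

(* G = g^alpha has geometrically decaying coefficients: with E = alpha theta(g)/g one has
   n |G_n| <= sum |E_k| |G_(n-k)|, and this bounds G_n, also after rescaling by R0 > 1. *)
Lemma bdf_power_exists (c : C) : exists G : fps, geo G /\ G O = c /\
  (g * ftheta G)%fps = (fK (RtoC alpha) * (ftheta g * G))%fps.
Proof.
  destruct scale_bdf_nonzero as [R0 [HR0 Hnz]].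
  assert (Hg0 : g O <> RtoC 0).
  { rewrite <- ev_0. apply Hne. rewrite Cmod_0. lra. }
  destruct (fps_inverse g Hg0) as [e He].
  assert (Hsg : forall a : fps, (forall n, (p <= n)%nat -> a n = RtoC 0) -> l1 (scale (RtoC R0) a)).
  { intros a Ha. apply (l1_finite _ p). intros n Hn. unfold scale. rewrite Ha by exact Hn. ring. }
  assert (Hle : l1 (scale (RtoC R0) e)).
  { apply (wiener (scale (RtoC R0) g)).
    - apply Hsg. intros n Hn. now apply pol_degree.
    - now rewrite <- scale_mul, He, scale_K.
    - exact Hnz. }
  set (E := (fK (RtoC alpha) * (ftheta g * e))%fps).
  assert (HlE : l1 (scale (RtoC R0) E)).
  { unfold E. rewrite !scale_mul, scale_K. apply l1_mul; [apply l1_K|]. apply l1_mul; [|exact Hle].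
    apply Hsg. intros n Hn. unfold ftheta, g, bdf_pol. rewrite pol_degree by exact Hn. ring. }
  (* Because [E] has no constant term, theta G = E G determines G_n from the earlier
     coefficients. *)
  assert (HE0 : E O = RtoC 0).
  { unfold E. rewrite !fmul_O. unfold ftheta. simpl. ring. }
  destruct (course_of_values (RtoC 0) (fun n u => match n with O => c
     | S m => (/ RtoC (INR (S m)) * fsum (fun j => E (S m - j)%nat * u j) (S m))%C end)) as [G HG].
  { intros [|n] u v H; [reflexivity|]. f_equal. apply fsum_ext. intros k Hk. now rewrite H. }
  assert (HGode : ftheta G = (E * G)%fps).
  { apply functional_extensionality; intros [|n].
    - unfold ftheta. rewrite fmul_O, HE0. simpl. ring.
    - unfold ftheta. rewrite (HG (S n)) at 1.
      unfold fmul. change (fsum (fun j => E (S n - j)%nat * G j)%C (S (S n))) with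
        (fsum (fun j => E (S n - j)%nat * G j) (S n) + E (S n - S n)%nat * G (S n))%C.
      rewrite Nat.sub_diag, HE0, Cmult_assoc, Cinv_r by (apply RtoC_neq_0, not_0_INR; lia). ring. }
  exists G. split; [|split; [apply (HG O)|]].
  - destruct HlE as [B HB]. pose proof (sums_le_nonneg _ _ HB) as HB0.
    set (Gt := scale (RtoC R0) G).
    assert (Hrec : forall n, INR n * Cmod (Gt n) <= rsum (fun j => Cmod (scale (RtoC R0) E (n - j)%nat) * Cmod (Gt j)) n).
    { intros n. assert (Ht : (RtoC (INR n) * Gt n = fmul (scale (RtoC R0) E) Gt n)%C).
      { unfold Gt. rewrite <- scale_mul, <- HGode. unfold scale, ftheta. ring. }
      rewrite <- (Rabs_pos_eq (INR n)) by apply pos_INR. rewrite <- Cmod_R, <- Cmod_mult, Ht.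
      unfold fmul. simpl fsum. rewrite Nat.sub_diag.
      replace (scale (RtoC R0) E O) with (RtoC 0) by (unfold scale; rewrite HE0; ring).
      rewrite Cmult_0_l, Cplus_0_r. eapply Rle_trans; [apply Cmod_fsum_le|]. right.
      apply rsum_ext. intros k _. apply Cmod_mult. }
    (* For n > N one has B < n, so n |G_n| <= B max |G_j| over j < n, with G rescaled by [R0],
       cannot push a coefficient above the bound [K] of the first ones. *)
    destruct (nfloor_ex B HB0) as [N HN].
    set (K := rsum (fun k => Cmod (Gt k)) (S N)).
    assert (HK0 : 0 <= K) by (apply rsum_nonneg; intros; apply Cmod_ge_0).
    assert (Hbd : forall n, Cmod (Gt n) <= K).
    { induction n as [n IH] using lt_wf_ind. destruct (le_lt_dec n N) as [Hn|Hn].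
      - pose proof (rsum_mono (fun k => Cmod (Gt k)) (S n) (S N) (fun k => Cmod_ge_0 _) ltac:(lia)) as Hm.
        fold K in Hm. simpl in Hm. pose proof (rsum_nonneg (fun k => Cmod (Gt k)) n (fun k => Cmod_ge_0 _)). lra.
      - assert (HnB : B < INR n).
        { eapply Rlt_le_trans; [apply HN|]. rewrite <- S_INR. apply le_INR. lia. }
        specialize (Hrec n).
        assert (H1 : rsum (fun j => Cmod (scale (RtoC R0) E (n - j)%nat) * Cmod (Gt j)) n <= B * K).
        { apply Rle_trans with (rsum (fun j => K * Cmod (scale (RtoC R0) E (n - j)%nat)) n).
          - apply rsum_le. intros k Hk. rewrite Rmult_comm. apply Rmult_le_compat_r; [apply Cmod_ge_0|]. now apply IH.
          - rewrite rsum_scal, Rmult_comm. apply Rmult_le_compat_r; [exact HK0|].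
            assert (Hrev : forall (u : nat -> R) m, rsum (fun j => u (m - j)%nat) m = rsum (fun j => u (S j)) m).
            { clear. intros u m. revert u. induction m as [|m IH]; intros u; [reflexivity|].
              rewrite rsum_S_l. simpl rsum at 2. rewrite Nat.sub_0_r, <- IH. rewrite Rplus_comm. f_equal. }
            rewrite (Hrev (fun j => Cmod (scale (RtoC R0) E j))). specialize (HB (S n)). rewrite rsum_S_l in HB.
            pose proof (Cmod_ge_0 (scale (RtoC R0) E 0%nat)). lra. }
        pose proof (Cmod_ge_0 (Gt n)). apply Rnot_lt_le. intros Hlt.
        assert (B * K <= INR n * K) by (apply Rmult_le_compat_r; lra).
        assert (INR n * K < INR n * Cmod (Gt n)) by (apply Rmult_lt_compat_l; lra). lra. }
    assert (HR1 : 0 < / R0 < 1).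
    { split; [apply Rinv_0_lt_compat; lra|]. rewrite <- Rinv_1. apply Rinv_lt_contravar; lra. }
    exists K, (/ R0). split; [exact HK0|]. split; [lra|]. intros n. specialize (Hbd n).
    unfold Gt, scale in Hbd. rewrite Cmod_mult, Cmod_pow, Cmod_R, Rabs_pos_eq in Hbd by lra.
    apply (Rmult_le_compat_r ((/ R0) ^ n)) in Hbd; [|apply pow_le; lra].
    rewrite Rmult_assoc, <- Rpow_mult_distr, Rinv_r, pow1, Rmult_1_r in Hbd by lra. exact Hbd.
  - rewrite HGode. unfold E.
    transitivity (fK (RtoC alpha) * (ftheta g * ((g * e) * G)))%fps; [ring|]. rewrite He. ring.
Qed.

(* If G and P agree to order k >= 1 at z = 1, the equations of G and P force the
   next coefficient to agree, as g(1) is nonzero. *)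
Lemma bdf_power_expansion (G : fps) : geo G -> ev G (RtoC 1) = RtoC 1 ->
  (g * ftheta G)%fps = (fK (RtoC alpha) * (ftheta g * G))%fps ->
  exists H, l1 H /\ G = (ng_pol p alpha + fX ^ p * H)%fps.
Proof.
  intros HG H1 Hode. destruct (ng_pol_ode p alpha Hp) as [Q [HQ HP]]. fold g in HP.
  set (P := ng_pol p alpha) in *.
  assert (HgP : geo P) by (apply (geo_finite _ p); intros; now apply pol_degree).
  assert (C1 : Cmod (RtoC 1) <= 1) by (rewrite Cmod_1; lra).
  assert (HP1 : ev P (RtoC 1) = RtoC 1).
  { unfold P, ng_pol. rewrite ev_pol by exact C1.
    destruct p as [|d]; [lia|]. rewrite fsum_S_l, (fsum_ext _ (fun _ => RtoC 0)), fsum_0.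
    - unfold fR. simpl. ring.
    - intros k _. replace (1 - 1)%C with (RtoC 0) by ring. simpl. ring. }
  assert (Hlg : l1 g) by apply pol_l1.
  assert (Hltg : l1 (ftheta g)).
  { apply (l1_finite _ p). intros n Hn. unfold ftheta, g, bdf_pol. rewrite pol_degree by exact Hn. ring. }
  assert (Hk : forall k, (1 <= k <= p)%nat -> exists h, geo h /\ (G - P)%fps = (fX ^ k * h)%fps).
  { induction k as [|k IH]; intros Hkp; [lia|].
    destruct (Nat.eq_dec k 0) as [->|Hk0].
    - destruct (geo_div_X (G - P)%fps) as [h [Hh E]].
      + now apply geo_sub.
      + rewrite ev_sub, H1, HP1 by auto using geo_l1. ring.
      + exists h. split; [exact Hh|]. rewrite E. simpl. ring.
    - destruct IH as [h [Hh E]]; [lia|]. destruct k as [|k]; [lia|].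
      assert (Hth : l1 (ftheta h)) by now apply geo_l1, geo_theta.
      assert (Hlh : l1 h) by now apply geo_l1.
      (* The equation for X^(k+1) h, divided by X^k. Its right-hand side still contains X because k
         + 1 < p, so at z = 1 only (k+1) g(1) h(1) = 0 remains. *)
      set (L := (fX * (g * ftheta h - fK (RtoC alpha) * (ftheta g * h)) - fK (RtoC (INR (S k))) * (fz * (g * h)))%fps).
      assert (EL : L = (fz * (fX * (fX ^ (p - 1 - S k) * Q)))%fps).
      { apply (fps_mul_cancel (fX ^ k)%fps); [rewrite fX_pow_O; intros F; injection F; lra|].
        transitivity (g * ftheta (fX ^ S k * h) - fK (RtoC alpha) * (ftheta g * (fX ^ S k * h)))%fps.
        - rewrite ftheta_mul, fX_pow_theta. unfold L. simpl fpow. ring.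
        - rewrite <- E, ftheta_sub.
          transitivity (g * ftheta G - fK (RtoC alpha) * (ftheta g * G) -
             (g * ftheta P - fK (RtoC alpha) * (ftheta g * P)))%fps; [ring|].
          rewrite Hode, HP. assert (Epow : (fX ^ (p - 1))%fps = (fX ^ k * (fX * fX ^ (p - 1 - S k)))%fps).
          { replace (p - 1)%nat with (k + S (p - 1 - S k))%nat at 1 by lia. generalize (p - 1 - S k)%nat. intros m.
            clear. induction k as [|k IH]; simpl; [ring|]. rewrite IH. simpl. ring. }
          rewrite Epow. ring. }
      assert (Hh1 : ev h (RtoC 1) = RtoC 0).
      { apply (f_equal (fun f => ev f (RtoC 1))) in EL. unfold L in EL.
        rewrite ev_sub in EL by auto 10 using l1_mul, l1_sub, l1_K, l1_X, l1_z.
        rewrite (ev_mul _ C1 fX) in EL by auto 10 using l1_mul, l1_sub, l1_K, l1_X, l1_z.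
        rewrite (ev_mul _ C1 (fK _)) in EL by auto 10 using l1_mul, l1_sub, l1_K, l1_X, l1_z.
        rewrite (ev_mul _ C1 fz), (ev_mul _ C1 fz) in EL by auto 10 using l1_mul, l1_sub, l1_K, l1_X, l1_z, l1_pow.
        rewrite (ev_mul _ C1 g), (ev_mul _ C1 fX) in EL by auto 10 using l1_mul, l1_pow, l1_X.
        rewrite ev_X, ev_K, ev_z in EL by exact C1. fold g in EL. rewrite bdf_pol_at_1 in EL.
        assert (Hn : RtoC (INR (S k)) <> RtoC 0) by (apply RtoC_neq_0, not_0_INR; lia).
        replace (ev h (RtoC 1)) with (/ RtoC (INR (S k)) * (RtoC (INR (S k)) * (1 * (1 * ev h (RtoC 1)))))%C
          by (field; exact Hn).
        replace (RtoC (INR (S k)) * (1 * (1 * ev h (RtoC 1))))%C with (RtoC 0); [ring|].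
        symmetry. match type of EL with (?a - ?b = ?c)%C => transitivity (a - (a - b))%C; [ring|rewrite EL; ring] end. }
      destruct (geo_div_X h Hh Hh1) as [h' [Hh' E']].
      exists h'. split; [exact Hh'|]. rewrite E, E'. simpl fpow. ring. }
  destruct (Hk p ltac:(lia)) as [h [Hh E]].
  exists h. split; [now apply geo_l1|]. rewrite <- E. ring.
Qed.
End FractionalBDF.

Lemma fbdf_structure (p : nat) (alpha : R) (omega : C -> C) (om : nat -> C) : (1 <= p <= 6)%nat -> 0 < alpha ->
  is_fbdf p alpha omega -> is_taylor_coef omega om -> order_structure p alpha om.
Proof.
  intros Hp Ha Hf Hom.
  assert (Hbase : forall z, Cmod z <= 1 -> fbdf_base p z = ((1 - z) * ev (bdf_pol p) z)%C).
  { intros z Hz. unfold bdf_pol. rewrite ev_pol by exact Hz. unfold fbdf_base. rewrite csum_1_fsum, <- fsum_scal.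
    apply fsum_ext. intros k _. unfold fR, bdf_coef. simpl. ring. }
  (* Inside the disk a zero of g would be a zero of exp(L), which has none. *)
  assert (Hne : forall z, Cmod z <= 1 -> ev (bdf_pol p) z <> RtoC 0).
  { intros z Hz. destruct (Req_dec (Cmod z) 1) as [H1|H1]; [now apply bdf_pol_circle|].
    intros E. destruct Hf as [[L HL] _]. destruct (HL z ltac:(lra)) as [_ [Eb _]].
    rewrite Hbase, E, Cmult_0_r in Eb by exact Hz. unfold Cexp in Eb. injection Eb as E1 E2.
    pose proof (sin2_cos2 (Im (L z))) as H. unfold Rsqr in H. pose proof (exp_pos (Re (L z))).
    assert (cos (Im (L z)) = 0) by (apply (Rmult_eq_reg_l (exp (Re (L z)))); lra).
    assert (sin (Im (L z)) = 0) by (apply (Rmult_eq_reg_l (exp (Re (L z)))); lra). nra. }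
  set (gr := fun x => rsum (fun k => bdf_coef k * (1 - x) ^ k) p).
  assert (Hgpos : forall x, -1 < x < 1 -> 0 < gr x).
  { intros x Hx. unfold gr. destruct p as [|d]; [lia|]. rewrite rsum_S_l.
    assert (0 <= rsum (fun k => bdf_coef (S k) * (1 - x) ^ S k) d).
    { apply rsum_nonneg. intros k. apply Rmult_le_pos; [|apply pow_le; lra].
      apply Rlt_le, Rinv_0_lt_compat, lt_0_INR. lia. }
    replace (bdf_coef 0 * (1 - x) ^ 0) with 1 by (unfold bdf_coef; simpl; field). lra. }
  destruct (bdf_power_exists p alpha Hp Hne (RtoC (Rpower (gr 0) alpha))) as [G [HG [HG0 Hode]]].
  destruct (bounded_of_l1 G (geo_l1 G HG)) as [B HB].
  assert (Hval : forall x, -1 < x < 1 -> tsum (scale (RtoC x) G) = RtoC (Rpower (gr x) alpha)).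
  { intros x Hx. rewrite (power_series_value_pol G bdf_coef p alpha B); auto.
    fold (gr x). fold (gr 0). rewrite HG0, <- RtoC_mult, Rpower_mult_distr.
    - do 2 f_equal. field. apply Rgt_not_eq, Hgpos. lra.
    - apply Hgpos; lra.
    - apply Rdiv_lt_0_compat; apply Hgpos; lra. }
  assert (Hgr1 : gr 1 = 1).
  { unfold gr. destruct p as [|d]; [lia|]. rewrite rsum_S_l, (rsum_ext _ (fun _ => 0)), rsum_const.
    - unfold bdf_coef. simpl. lra.
    - intros k _. simpl. ring. }
  (* The power formula for G is known only on (-1,1); the value at 1 is its limit along 1 - h. *)
  assert (HG1 : ev G (RtoC 1) = RtoC 1).
  { apply Ceq_of_dist. intros eps He. assert (He2 : 0 < eps / 2) by lra.
    destruct (ev_equicont G (eps / 2) (geo_l1 G HG) He2) as [eta [Heta Heq]].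
    assert (Hcont : continuous (fun x => Rpower (gr x) alpha) 1).
    { assert (Hdg : ex_derive gr 1).
      { unfold gr. clear. induction p as [|q IH]; simpl.
        - apply ex_derive_const.
        - apply (ex_derive_plus (V := R_NormedModule)); [exact IH|]. auto_derive. easy. }
      apply (ex_derive_continuous (V := R_NormedModule)). unfold Rpower. auto_derive.
      rewrite Hgr1. repeat split; [exact Hdg|lra]. }
    destruct (proj1 (filterlim_locally _ _) Hcont (mkposreal _ He2)) as [del Hdel].
    pose proof (cond_pos del) as Hdp.
    set (h := Rmin (1 / 2) (Rmin (eta / 2) (del / 2))).
    assert (Hm : 0 < h) by (repeat apply Rmin_pos; lra).
    pose proof (Rmin_l (1 / 2) (Rmin (eta / 2) (del / 2))) as M1.
    pose proof (Rmin_r (1 / 2) (Rmin (eta / 2) (del / 2))) as M2. fold h in M1, M2.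
    pose proof (Rmin_l (eta / 2) (del / 2)) as M3. pose proof (Rmin_r (eta / 2) (del / 2)) as M4.
    assert (Hb1 : Rabs (Rpower (gr (1 - h)) alpha - Rpower (gr 1) alpha) < eps / 2).
    { apply Hdel. unfold_ball. rewrite Rabs_left; lra. }
    replace (Rpower (gr 1) alpha) with 1 in Hb1
      by (rewrite Hgr1; unfold Rpower; now rewrite ln_1, Rmult_0_r, exp_0).
    assert (Hb2 : Cmod (ev G (RtoC 1) - ev G (RtoC (1 - h))) <= eps / 2).
    { apply Heq; rewrite <- ?RtoC_minus, Cmod_R, Rabs_pos_eq; lra. }
    unfold ev at 2 in Hb2. rewrite Hval in Hb2 by lra.
    rewrite <- Cmod_R, RtoC_minus in Hb1.
    set (v := RtoC (Rpower (gr (1 - h)) alpha)) in *.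
    pose proof (Cmod_triangle (ev G (RtoC 1) - v) (v - 1)) as Ht.
    replace (ev G (RtoC 1) - v + (v - 1))%C with (ev G (RtoC 1) - 1)%C in Ht by ring. lra. }
  destruct (bdf_power_expansion p alpha Hp Hne G HG HG1 Hode) as [H [HH EG]].
  exists H. split; [exact HH|]. rewrite <- EG.
  assert (Hl : l1 (cbin (- alpha) * G)%fps) by (apply l1_mul; [now apply cbin_l1|now apply geo_l1]).
  apply (taylor_eq omega); auto. intros x Hx.
  assert (Hx1 : Cmod (RtoC x) <= 1) by (rewrite Cmod_R; apply Rabs_le; lra).
  rewrite scale_mul, tsum_mul by (apply scale_l1; auto using cbin_l1, geo_l1).
  rewrite cbin_value, Hval, <- RtoC_mult, Rpower_mult_distr by (auto; lra).
  apply (power_branch_real (fbdf_base p) omega alpha (fun x => (1 - x) * gr x)); auto.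
  intros y Hy. split.
  - rewrite Hbase by (rewrite Cmod_R; apply Rabs_le; lra). unfold bdf_pol. rewrite ev_pol_real by lra.
    fold (gr y). now rewrite RtoC_mult, RtoC_minus.
  - apply Rmult_lt_0_compat; [lra|now apply Hgpos].
Qed.

(** * Generalized Vandermonde systems *)

Lemma rsum_0 (u : nat -> R) (n : nat) : (forall k, (k < n)%nat -> u k = 0) -> rsum u n = 0.
Proof. intros H. rewrite (rsum_ext u (fun _ => 0)) by exact H. rewrite rsum_const. ring. Qed.

Lemma is_derive_power_sum (c e : nat -> R) (m : nat) (t : R) : 0 < t ->
  is_derive (fun t => rsum (fun r => c r * Rpower t (e r)) m) t
            (rsum (fun r => c r * e r * Rpower t (e r - 1)) m).
Proof.
  intros Ht. induction m as [|m IH]; simpl.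
  - apply (is_derive_const (V := R_NormedModule) 0).
  - apply (is_derive_plus (V := R_NormedModule)); [exact IH|].
    unfold Rpower. auto_derive; [exact Ht|].
    replace ((e m - 1) * ln t) with (e m * ln t + - ln t) by ring.
    rewrite exp_plus, exp_Ropp, exp_ln by exact Ht. field. lra.
Qed.

(* Descartes' bound, by Rolle after dividing by the lowest power. *)
Lemma power_sum_zeros (m : nat) : forall c s x : nat -> R,
  (forall r, (S r < m)%nat -> s r < s (S r)) -> (forall j, (j < m)%nat -> 0 < x j) ->
  (forall j, (S j < m)%nat -> x j < x (S j)) ->
  (forall j, (j < m)%nat -> rsum (fun r => c r * Rpower (x j) (s r)) m = 0) ->
  forall r, (r < m)%nat -> c r = 0.
Proof.
  induction m as [|m IH]; intros c s x Hs Hx0 Hx Hz; [lia|].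
  set (h := fun t => rsum (fun r => c r * Rpower t (s r - s O)) (S m)).
  set (dh := fun t => rsum (fun r => c r * (s r - s O) * Rpower t (s r - s O - 1)) (S m)).
  assert (Hdh : forall t, 0 < t -> is_derive h t (dh t)) by (intros; now apply is_derive_power_sum).
  assert (Hh0 : forall j, (j < S m)%nat -> h (x j) = 0).
  { intros j Hj. unfold h. rewrite (rsum_ext _ (fun r => Rpower (x j) (- s O) * (c r * Rpower (x j) (s r)))).
    - rewrite rsum_scal, Hz by exact Hj. ring.
    - intros r _. unfold Rminus. rewrite Rpower_plus. ring. }
  assert (Hroll : forall j, exists y, (j < m)%nat -> x j < y < x (S j) /\ dh y = 0).
  { intros j. destruct (lt_dec j m) as [Hj|Hj]; [|exists 0; lia].
    pose proof (Hx j ltac:(lia)) as Hlt. pose proof (Hx0 j ltac:(lia)) as Hp.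
    destruct (MVT_cor2 h dh (x j) (x (S j)) Hlt) as [y [E Hy]].
    { intros t Ht. apply is_derive_Reals, Hdh. lra. }
    exists y. intros _. split; [exact Hy|]. rewrite !Hh0 in E by lia.
    apply (Rmult_eq_reg_r (x (S j) - x j)); lra. }
  set (y := fun j => proj1_sig (constructive_indefinite_description _ (Hroll j))).
  assert (Hy : forall j, (j < m)%nat -> x j < y j < x (S j) /\ dh (y j) = 0).
  { intros j. exact (proj2_sig (constructive_indefinite_description _ (Hroll j))). }
  assert (Hs0 : forall r, (r < m)%nat -> s O < s (S r)).
  { induction r as [|r IHr]; intros Hr; [apply Hs; lia|]. specialize (IHr ltac:(lia)).
    pose proof (Hs (S r) ltac:(lia)). lra. }
  assert (Hc : forall r, (r < m)%nat -> c (S r) = 0).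
  { intros r Hr.
    assert (H : c (S r) * (s (S r) - s O) = 0).
    { apply (IH (fun r => c (S r) * (s (S r) - s O)) (fun r => s (S r) - s O - 1) y); [| | | |exact Hr].
      - intros k Hk. pose proof (Hs (S k) ltac:(lia)). lra.
      - intros j Hj. pose proof (Hx0 j ltac:(lia)). destruct (Hy j Hj). lra.
      - intros j Hj. destruct (Hy j ltac:(lia)). destruct (Hy (S j) ltac:(lia)). lra.
      - intros j Hj. destruct (Hy j Hj) as [_ E]. unfold dh in E. rewrite rsum_S_l in E.
        rewrite Rminus_diag in E. rewrite Rmult_0_r, Rmult_0_l, Rplus_0_l in E. exact E. }
    specialize (Hs0 r Hr). apply Rmult_integral in H. destruct H; [assumption|lra]. }
  intros [|r] Hr; [|apply Hc; lia].
  specialize (Hz O ltac:(lia)). rewrite rsum_S_l, rsum_0, Rplus_0_r in Hz.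
  - pose proof (exp_pos (s O * ln (x O))) as Hp. apply Rmult_integral in Hz.
    destruct Hz as [Hz|Hz]; [exact Hz|]. unfold Rpower in Hz. lra.
  - intros k Hk. rewrite Hc by exact Hk. ring.
Qed.

(** Newton-type induction: [phi] vanishes at the first m nodes, so by the bound on zeros it cannot
    vanish at the next one, and a multiple of it corrects the value there. *)
Lemma power_sum_interpolation (m : nat) : forall (s x v : nat -> R),
  (forall r, (S r < m)%nat -> s r < s (S r)) -> (forall j, (j < m)%nat -> 0 < x j) ->
  (forall j, (S j < m)%nat -> x j < x (S j)) ->
  exists c : nat -> R, forall j, (j < m)%nat -> rsum (fun r => c r * Rpower (x j) (s r)) m = v j.
Proof.
  induction m as [|m IH]; intros s x v Hs Hx0 Hx; [exists (fun _ => 0); lia|].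
  assert (IH' := fun v => IH s x v (fun r H => Hs r ltac:(lia)) (fun j H => Hx0 j ltac:(lia)) (fun j H => Hx j ltac:(lia))).
  destruct (IH' v) as [a Ha]. destruct (IH' (fun j => Rpower (x j) (s m))) as [b Hb]. clear IH'.
  set (phi := fun t => Rpower t (s m) - rsum (fun r => b r * Rpower t (s r)) m).
  assert (Hphi : phi (x m) <> 0).
  { intros E. set (d := fun r => if Nat.eq_dec r m then 1 else - b r).
    assert (Hd : forall t, rsum (fun r => d r * Rpower t (s r)) (S m) = phi t).
    { intros t. simpl. unfold d at 2. destruct (Nat.eq_dec m m); [|lia].
      rewrite (rsum_ext _ (fun r => -1 * (b r * Rpower t (s r)))).
      - rewrite rsum_scal. unfold phi. ring.
      - intros k Hk. unfold d. destruct (Nat.eq_dec k m); [lia|ring]. }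
    assert (H : d m = 0).
    { apply (power_sum_zeros (S m) d s x); auto. intros j Hj. rewrite Hd.
      destruct (Nat.eq_dec j m) as [->|]; [exact E|]. unfold phi. rewrite Hb by lia. ring. }
    unfold d in H. destruct (Nat.eq_dec m m); [lra|lia]. }
  set (l := (v m - rsum (fun r => a r * Rpower (x m) (s r)) m) / phi (x m)).
  exists (fun r => if Nat.eq_dec r m then l else a r - l * b r).
  assert (Hc : forall t, rsum (fun r => (if Nat.eq_dec r m then l else a r - l * b r) * Rpower t (s r)) (S m)
    = rsum (fun r => a r * Rpower t (s r)) m + l * phi t).
  { intros t. simpl. destruct (Nat.eq_dec m m); [|lia].
    rewrite (rsum_ext _ (fun r => a r * Rpower t (s r) - l * (b r * Rpower t (s r)))).
    - rewrite rsum_sub, rsum_scal. unfold phi. ring.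
    - intros k Hk. destruct (Nat.eq_dec k m); [lia|ring]. }
  intros j Hj. rewrite Hc. destruct (Nat.eq_dec j m) as [->|].
  - unfold l. field. exact Hphi.
  - rewrite Ha by lia. unfold phi. rewrite Hb by lia. ring.
Qed.

Lemma fsum_null (u : nat -> nat -> C) (m : nat) : (forall r, (r < m)%nat -> null_seq (u r)) ->
  null_seq (fun n => fsum (fun r => u r n) m).
Proof.
  induction m as [|m IH]; intros H; simpl.
  - intros eps He. exists O. intros. rewrite Cmod_0. lra.
  - apply (null_add (fun n => fsum (fun r => u r n) m) (u m)); [apply IH; intros|]; apply H; lia.
Qed.

(** Interpolating the indicator of one node by powers expresses the weight at that node as a linear
    combination, with coefficients independent of n, of the m null moments. *)
Lemma vandermonde_null (m : nat) (s x : nat -> R) (w : nat -> nat -> C) :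
  (forall r, (S r < m)%nat -> s r < s (S r)) -> (forall j, (j < m)%nat -> 0 < x j) ->
  (forall j, (S j < m)%nat -> x j < x (S j)) ->
  (forall r, (r < m)%nat -> null_seq (fun n => fsum (fun j => w n j * RtoC (Rpower (x j) (s r)))%C m)) ->
  forall j, (j < m)%nat -> null_seq (fun n => w n j).
Proof.
  intros Hs Hx0 Hx Hw j0 Hj0.
  destruct (power_sum_interpolation m s x (fun j => if Nat.eq_dec j j0 then 1 else 0) Hs Hx0 Hx) as [c Hc].
  apply (null_ext (fun n => fsum (fun r => RtoC (c r) * fsum (fun j => w n j * RtoC (Rpower (x j) (s r))) m)%C m) _ 0).
  - intros n _.
    rewrite (fsum_ext _ (fun r => fsum (fun j => w n j * RtoC (c r * Rpower (x j) (s r)))%C m)).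
    + rewrite fsum_exchange.
      assert (Hin : forall j, (j < m)%nat -> fsum (fun r => w n j * RtoC (c r * Rpower (x j) (s r)))%C m
         = (w n j * RtoC (if Nat.eq_dec j j0 then 1 else 0))%C).
      { intros j Hj. rewrite fsum_scal. f_equal. rewrite <- Hc by exact Hj.
        generalize m. induction m0 as [|k IHk]; simpl; [reflexivity|]. now rewrite IHk, RtoC_plus. }
      rewrite (fsum_single _ m j0 Hj0).
      * rewrite Hin by exact Hj0. destruct (Nat.eq_dec j0 j0); [ring|lia].
      * intros j Hj Hne. rewrite Hin by exact Hj. destruct (Nat.eq_dec j j0); [lia|ring].
    + intros r _. rewrite <- fsum_scal. apply fsum_ext. intros j _. rewrite RtoC_mult. ring.
  - apply fsum_null. intros r Hr. apply null_scal, Hw, Hr.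
Qed.

(** ** Finite differences of powers *)

Lemma rpow_pos (x s : R) : 0 < x -> rpow x s = Rpower x s.
Proof. intros H. unfold rpow. destruct (Rle_dec x 0); [lra|reflexivity]. Qed.

Lemma rpow_0 (s : R) : rpow 0 s = 0.
Proof. unfold rpow. destruct (Rle_dec 0 0); [reflexivity|lra]. Qed.

(** With h = 1/n the difference is tau^s n^s times 1 - (1-h)^s or 1 - 2(1-h)^s + (1-2h)^s. These
    factors are O(h^q), and s < q makes the product null. *)
Lemma backward_difference_null (q : nat) (tau s : R) : q = 1%nat \/ q = 2%nat -> 0 < tau -> s < INR q ->
  null_seq (fun n => E q (fun k => RtoC (rpow (INR k * tau) s)) n).
Proof.
  intros Hq Htau Hs.
  assert (Hpow : forall n k, (k < n)%nat -> (2 * k <= n)%nat ->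
     rpow (INR (n - k) * tau) s = Rpower tau s * (Rpower (INR n) s * Rpower (1 - INR k * / INR n) s)).
  { intros n k Hk Hkn. assert (Hn : 0 < INR n) by (apply lt_0_INR; lia).
    assert (Hnk : 0 < INR (n - k)) by (apply lt_0_INR; lia).
    assert (E : INR n * (1 - INR k * / INR n) = INR (n - k)) by (rewrite minus_INR by lia; field; lra).
    rewrite rpow_pos by nra. rewrite Rpower_mult_distr; [|exact Hn|nra].
    rewrite E, Rpower_mult_distr by assumption. f_equal. ring. }
  assert (Hlim : forall D : nat -> R, pow_bigO (- INR q) D ->
     null_seq (fR (fun n => Rpower tau s * (Rpower (INR n) s * D n)))).
  { intros D HD. apply null_of_lim, (bigO_neg_lim (s + - INR q)); [lra|].
    apply bigO_scal, bigO_mul; [apply bigO_Rpower|exact HD]. }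
  destruct Hq as [-> | ->].
  - destruct (binomial_taylor 1 s) as (K & HK & HT).
    apply (null_ext (fR (fun n => Rpower tau s * (Rpower (INR n) s * (1 - Rpower (1 - / INR n) s)))) _ 2).
    + intros n Hn. unfold fR, Defs.E, Defs.E1. cbv beta iota. rewrite <- RtoC_minus. f_equal.
      rewrite (Hpow n 1%nat) by lia. pose proof (Hpow n O ltac:(lia) ltac:(lia)) as H0.
      rewrite Nat.sub_0_r in H0. rewrite H0. simpl INR. rewrite Rmult_0_l, Rminus_0_r, Rmult_1_l.
      replace (Rpower 1 s) with 1 by (unfold Rpower; now rewrite ln_1, Rmult_0_r, exp_0). ring.
    + apply Hlim. exists K, 2%nat. split; [exact HK|]. intros n Hn.
      rewrite Rpower_INR_opp_nat by lia.
      assert (Hh : 0 <= / INR n <= / 2).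
      { split; [apply Rlt_le, Rinv_0_lt_compat, lt_0_INR; lia|apply Rinv_le_contravar; [lra|apply (le_INR 2); lia]]. }
      specialize (HT _ Hh). simpl rsum in HT. rewrite Rabs_minus_sym.
      replace (Rpower (1 - / INR n) s - 1) with (Rpower (1 - / INR n) s - (0 + 1 * 1)) by ring. exact HT.
  - destruct (binomial_taylor 2 s) as (K & HK & HT).
    apply (null_ext (fR (fun n => Rpower tau s * (Rpower (INR n) s *
       (1 - 2 * Rpower (1 - / INR n) s + Rpower (1 - 2 * / INR n) s)))) _ 4).
    + intros n Hn. unfold fR, Defs.E, Defs.E2. cbv beta iota. rewrite <- RtoC_mult, <- RtoC_minus, <- RtoC_plus. f_equal.
      rewrite (Hpow n 1%nat), (Hpow n 2%nat) by lia. pose proof (Hpow n O ltac:(lia) ltac:(lia)) as H0.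
      rewrite Nat.sub_0_r in H0. rewrite H0. simpl INR. rewrite Rmult_0_l, Rminus_0_r, Rmult_1_l.
      replace (Rpower 1 s) with 1 by (unfold Rpower; now rewrite ln_1, Rmult_0_r, exp_0).
      replace (1 + 1) with 2 by ring. ring.
    (* 2K comes from the remainder at h and 4K from the one at 2h; n >= 4 keeps 2h below 1/2. *)
    + apply Hlim. exists (6 * K), 4%nat. split; [lra|]. intros n Hn.
      rewrite Rpower_INR_opp_nat by lia.
      assert (Hn0 : 0 < INR n) by (apply lt_0_INR; lia).
      assert (Hh : 0 <= / INR n <= / 4).
      { split; [apply Rlt_le, Rinv_0_lt_compat; lra|apply Rinv_le_contravar; [lra|]].
        replace 4 with (INR 4) by (simpl; ring). apply le_INR. lia. }
      set (h := / INR n) in *.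
      pose proof (HT h ltac:(lra)) as T1. pose proof (HT (2 * h) ltac:(lra)) as T2.
      assert (Hb : forall k, rsum (fun j => bin_seq (- s) j * k ^ j) 2 = 1 - s * k).
      { intros k. simpl. field. }
      rewrite Hb in T1, T2.
      apply Rabs_le_between in T1. apply Rabs_le_between in T2. apply Rabs_le.
      simpl pow in *. split; nra.
Qed.

(** * Stability *)

Definition disk_continuous (f : C -> C) : Prop :=
  forall z, Cmod z <= 1 -> forall eps, 0 < eps -> exists eta, 0 < eta /\
    forall y, Cmod y <= 1 -> Cmod (y - z) < eta -> Cmod (f y - f z) < eps.

Lemma power_branch_disk_continuous (b f : C -> C) (alpha : R) :
  is_power_branch b alpha f -> disk_continuous f.
Proof.
  intros [_ [_ H]] z Hz eps He. specialize (H z Hz (fun v => Cmod (v - f z) < eps)).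
  assert (He2 : 0 < eps / 2) by lra.
  destruct H as [eta Heta].
  - exists (mkposreal _ He2). intros v [H1 H2]. 
    unfold ball in H1, H2; simpl in H1, H2. unfold AbsRing_ball, abs, minus, plus, opp in H1, H2; simpl in H1, H2.
    eapply Rle_lt_trans; [apply Cmod_le_re_im|]. unfold Re, Im; simpl. lra.
  - exists eta. split; [apply cond_pos|]. intros y Hy Hyz. apply Heta; [|exact Hy].
    pose proof (re_le_Cmod (y - z)). pose proof (im_le_Cmod (y - z)).
    split; unfold_ball;
      unfold Re, Im in *; simpl in *; lra.
Qed.

Lemma disk_continuous_mul (f : C -> C) (a : fps) : l1 a -> disk_continuous f ->
  disk_continuous (fun z => f z * ev a z)%C.
Proof.
  intros [A HA] Hf z Hz eps He. pose proof (sums_le_nonneg _ _ HA) as HA0.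
  pose proof (Cmod_ge_0 (f z)) as Hfz.
  destruct (Hf z Hz (eps / 2 / (A + 1))) as [e1 [He1 H1]]; [repeat apply Rdiv_lt_0_compat; lra|].
  destruct (ev_equicont a (eps / 2 / (Cmod (f z) + 1)) (ex_intro _ A HA)) as [e2 [He2 H2]];
    [repeat apply Rdiv_lt_0_compat; lra|].
  exists (Rmin e1 e2). split; [now apply Rmin_pos|]. intros y Hy Hyz.
  pose proof (Rmin_l e1 e2). pose proof (Rmin_r e1 e2).
  specialize (H1 y Hy ltac:(lra)). specialize (H2 y z Hy Hz ltac:(lra)).
  replace (f y * ev a y - f z * ev a z)%C with ((f y - f z) * ev a y + f z * (ev a y - ev a z))%C by ring.
  eapply Rle_lt_trans; [apply Cmod_triangle|]. rewrite !Cmod_mult.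
  pose proof (ev_bound y Hy a A HA). pose proof (Cmod_ge_0 (ev a y)). pose proof (Cmod_ge_0 (f y - f z)).
  set (u := eps / 2 / (A + 1)) in *. set (v := eps / 2 / (Cmod (f z) + 1)) in *.
  assert (Eu : u * (A + 1) = eps / 2) by (unfold u; field; lra).
  assert (Ev : v * (Cmod (f z) + 1) = eps / 2) by (unfold v; field; lra).
  assert (0 < u) by (unfold u; repeat apply Rdiv_lt_0_compat; lra).
  assert (0 < v) by (unfold v; repeat apply Rdiv_lt_0_compat; lra).
  assert (Cmod (f y - f z) * Cmod (ev a y) <= u * A) by (apply Rmult_le_compat; lra).
  assert (Cmod (f z) * Cmod (ev a y - ev a z) <= Cmod (f z) * v) by (apply Rmult_le_compat_l; lra).
  nra.
Qed.

Lemma disk_continuous_ext (f h : C -> C) : (forall z, Cmod z <= 1 -> f z = h z) ->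
  disk_continuous f -> disk_continuous h.
Proof.
  intros E Hf z Hz eps He. destruct (Hf z Hz eps He) as [eta [H0 H]]. exists eta. split; [exact H0|].
  intros y Hy Hyz. rewrite <- !E by assumption. now apply H.
Qed.

(** Both sides are continuous on the closed disk and agree inside it; the point z is approached
    along (1-h) z. *)
Lemma taylor_closed_disk (omega : C -> C) (om : fps) : is_taylor_coef omega om -> l1 om ->
  disk_continuous omega -> forall z, Cmod z <= 1 -> ev om z = omega z.
Proof.
  intros Hom Hl Hc z Hz. apply Ceq_of_dist. intros eps He.
  destruct (Hc z Hz (eps / 2)) as [e1 [He1 H1]]; [lra|].
  destruct (ev_equicont om (eps / 2) Hl) as [e2 [He2 H2]]; [lra|].
  set (h := Rmin (1 / 2) (Rmin (e1 / 2) e2)).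
  assert (Hh : 0 < h) by (repeat apply Rmin_pos; lra).
  pose proof (Rmin_l (1 / 2) (Rmin (e1 / 2) e2)) as M1. pose proof (Rmin_r (1 / 2) (Rmin (e1 / 2) e2)) as M2.
  pose proof (Rmin_l (e1 / 2) e2) as M3. pose proof (Rmin_r (e1 / 2) e2) as M4. fold h in M1, M2.
  set (y := (RtoC (1 - h) * z)%C). pose proof (Cmod_ge_0 z) as Hz0.
  assert (Hy : Cmod y < 1) by (unfold y; rewrite Cmod_mult, Cmod_R, Rabs_pos_eq by lra; nra).
  assert (Hyz : Cmod (y - z) <= h).
  { unfold y. replace (RtoC (1 - h) * z - z)%C with (RtoC (- h) * z)%C by (rewrite RtoC_minus, RtoC_opp; ring).
    rewrite Cmod_mult, Cmod_R, Rabs_Ropp, Rabs_pos_eq by lra. nra. }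
  specialize (H1 y ltac:(lra) ltac:(lra)). specialize (H2 y z ltac:(lra) Hz ltac:(lra)).
  assert (E : ev om y = omega y) by now apply taylor_tsum.
  pose proof (Cmod_triangle (omega y - omega z) (- (ev om y - ev om z))) as Ht.
  rewrite Cmod_opp in Ht. rewrite E in Ht, H2.
  replace (omega y - omega z + - (omega y - ev om z))%C with (ev om z - omega z)%C in Ht by ring.
  lra.
Qed.

Lemma filterlim_of_null (U : nat -> C) : null_seq U -> filterlim U eventually (locally (RtoC 0)).
Proof.
  intros H P [eps HP]. destruct (H (eps / 2)) as [N HN]; [pose proof (cond_pos eps); lra|].
  exists N. intros n Hn. apply HP. specialize (HN n Hn). pose proof (cond_pos eps).
  pose proof (re_le_Cmod (U n)). pose proof (im_le_Cmod (U n)).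
  split; unfold_ball;
    rewrite Ropp_0, Rplus_0_r; unfold Re, Im in *; lra.
Qed.

(** For n < q the subtraction of naturals in [E1] and [E2] is truncated, whereas the convolution
    reads missing terms as zero; the two agree from q on. *)
Lemma E_fmul (q : nat) (U : fps) (n : nat) : q = 1%nat \/ q = 2%nat -> (q <= n)%nat ->
  Defs.E q U n = fmul (fX ^ q)%fps U n.
Proof.
  intros Hq Hn. assert (H1 : (fX ^ 1)%fps = fX) by (simpl; ring).
  destruct Hq as [-> | ->].
  - rewrite H1. destruct n as [|n]; [lia|]. rewrite fX_mul_S. unfold Defs.E, Defs.E1.
    rewrite Nat.sub_succ, Nat.sub_0_r. reflexivity.
  - replace (fX ^ 2 * U)%fps with (fX * (fX * U))%fps by (simpl; ring).
    destruct n as [|[|n]]; try lia. rewrite fX_mul_S, !fX_mul_S. unfold Defs.E, Defs.E2.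
    replace (S (S n) - 1)%nat with (S n) by lia. replace (S (S n) - 2)%nat with n by lia. ring.
Qed.

(** * The scheme as a convolution equation *)

Lemma cbin_1_mul (a : fps) (c : C) (U : nat -> C) (n : nat) :
  fsum (fun j => a (n - j)%nat * (U j - c))%C (S n) = (fmul a U n - c * fmul a (cbin 1) n)%C.
Proof.
  unfold fmul. rewrite <- fsum_scal.
  rewrite (fsum_ext _ (fun j => a (n - j)%nat * U j + RtoC (-1) * (c * (a (n - j)%nat * cbin 1 j)))%C).
  - rewrite fsum_add, fsum_scal. change (-1) with (- (1)). rewrite RtoC_opp. ring.
  - intros k _. unfold cbin, fR. rewrite bin_seq_1. change (-1) with (- (1)). rewrite RtoC_opp. ring.
Qed.

Definition corr (m : nat) (w U : nat -> C) : C :=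
  fsum (fun j => w (S j) * (U (S j) - U O))%C m.

Lemma corr_scal (m : nat) (w U : nat -> C) (c : C) :
  csum (fun j => w j * (c * U j - c * U O))%C 1 m = (c * corr m w U)%C.
Proof.
  rewrite csum_1_fsum. unfold corr. rewrite <- fsum_scal. apply fsum_ext. intros; ring.
Qed.

(** Involves U only at the indices 0, ..., max(m, mu, mf), all below [n_star], so the right-hand
    side is fixed by the starting values. *)
Definition method_rhs (T : R) (rho kappa : C) (om : fps) (m mu mf : nat) (w wu wf U : nat -> C) (n : nat) : C :=
  (U O * fmul om (cbin 1) n - corr m w U + RtoC T * (rho * corr mf wf U + kappa * corr mu wu U))%C.

(** Its value at z is the expression that [step_admissible] requires to be nonzero. *)
Definition method_symbol (T : R) (q : nat) (lambda rho kappa : C) (om : fps) : fps :=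
  (om - fK (RtoC T) * (fK (lambda + rho)%C - fK (rho + kappa)%C * fX ^ q))%fps.

Lemma method_iff (tau alpha : R) (q : nat) (lambda rho kappa : C) (om : nat -> C) (m mu mf : nat)
  (w wu wf U : nat -> C) (n : nat) : q = 1%nat \/ q = 2%nat -> (q <= n)%nat ->
  method_at tau alpha q lambda rho kappa om m mu mf w wu wf U n <->
  fmul (method_symbol (Rpower tau alpha) q lambda rho kappa om) U n =
  method_rhs (Rpower tau alpha) rho kappa om m mu mf w wu wf U n.
Proof.
  intros Hq Hn. set (T := Rpower tau alpha).
  assert (HT : RtoC T <> RtoC 0) by (apply RtoC_neq_0, Rgt_not_eq, exp_pos).
  unfold method_at, frac_op, E_corr. fold T.
  rewrite (E_fmul q (fun k => rho * U k)%C n Hq Hn), (E_fmul q U n Hq Hn).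
  rewrite csum_0_fsum, cbin_1_mul, corr_scal.
  replace (csum (fun j => w j * (U j - U O))%C 1 m) with (corr m w U) by (unfold corr; now rewrite csum_1_fsum).
  replace (csum (fun j => wu j * (U j - U O))%C 1 mu) with (corr mu wu U) by (unfold corr; now rewrite csum_1_fsum).
  replace (fmul (fX ^ q)%fps (fun k => rho * U k)%C n) with (rho * fmul (fX ^ q)%fps U n)%C.
  2:{ rewrite !(fmul_comm (fX ^ q)%fps). symmetry. apply fmul_scal_l. }
  assert (E : fmul (method_symbol T q lambda rho kappa om) U n =
    (fmul om U n - RtoC T * ((lambda + rho) * U n - (rho + kappa) * fmul (fX ^ q)%fps U n))%C).
  { unfold method_symbol.
    replace ((om - fK (RtoC T) * (fK (lambda + rho)%C - fK (rho + kappa)%C * fX ^ q)) * U)%fps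
      with (om * U - fK (RtoC T) * (fK (lambda + rho)%C * U - fK (rho + kappa)%C * (fX ^ q * U)))%fps by ring.
    unfold fsub at 1. rewrite fmul_K_l. unfold fsub. now rewrite !fmul_K_l. }
  rewrite E. unfold method_rhs.
  set (A := fmul om U n). set (S0 := fmul om (cbin 1) n). set (X := fmul (fX ^ q)%fps U n).
  split; intros H.
  - apply (f_equal (fun x => RtoC T * x)%C) in H.
    transitivity (RtoC T * (/ RtoC T * (A - U O * S0) + / RtoC T * corr m w U)
      + (U O * S0 - corr m w U) - RtoC T * ((lambda + rho) * U n - (rho + kappa) * X))%C; [field; exact HT|].
    rewrite H. ring.
  - transitivity (/ RtoC T * ((A - RtoC T * ((lambda + rho) * U n - (rho + kappa) * X)) - U O * S0 + corr m w U)
      + ((lambda + rho) * U n - (rho + kappa) * X))%C; [field; exact HT|].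
    rewrite H. field. exact HT.
Qed.

Lemma increasing_le (s : nat -> R) (m : nat) : (forall r, (1 <= r)%nat -> s r < s (r + 1)%nat) ->
  forall r, (1 <= r <= m)%nat -> s r <= s m.
Proof.
  intros Hs r Hr. replace m with (r + (m - r))%nat by lia. generalize (m - r)%nat. intros k.
  induction k as [|k IH]; [rewrite Nat.add_0_r; lra|].
  specialize (Hs (r + k)%nat ltac:(lia)). replace (r + S k)%nat with (r + k + 1)%nat by lia. lra.
Qed.

Lemma increasing_pos (s : nat -> R) : 0 < s 1%nat -> (forall r, (1 <= r)%nat -> s r < s (r + 1)%nat) ->
  forall r, (1 <= r)%nat -> 0 < s r.
Proof.
  intros H0 Hs r Hr. pose proof (increasing_le s r Hs 1 ltac:(lia)). lra.
Qed.

(** The defining system makes the sums over j of w_(n,j) j^(sigma_r) equal to minus the quadrature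
    errors, which tend to zero; [vandermonde_null] passes from these sums to the weights. *)
Lemma starting_weights_null (p m N : nat) (alpha : R) (om : fps) (sigma : nat -> R) (w : nat -> nat -> C) :
  0 < alpha <= 1 -> (1 <= p <= 6)%nat -> order_structure p alpha om ->
  0 < sigma 1%nat -> (forall r, (1 <= r)%nat -> sigma r < sigma (r + 1)%nat) ->
  ((1 <= m)%nat -> sigma m < alpha + INR p) ->
  (forall n, (N <= n)%nat -> starting_weights alpha om m sigma n (w n)) ->
  forall j, (j < m)%nat -> null_seq (fun n => w n (S j)).
Proof.
  intros Ha Hp Hom H0 Hs Hm Hw.
  apply (vandermonde_null m (fun r => sigma (S r)) (fun j => INR (S j)) (fun n j => w n (S j))).
  - intros r Hr. specialize (Hs (S r) ltac:(lia)). rewrite Nat.add_1_r in Hs. exact Hs.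
  - intros j _. apply lt_0_INR. lia.
  - intros j _. apply lt_INR. lia.
  - intros r Hr.
    assert (Hr1 : 0 < sigma (S r)) by (apply increasing_pos; auto; lia).
    assert (Hr2 : sigma (S r) <= sigma m) by (apply increasing_le; auto; lia).
    specialize (Hm ltac:(lia)).
    pose proof (quadrature_error p alpha om Ha Hp Hom (sigma (S r)) ltac:(lra)) as Hq.
    apply (null_scal (- RtoC 1)%C) in Hq. eapply (null_ext _ _ N); [|exact Hq].
    intros n Hn. specialize (Hw n Hn (S r) ltac:(lia)). rewrite csum_0_fsum, csum_1_fsum in Hw.
    cbv beta. rewrite <- Hw. unfold fmul, fR.
    rewrite (fsum_ext (fun j => w n (S j) * RtoC (Rpower (INR (S j)) (sigma (S r))))%C
      (fun j => w n (S j) * RtoC (rpow (INR (S j)) (sigma (S r))))%C).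
    + ring.
    + intros j _. rewrite rpow_pos; [reflexivity|]. apply lt_0_INR. lia.
Qed.

(** The nodes are now j tau, and the moments are the backward differences of the powers
    themselves. *)
Lemma perturbation_weights_null (q m N : nat) (tau : R) (sigma : nat -> R) (w : nat -> nat -> C) :
  q = 1%nat \/ q = 2%nat -> 0 < tau -> 
  0 < sigma 1%nat -> (forall r, (1 <= r)%nat -> sigma r < sigma (r + 1)%nat) ->
  ((1 <= m)%nat -> sigma m < INR q) ->
  (forall n, (N <= n)%nat -> perturbation_weights tau q m sigma n (w n)) ->
  forall j, (j < m)%nat -> null_seq (fun n => w n (S j)).
Proof.
  intros Hq Htau H0 Hs Hm Hw.
  apply (vandermonde_null m (fun r => sigma (S r)) (fun j => INR (S j) * tau) (fun n j => w n (S j))).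
  - intros r Hr. specialize (Hs (S r) ltac:(lia)). rewrite Nat.add_1_r in Hs. exact Hs.
  - intros j _. apply Rmult_lt_0_compat; [apply lt_0_INR; lia|exact Htau].
  - intros j _. apply Rmult_lt_compat_r; [exact Htau|]. apply lt_INR. lia.
  - intros r Hr.
    assert (Hr2 : sigma (S r) <= sigma m) by (apply increasing_le; auto; lia).
    specialize (Hm ltac:(lia)).
    pose proof (backward_difference_null q tau (sigma (S r)) Hq Htau ltac:(lra)) as Hd.
    eapply (null_ext _ _ N); [|exact Hd]. intros n Hn. specialize (Hw n Hn (S r) ltac:(lia)).
    unfold E_corr in Hw. rewrite csum_1_fsum in Hw.
    match type of Hw with (?a - ?b)%C = _ => transitivity b end.
    + match type of Hw with (?a - ?b)%C = _ => replace a with (a - b + b)%C by ring end. rewrite Hw. ring.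
    + apply fsum_ext. intros j _. simpl (INR 0). rewrite Rmult_0_l, rpow_0, rpow_pos; [ring|].
      apply Rmult_lt_0_compat; [apply lt_0_INR; lia|exact Htau].
Qed.

Lemma corr_null (m : nat) (w : nat -> nat -> C) (U : nat -> C) :
  (forall j, (j < m)%nat -> null_seq (fun n => w n (S j))) -> null_seq (fun n => corr m (w n) U).
Proof.
  intros H. unfold corr. apply (fsum_null (fun j n => w n (S j) * (U (S j) - U O))%C). intros j Hj.
  apply (null_ext (fun n => (U (S j) - U O) * w n (S j))%C _ 0); [intros; ring|]. now apply null_scal, H.
Qed.

(** Since d_0 = d(0) is nonzero, the n-th equation determines U_n from the earlier values, which
    gives existence and uniqueness. *)
Lemma convolution_stable (n0 : nat) (d : fps) (rhs : (nat -> C) -> nat -> C)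
  (eqn : (nat -> C) -> nat -> Prop) :
  l1 d -> (forall z, Cmod z <= 1 -> ev d z <> RtoC 0) ->
  (forall U n, (n0 <= n)%nat -> eqn U n <-> fmul d U n = rhs U n) ->
  (forall U U' n, (n0 <= n)%nat -> (forall k, (k < n0)%nat -> U k = U' k) -> rhs U n = rhs U' n) ->
  (forall U, null_seq (rhs U)) ->
  stable n0 eqn.
Proof.
  intros Hd Hne Heqn Hdep Hnull V.
  assert (Hd0 : d O <> RtoC 0) by (rewrite <- ev_0; apply Hne; rewrite Cmod_0; lra).
  destruct (fps_inverse d Hd0) as [e He]. pose proof (wiener d e Hd He Hne) as Hle.
  set (F := fun n (u : nat -> C) => if le_lt_dec n0 n
     then (/ d O * (rhs u n - fsum (fun j => d (n - j)%nat * u j) n))%C else V n).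
  assert (Hconv : forall (u : nat -> C) n, (n0 <= n)%nat -> (fmul d u n = rhs u n <-> u n = F n u)).
  { intros u n Hn. unfold F. destruct (le_lt_dec n0 n); [|lia].
    assert (E : fmul d u n = (fsum (fun j => d (n - j)%nat * u j) n + d O * u n)%C).
    { unfold fmul. simpl fsum. now rewrite Nat.sub_diag. }
    rewrite E. set (S0 := fsum (fun j => d (n - j)%nat * u j)%C n). split; intros H.
    - rewrite <- H. field. exact Hd0.
    - rewrite H at 1. field. exact Hd0. }
  assert (HF : forall n u v, (forall k, (k < n)%nat -> u k = v k) -> F n u = F n v).
  { intros n u v H. unfold F. destruct (le_lt_dec n0 n) as [Hn|Hn]; [|reflexivity].
    rewrite (Hdep u v n Hn) by (intros; apply H; lia).
    rewrite (fsum_ext _ (fun j => d (n - j)%nat * v j)%C) by (intros; rewrite H by assumption; reflexivity).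
    reflexivity. }
  assert (HVF : forall n u, (n < n0)%nat -> F n u = V n).
  { intros n u Hn. unfold F. destruct (le_lt_dec n0 n); [lia|reflexivity]. }
  destruct (course_of_values (RtoC 0) F HF) as [U HU].
  assert (Hsol : forall n, (n0 <= n)%nat -> fmul d U n = rhs U n) by (intros n Hn; apply Hconv, HU; exact Hn).
  exists U. split; [split|split].
  - intros n Hn. rewrite HU. now apply HVF.
  - intros n Hn. apply Heqn; auto.
  - intros U' [HV HE] n. induction n as [n IH] using lt_wf_ind.
    destruct (le_lt_dec n0 n) as [Hn|Hn].
    + pose proof (proj1 (Hconv U' n Hn) (proj1 (Heqn U' n Hn) (HE n Hn))) as E.
      rewrite E, (HU n). apply HF. exact IH.
    + rewrite HV, HU, HVF by exact Hn. reflexivity.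
  - apply filterlim_of_null.
    replace U with (e * (d * U))%fps by (transitivity ((d * e) * U)%fps; [ring|rewrite He; ring]).
    (* Below n0 the starting values leave d * U arbitrary; finitely many terms do not affect the
       limit. *)
    apply null_l1_mul; [exact Hle|]. apply (null_ext (rhs U) _ n0); [|apply Hnull].
    intros n Hn. symmetry. now apply Hsol.
Qed.

Theorem theorem2p2
  (alpha : R) (p q : nat) (lambda rho kappa : C)
  (omega : C -> C) (om : nat -> C)
  (m mu mf : nat) (sigma delta : nat -> R)
  (tau : R) (w wu wf : nat -> nat -> C)
  (halpha : 0 < alpha <= 1)
  (hp : (1 <= p <= 6)%nat)
  (hq : q = 1%nat \/ q = 2%nat)
  (hlambda : Re lambda < 0)
  (homega : is_fbdf p alpha omega \/ is_newton_gregory p alpha omega)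
  (hom : is_taylor_coef omega om)
  (hsigma0 : 0 < sigma 1%nat)
  (hsigma : forall r : nat, (1 <= r)%nat -> sigma r < sigma (r + 1)%nat)
  (hdelta0 : 0 < delta 1%nat)
  (hdelta : forall r : nat, (1 <= r)%nat -> delta r < delta (r + 1)%nat)
  (hdelta_mem : forall r : nat, (1 <= r)%nat ->
     exists k : nat, (1 <= k)%nat /\
       (delta r = sigma k \/ delta r = sigma k - alpha))
  (htau : 0 < tau)
  (htauS : step_admissible omega alpha q lambda rho kappa tau)
  (hm : (1 <= m)%nat -> sigma m < alpha + INR p)
  (hmu : (1 <= mu)%nat -> sigma mu < INR q)
  (hmf : (1 <= mf)%nat -> delta mf < INR q)
  (hw : forall n : nat, (n_star m mu mf q <= n)%nat ->
     starting_weights alpha om m sigma n (w n))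
  (hwu : forall n : nat, (n_star m mu mf q <= n)%nat ->
     perturbation_weights tau q mu sigma n (wu n))
  (hwf : forall n : nat, (n_star m mu mf q <= n)%nat ->
     perturbation_weights tau q mf delta n (wf n)) :
  stable (n_star m mu mf q)
    (fun U n =>
       method_at tau alpha q lambda rho kappa om m mu mf (w n) (wu n) (wf n) U n).
Proof.
  assert (Hstruct : order_structure p alpha om).
  { destruct homega as [Hf|Hng]; [apply (fbdf_structure p alpha omega)|apply (newton_gregory_structure p alpha omega)];
      auto; lra. }
  assert (Hl1 : l1 om) by (apply (order_structure_l1 p alpha); assumption).
  assert (Hcont : disk_continuous omega).
  { destruct homega as [Hf|[f [Hf E]]]; [eapply power_branch_disk_continuous; exact Hf|].
    apply (disk_continuous_ext (fun z => f z * ev (ng_pol p alpha) z)%C).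
    - intros z Hz. rewrite E by exact Hz. unfold ng_pol. rewrite ev_pol, csum_1_fsum by exact Hz. f_equal.
      apply fsum_ext. intros k _. simpl. now rewrite Nat.sub_0_r.
    - apply disk_continuous_mul; [apply pol_l1|]. eapply power_branch_disk_continuous; exact Hf. }
  set (T := Rpower tau alpha). set (N := n_star m mu mf q).
  assert (HN : (m < N /\ mu < N /\ mf < N /\ q <= N)%nat) by (unfold N, n_star; lia).
  apply (convolution_stable N (method_symbol T q lambda rho kappa om)
    (fun U n => method_rhs T rho kappa om m mu mf (w n) (wu n) (wf n) U n)).
  - unfold method_symbol. repeat apply l1_sub || apply l1_mul || apply l1_K; auto. apply l1_pow, l1_X.
  - intros z Hz. unfold method_symbol.
    rewrite ev_sub, ev_mul, ev_sub, ev_mul, ev_pow, !ev_K, ev_X, (taylor_closed_disk omega om)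
      by auto 10 using l1_mul, l1_sub, l1_K, l1_pow, l1_X.
    apply htauS, Hz.
  - intros U n Hn. apply method_iff; [exact hq|lia].
  - intros U U' n Hn H. unfold method_rhs, corr. rewrite (H O) by lia.
    rewrite (fsum_ext (fun j => w n (S j) * (U (S j) - U' O))%C (fun j => w n (S j) * (U' (S j) - U' O))%C m)
      by (intros; rewrite H by lia; reflexivity).
    rewrite (fsum_ext (fun j => wu n (S j) * (U (S j) - U' O))%C (fun j => wu n (S j) * (U' (S j) - U' O))%C mu)
      by (intros; rewrite H by lia; reflexivity).
    rewrite (fsum_ext (fun j => wf n (S j) * (U (S j) - U' O))%C (fun j => wf n (S j) * (U' (S j) - U' O))%C mf)
      by (intros; rewrite H by lia; reflexivity).
    reflexivity.
  - intros U. unfold method_rhs.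
    assert (Hcw : null_seq (fun n => corr m (w n) U))
      by (apply corr_null, (starting_weights_null p m N alpha om sigma); assumption).
    assert (Hcu : null_seq (fun n => corr mu (wu n) U))
      by (apply corr_null, (perturbation_weights_null q mu N tau sigma); assumption).
    assert (Hcf : null_seq (fun n => corr mf (wf n) U))
      by (apply corr_null, (perturbation_weights_null q mf N tau delta); assumption).
    assert (Hs : null_seq (om * cbin 1)%fps)
      by (apply (order_structure_sums_null p alpha); assumption).
    apply (null_scal (U O)) in Hs. apply (null_scal (- RtoC 1)%C) in Hcw.
    apply (null_scal (RtoC T * rho)%C) in Hcf. apply (null_scal (RtoC T * kappa)%C) in Hcu.
    eapply (null_ext _ _ 0); [|exact (null_add _ _ (null_add _ _ Hs Hcw) (null_add _ _ Hcf Hcu))].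
    intros n _. unfold fadd. ring.
Qed.
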